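(* The problem $1|\mathrm{prec}|k\text{-sched},C_{\max}$ is $\mathsf{W}[1]$-hard parameterized by $k$.
   Context: Problem $1|\mathrm{prec}|k\text{-sched},C_{\max}$: the input consists of a single machine, a set of jobs with positive integer processing times $p_j$, a directed acyclic precedence graph on the jobs ($a\prec b$ if there is a path from $a$ to $b$), an integer $k$, and a bound $C_{\max}$. A (partial) schedule selects a subset of jobs and processes them non-preemptively on the machine, one at a time, starting at time $0$ or later; if a selected job $b$ has $a\prec b$, then $a$ must be selected and completed before $b$ starts. The question is whether a schedule processing at least $k$ jobs with makespan (maximum completion time) at most $C_{\max}$ exists. *)

(* Defs.v *)
From mathcomp Require Import all_boot all_order all_algebra.
Set Implicit Arguments.
Unset Strict Implicit.
Unset Printing Implicit Defensive.
Import Order.TTheory GRing.Theory Num.Theory.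

(** * Model of computation

    Multi-stack machines over the alphabet {0,1} with structured control.  A
    program uses finitely many registers, each holding a stack of bits, and
    every primitive step (a push, a pop, a test of a top symbol) costs one unit.
    Two stacks are one Turing tape, and a finite control is simulated by one
    [While] around nested [Case]s, so these machines and multi-tape Turing
    machines simulate each other with constant-factor overhead. *)

Inductive prog : Type :=
| Skip
| Push of nat & bool
| Pop of nat
| Seq of prog & prog
| Case of nat & prog & prog & prog (* register empty / top is 0 / top is 1 *)
| While of nat & prog.             (* as long as the register is nonempty *)

Definition store := nat -> seq bool.

Definition upd (st : store) (r : nat) (s : seq bool) : store :=
  fun i => if i == r then s else st i.

(* [exec p st t st']: started in [st], [p] halts in [st'] after [t] steps. *)
Inductive exec : prog -> store -> nat -> store -> Prop :=
| exec_skip st : exec Skip st 1 st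
| exec_push st r b : exec (Push r b) st 1 (upd st r (b :: st r))
| exec_pop st r : exec (Pop r) st 1 (upd st r (behead (st r)))
| exec_seq p q st t st' u st'' :
    exec p st t st' -> exec q st' u st'' -> exec (Seq p q) st (t + u) st''
| exec_case r pe p0 p1 st t st' :
    exec (match st r with
          | [::] => pe
          | b :: _ => if b then p1 else p0
          end) st t st' ->
    exec (Case r pe p0 p1) st t.+1 st'
| exec_while_stop r p st : st r = [::] -> exec (While r p) st 1 st
| exec_while_step r p st t st' u st'' :
    st r <> [::] -> exec p st t st' -> exec (While r p) st' u st'' ->
    exec (While r p) st (t + u).+1 st''.

Definition init (args : seq (seq bool)) : store := nth [::] args.

Definition unary (n : nat) : seq bool := nseq n true.

Definition computable (f : nat -> nat) : Prop :=
  exists p : prog, forall n, exists (t : nat) (st : store),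
    exec p (init [:: unary n]) t st /\ st 0 = unary (f n).

(** * Parameterized problems and the W-hierarchy

    The definitions are those of M. Cygan et al., Parameterized Algorithms,
    Springer 2015, Chapter 13. *)

(* A parameterized problem is a subset of {0,1}^* x N. *)
Definition param_problem := seq bool -> nat -> Prop.

(* The machine receives [x] in register 0 and the parameter in unary in
   register 1, and leaves its output in the same form. *)
Definition fpt_reducible (P Q : param_problem) : Prop :=
  exists (p : prog) (f g : nat -> nat) (c : nat),
    [/\ computable f, computable g &
        forall (x : seq bool) (k : nat),
        exists (x' : seq bool) (k' t : nat) (st : store),
          [/\ exec p (init [:: x; unary k]) t st,
              st 0 = x' /\ st 1 = unary k',
              t <= f k * (size x).+1 ^ c,
              k' <= g k &
              P x k <-> Q x' k']].

(** ** Encodings of finite objects as bit strings (prefix codes) *)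

Definition enc_unary (n : nat) : seq bool := rcons (unary n) false.

Definition enc_seq (T : Type) (e : T -> seq bool) (s : seq T) : seq bool :=
  rcons (flatten [seq true :: e x | x <- s]) false.

(* Binary digits, least significant first, without leading zeros. *)
Fixpoint pos_bits (p : BinNums.positive) : seq bool :=
  match p with
  | BinNums.xH => [:: true]
  | BinNums.xO q => false :: pos_bits q
  | BinNums.xI q => true :: pos_bits q
  end.

Definition bits (n : nat) : seq bool :=
  match bin_of_nat n with
  | BinNums.N0 => [::]
  | BinNums.Npos p => pos_bits p
  end.

Definition enc_nat (n : nat) : seq bool := enc_seq (fun b => [:: b]) (bits n).

(** ** Boolean circuits *)

(* A circuit is the list of its nodes in a topological order; the arguments of
   a gate are the positions of its in-neighbours. *)
Inductive gate : Type :=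
| Input
| Not of nat
| And of seq nat
| Or of seq nat.

Definition circuit := seq gate.

Definition gate_args (g : gate) : seq nat :=
  match g with
  | Input => [::]
  | Not j => [:: j]
  | And js => js
  | Or js => js
  end.

Definition node (C : circuit) (i : nat) : gate := nth (Not 0) C i.

Definition is_input (C : circuit) (i : nat) : bool :=
  if node C i is Input then true else false.

(* And/or-nodes have indegree at least 2, and exactly one node, necessarily the
   last one, has outdegree 0: it is the output. *)
Definition wf_circuit (C : circuit) : Prop :=
  [/\ 0 < size C,
      forall i, i < size C -> all (fun j => j < i) (gate_args (node C i)),
      forall i, i < size C ->
        match node C i with
        | And js | Or js => uniq js && (1 < size js)
        | _ => true
        end &
      forall i, i.+1 < size C ->
        exists2 l, l < size C & i \in gate_args (node C l)].

(* Recursion along the topological order: [step i vs g] is the value of the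
   node [g] at position [i], given the values [vs] of the nodes before it. *)
Definition scan (T : Type) (step : nat -> seq T -> gate -> T) (C : circuit) :
    seq T :=
  foldl (fun vs g => rcons vs (step (size vs) vs g)) [::] C.

Definition gate_value (a : nat -> bool) (i : nat) (vs : seq bool) (g : gate) :=
  match g with
  | Input => a i
  | Not j => ~~ nth false vs j
  | And js => all (nth false vs) js
  | Or js => has (nth false vs) js
  end.

(* Only the values of [a] at (positions of) input nodes matter. *)
Definition circuit_value (C : circuit) (a : nat -> bool) : bool :=
  last false (scan (gate_value a) C).

Definition weight (C : circuit) (a : nat -> bool) : nat :=
  count (fun i => is_input C i && a i) (iota 0 (size C)).

(* Length of a longest path from an input node to the given node. *)
Definition gate_depth (i : nat) (ds : seq nat) (g : gate) : nat :=
  match g with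
  | Input => 0
  | _ => (\max_(j <- gate_args g) nth 0 ds j).+1
  end.

Definition depth (C : circuit) : nat := last 0 (scan gate_depth C).

(* Maximum number of large nodes (indegree greater than 2) on such a path. *)
Definition gate_weft (i : nat) (ws : seq nat) (g : gate) : nat :=
  (2 < size (gate_args g)) + \max_(j <- gate_args g) nth 0 ws j.

Definition weft (C : circuit) : nat := last 0 (scan gate_weft C).

Definition enc_gate (g : gate) : seq bool :=
  match g with
  | Input => [:: false; false]
  | Not j => [:: false; true] ++ enc_unary j
  | And js => [:: true; false] ++ enc_seq enc_unary js
  | Or js => [:: true; true] ++ enc_seq enc_unary js
  end.

Definition enc_circuit : circuit -> seq bool := enc_seq enc_gate.

(* Weighted circuit satisfiability on circuits of weft at most [t] and depth at
   most [d], parameterized by the (exact) weight [k]. *)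
Definition WCS (t d : nat) : param_problem :=
  fun x k => exists C : circuit,
    [/\ x = enc_circuit C,
        wf_circuit C,
        weft C <= t,
        depth C <= d &
        exists a : nat -> bool, weight C a = k /\ circuit_value C a].

Definition in_W (t : nat) (P : param_problem) : Prop :=
  exists2 d, 1 <= d & fpt_reducible P (WCS t d).

Definition W_hard (t : nat) (Q : param_problem) : Prop :=
  forall P : param_problem, in_W t P -> fpt_reducible P Q.

(** * The scheduling problem 1|prec|k-sched,Cmax *)

(* Jobs are the positions in the list of processing times. *)
Record sched_instance : Type := SchedInstance {
  ptimes : seq nat;
  arcs : seq (nat * nat);
  cmax : nat
}.

Definition job (I : sched_instance) : finType := 'I_(size (ptimes I)).

Definition ptime (I : sched_instance) (j : job I) : nat := nth 0 (ptimes I) j.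

Definition arc (I : sched_instance) : rel (job I) :=
  fun a b => (val a, val b) \in arcs I.

(* There is a (nonempty) path from [a] to [b]. *)
Definition prec (I : sched_instance) (a b : job I) : bool :=
  [exists c, arc a c && connect (@arc I) c b].

Definition wf_sched (I : sched_instance) : Prop :=
  [/\ forall j : job I, 0 < ptime j,
      forall e, e \in arcs I ->
        (e.1 < size (ptimes I)) && (e.2 < size (ptimes I)) &
      forall a : job I, ~~ prec a a].

Section Schedule.
Local Open Scope ring_scope.

Definition completion (I : sched_instance) (start : job I -> rat) (j : job I)
  : rat := start j + (ptime j)%:R.

(* [S] is the set of selected jobs; start times outside [S] are irrelevant. *)
Definition schedule (I : sched_instance) (S : {set job I})
    (start : job I -> rat) : Prop :=
  [/\ forall j, j \in S -> 0 <= start j,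
      forall i j, i \in S -> j \in S -> i != j ->
        completion start i <= start j \/ completion start j <= start i &
      forall a b, b \in S -> prec a b ->
        a \in S /\ completion start a <= start b].

Definition makespan_le (I : sched_instance) (S : {set job I})
    (start : job I -> rat) (C : nat) : Prop :=
  forall j, j \in S -> completion start j <= C%:R.

End Schedule.

Definition enc_arc (e : nat * nat) : seq bool := enc_unary e.1 ++ enc_unary e.2.

(* Processing times and the makespan bound are written in binary. *)
Definition enc_sched (I : sched_instance) : seq bool :=
  enc_seq enc_nat (ptimes I) ++ enc_seq enc_arc (arcs I) ++ enc_nat (cmax I).

Definition k_sched_cmax : param_problem :=
  fun x k => exists I : sched_instance,
    [/\ x = enc_sched I,
        wf_sched I &
        exists (S : {set job I}) (start : job I -> rat),
          [/\ schedule S start, k <= #|S| & makespan_le S start (cmax I)]].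

(** * Execution is deterministic and the encodings are injective *)

Lemma exec_det p st t st1 u st2 :
  exec p st t st1 -> exec p st u st2 -> t = u /\ st1 = st2.
Proof.
move=> H; elim: H u st2 => {p st t st1}.
- by move=> st u st2 H; inversion H.
- by move=> st r b u st2 H; inversion H.
- by move=> st r u st2 H; inversion H.
- move=> p q st t st' v st'' _ IH1 _ IH2 u st2 H; inversion H; subst.
  by have [? ?] := IH1 _ _ ltac:(eassumption); subst;
     have [-> ->] := IH2 _ _ ltac:(eassumption).
- move=> r pe p0 p1 st t st' _ IH u st2 H; inversion H; subst.
  by have [-> ->] := IH _ _ ltac:(eassumption).
- by move=> r p st Hr u st2 H; inversion H.
- move=> r p st t st' v st'' Hr _ IH1 _ IH2 u st2 H; inversion H; subst=> //.
  by have [? ?] := IH1 _ _ ltac:(eassumption); subst;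
     have [-> ->] := IH2 _ _ ltac:(eassumption).
Qed.

Definition prefix_code (T : Type) (e : T -> seq bool) : Prop :=
  forall x y s t, e x ++ s = e y ++ t -> x = y /\ s = t.

Lemma prefix_code_inj (T : Type) (e : T -> seq bool) :
  prefix_code e -> injective e.
Proof. by move=> pe x y exy; case: (pe x y [::] [::]); rewrite ?exy. Qed.

Lemma enc_unary_prefix : prefix_code enc_unary.
Proof.
elim=> [|m IH] [|n] s t //=; first by case.
by case=> /IH [-> ->].
Qed.

Lemma enc_seq_prefix (T : Type) (e : T -> seq bool) :
  prefix_code e -> prefix_code (enc_seq e).
Proof.
rewrite /enc_seq => pe; elim=> [|x xs IH] [|y ys] s t //=; first by case.
by rewrite !rcons_cat -!catA; case=> /pe [-> /IH [-> ->]].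
Qed.

Lemma bits_inj : injective bits.
Proof.
have pos_inj : injective pos_bits.
  elim=> [p IH|p IH|] [q|q|] //=; try by case=> /IH ->.
  - by case: p {IH}.
  - by case: q.
move=> m n eq_mn; apply: (can_inj bin_of_natK); move: eq_mn; rewrite /bits.
case: (bin_of_nat m) (bin_of_nat n) => [|p] [|q] //=; first by case: q.
  by case: p.
by move/pos_inj=> ->.
Qed.

Lemma enc_nat_prefix : prefix_code enc_nat.
Proof.
have pb : prefix_code (fun b : bool => [:: b]) by move=> x y s t [-> ->].
by move=> m n s t /(enc_seq_prefix pb) [/bits_inj -> ->].
Qed.

Lemma enc_gate_prefix : prefix_code enc_gate.
Proof.
move=> [|i|us|us] [|j|vs|vs] s t //=; first by case.
- by case=> /enc_unary_prefix [-> ->].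
- by case=> /(enc_seq_prefix enc_unary_prefix) [-> ->].
- by case=> /(enc_seq_prefix enc_unary_prefix) [-> ->].
Qed.

Lemma enc_circuit_inj : injective enc_circuit.
Proof. exact/prefix_code_inj/enc_seq_prefix/enc_gate_prefix. Qed.

Lemma enc_sched_inj : injective enc_sched.
Proof.
have pa : prefix_code enc_arc.
  move=> [a b] [c d] s t; rewrite /enc_arc /= -!catA.
  by case/enc_unary_prefix=> -> /enc_unary_prefix [-> ->].
move=> [p a c] [p' a' c']; rewrite /enc_sched /=.
case/(enc_seq_prefix enc_nat_prefix)=> -> /(enc_seq_prefix pa) [->].
by move/(prefix_code_inj enc_nat_prefix)=> ->.
Qed.

(* Main.v *)
From mathcomp Require Import all_boot all_order all_algebra zify.
From Stdlib Require Import FunctionalExtensionality.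
Require Import Defs.
Set Implicit Arguments.
Unset Strict Implicit.
Unset Printing Implicit Defensive.
Import Order.TTheory GRing.Theory Num.Theory.

(** A circuit of weft 1 and depth [d] is a polynomial-size disjunction of
    conjunctions of literals, each literal fixing the value of a node that
    depends on at most [q = 2^d] inputs.  Such a conjunction [c] holds on a set
    [A] of [k] inputs iff every [N] with at most [q] elements of [A] extends to
    some [B], [N <= B <= A], on which [c] holds: a literal violated on [A] stays
    violated on every [B] containing the part of [A] it sees.  The sets [B] worth
    considering are the leaves of a search tree that repeatedly adds an input of
    the first violated literal; its size is bounded by a function of [k] times a
    polynomial.  Choosing one leaf for each of the [(k+1)^q] ways of indexing [N]
    by elements of [A], with pairwise compatible choices, is a clique problem.

    A [K]-clique is found by scheduling: a vertex takes time [K^2+1], an ordered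
    pair of adjacent or equal vertices takes time [1] and is preceded by its two
    members.  Within time [K(K^2+1) + K^2] at most [K] vertices fit, so
    [K + K^2] jobs fit only if they are [K] vertices and all [K^2] pairs of them.

    To bound running times, data are trees stored in prefix notation on one stack,
    and polynomial-time functions on trees are closed under composition, pairing
    and size-bounded iteration.  The parameter is padded with [2^((k+1)^2)] so that
    the search tree, too, is computed in polynomial time. *)

(** * Running programs *)

(** Literals are not monotone in the set of selected inputs: one that fails on [N] may hold on [A].
    So testing the small sets [N] by themselves would be wrong, and each of them is first extended
    to some [B]. Weft 1 is what makes literals local: below the only large gate of a path, every
    gate has at most two arguments. A branch of the search tree stores each input together with an
    index from 1 to [k], and compatibility demands that indices and inputs determine each other. A
    clique thus defines an injective numbering, which forces the weight to be exactly [k]. Adjacent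
    vertices also share their conjunction and differ in their class, so a clique with as many
    vertices as there are classes selects one disjunct and meets each class once. Index 0 stands for
    no input and pads sets with fewer than [q] elements. The search tree has up to about
    [(k * 2 ^ d) ^ (k + 1)] leaves. A parameterized reduction may spend such a factor, but a
    calculus of polynomial-time functions cannot express it; the padding turns the factor into input
    length. *)

Definition runs (p : prog) (st st' : store) (n : nat) : Prop :=
  exists2 t, exec p st t st' & t <= n.

Lemma runs_weaken p st st' m n : runs p st st' m -> m <= n -> runs p st st' n.
Proof. by move=> [t H tm] mn; exists t => //; apply: leq_trans mn. Qed.

Lemma runs_seq p q st st' st'' m n :
  runs p st st' m -> runs q st' st'' n -> runs (Seq p q) st st'' (m + n).
Proof.
move=> [t Ht tm] [u Hu un]; exists (t + u); last exact: leq_add.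
exact: exec_seq Ht Hu.
Qed.

Lemma runs_while_stop r p st : st r = [::] -> runs (While r p) st st 1.
Proof. by move=> H; exists 1 => //; apply: exec_while_stop. Qed.

Lemma runs_while_step r p st st' st'' m n :
  st r <> [::] -> runs p st st' m -> runs (While r p) st' st'' n ->
  runs (While r p) st st'' (m + n).+1.
Proof.
move=> H [t Ht tm] [u Hu un]; exists (t + u).+1; last by rewrite ltnS leq_add.
exact: exec_while_step Ht Hu.
Qed.

Lemma runs_case r pe p0 p1 st st' n :
  runs (match st r with [::] => pe | b :: _ => if b then p1 else p0 end)
    st st' n ->
  runs (Case r pe p0 p1) st st' n.+1.
Proof. by move=> [t Ht tn]; exists t.+1 => //; apply: exec_case. Qed.

Lemma init_ext l l' : (forall i, nth [::] l i = nth [::] l' i) -> init l = init l'.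
Proof. by move=> H; apply: functional_extensionality => i; apply: H. Qed.

Lemma upd_init l r s : upd (init l) r s = init (set_nth [::] l r s).
Proof.
by apply: functional_extensionality => i; rewrite /upd /init nth_set_nth.
Qed.

Fixpoint loopfree (p : prog) : bool :=
  match p with
  | Seq p q => loopfree p && loopfree q
  | Case _ pe p0 p1 => [&& loopfree pe, loopfree p0 & loopfree p1]
  | While _ _ => false
  | _ => true
  end.

(* Symbolic evaluation of a loop-free program: final registers and time. *)
Fixpoint lf (p : prog) (l : seq (seq bool)) : seq (seq bool) * nat :=
  match p with
  | Skip => (l, 1)
  | Push r b => (set_nth [::] l r (b :: nth [::] l r), 1)
  | Pop r => (set_nth [::] l r (behead (nth [::] l r)), 1)
  | Seq p q => ((lf q (lf p l).1).1, (lf p l).2 + (lf q (lf p l).1).2)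
  | Case r pe p0 p1 =>
      match nth [::] l r with
      | [::] => ((lf pe l).1, (lf pe l).2.+1)
      | b :: _ => if b then ((lf p1 l).1, (lf p1 l).2.+1)
                  else ((lf p0 l).1, (lf p0 l).2.+1)
      end
  | While _ _ => (l, 0)
  end.

Lemma lfP p l : loopfree p -> exec p (init l) (lf p l).2 (init (lf p l).1).
Proof.
elim: p l => //=.
- by move=> l _; apply: exec_skip.
- by move=> r b l _; rewrite -upd_init; apply: exec_push.
- by move=> r l _; rewrite -upd_init; apply: exec_pop.
- by move=> p IHp q IHq l /andP[hp hq]; apply: exec_seq (IHp _ hp) (IHq _ hq).
move=> r pe IHe p0 IH0 p1 IH1 l /and3P[he h0 h1].
case E: (nth [::] l r) => [|[] s] /=; apply: exec_case; rewrite /init E.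
- exact: IHe.
- exact: IH1.
- exact: IH0.
Qed.

Lemma runs_lf p l l' n :
  loopfree p -> (lf p l).1 = l' -> (lf p l).2 <= n -> runs p (init l) (init l') n.
Proof. by move=> hp <- ?; exists (lf p l).2 => //; apply: lfP. Qed.

(** One turn of a loop whose body is evaluated by [lf], arranged so that the main goal left is the
    rest of the loop. The strict inequality pays for the loop test. *)
Lemma runs_iter m r p l l' st n k :
  nth [::] l r <> [::] -> loopfree p -> (lf p l).1 = l' -> (lf p l).2 <= m ->
  runs (While r p) (init l') st n -> m + n < k -> runs (While r p) (init l) st k.
Proof.
move=> hr hp hl hm H mnk; apply: runs_weaken mnk.
exact: runs_while_step (runs_lf hp hl hm) H.
Qed.

(** A step pushes at most one bit. Time bounds therefore give size bounds, both for composed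
    programs and for the output of an arbitrary given reduction. *)
Lemma exec_size p st t st' r :
  exec p st t st' -> size (st' r) <= size (st r) + t.
Proof.
elim=> {p st t st'} //=; rewrite /upd.
- by move=> st; lia.
- by move=> st i b; case: eqP => [->|_] /=; lia.
- by move=> st i; case: eqP => [->|_]; rewrite ?size_behead; lia.
- by move=> *; lia.
- by move=> *; lia.
- by move=> *; lia.
- by move=> *; lia.
Qed.

(** * Trees on the stack *)

Inductive tree : Type := Leaf | Node of tree & tree.

Fixpoint tcode (t : tree) : seq bool :=
  if t is Node l r then true :: tcode l ++ tcode r else [:: false].

(** The empty scratch registers are written out so that [set_nth], and with it [lf], produces lists
    of a fixed shape. *)
Definition stk (s : seq bool) : store := init [:: s; [::]; [::]; [::]].

Lemma stkE s : stk s = init [:: s].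
Proof. by apply: init_ext => -[|[|[|[|i]]]] //=; rewrite nth_nil. Qed.

(* Register 3 counts the trees still to be read. *)
Definition move_loop (r : nat) : prog :=
  While 3 (Case 0 (Pop 3) (Seq (Pop 0) (Seq (Push r false) (Pop 3)))
                  (Seq (Pop 0) (Seq (Push r true) (Push 3 true)))).

Definition move_tree (r : nat) : prog := Seq (Push 3 true) (move_loop r).

(** Continuation form: the rest of the loop is a hypothesis, so the induction can chain the two
    subtrees of a node within a single execution of the loop. *)
Lemma move_loop1 t s a b c st n :
  runs (move_loop 1) (init [:: s; catrev (tcode t) a; b; c]) st n ->
  runs (move_loop 1) (init [:: tcode t ++ s; a; b; true :: c]) st
    (5 * size (tcode t) + n).
Proof.
elim: t s a c n => [|l IHl r IHr] s a c n H /=.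
  by apply: (runs_iter (m := 4)) H _ => //; lia.
rewrite -catA; apply: (runs_iter (m := 4)) => //=.
  apply: IHl; apply: IHr.
  by move: H; rewrite /= !catrevE rev_cat catA; apply.
by rewrite size_cat; lia.
Qed.

Lemma move_loop2 t s a b c st n :
  runs (move_loop 2) (init [:: s; a; catrev (tcode t) b; c]) st n ->
  runs (move_loop 2) (init [:: tcode t ++ s; a; b; true :: c]) st
    (5 * size (tcode t) + n).
Proof.
elim: t s b c n => [|l IHl r IHr] s b c n H /=.
  by apply: (runs_iter (m := 4)) H _ => //; lia.
rewrite -catA; apply: (runs_iter (m := 4)) => //=.
  apply: IHl; apply: IHr.
  by move: H; rewrite /= !catrevE rev_cat catA; apply.
by rewrite size_cat; lia.
Qed.

Lemma move_tree1 t s b :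
  runs (move_tree 1) (init [:: tcode t ++ s; [::]; b; [::]])
    (init [:: s; rev (tcode t); b; [::]]) (5 * size (tcode t) + 2).
Proof.
apply: runs_weaken.
  apply: runs_seq; first by apply: (runs_lf (n := 1) _ (erefl _)).
  apply: (@move_loop1 t s [::] b [::]).
  exact: runs_while_stop.
lia.
Qed.

Lemma move_tree2 t s a :
  runs (move_tree 2) (init [:: tcode t ++ s; a; [::]; [::]])
    (init [:: s; a; rev (tcode t); [::]]) (5 * size (tcode t) + 2).
Proof.
apply: runs_weaken.
  apply: runs_seq; first by apply: (runs_lf (n := 1) _ (erefl _)).
  apply: (@move_loop2 t s a [::] [::]).
  exact: runs_while_stop.
lia.
Qed.

Definition shift_reg (i j : nat) : prog :=
  While i (Case i Skip (Seq (Pop i) (Push j false)) (Seq (Pop i) (Push j true))).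

Lemma shift10 s a b c :
  runs (shift_reg 1 0) (init [:: s; a; b; c]) (init [:: catrev a s; [::]; b; c])
    (4 * size a + 1).
Proof.
elim: a s => [|x a IH] s; first exact: runs_while_stop.
apply: (runs_iter (m := 3)) (IH (x :: s)) _ => //; try by case: x.
by rewrite /=; lia.
Qed.

Lemma shift20 s a b c :
  runs (shift_reg 2 0) (init [:: s; a; b; c]) (init [:: catrev b s; a; [::]; c])
    (4 * size b + 1).
Proof.
elim: b s => [|x b IH] s; first exact: runs_while_stop.
apply: (runs_iter (m := 3)) (IH (x :: s)) _ => //; try by case: x.
by rewrite /=; lia.
Qed.

Lemma shift21 s a b c :
  runs (shift_reg 2 1) (init [:: s; a; b; c]) (init [:: s; catrev b a; [::]; c])
    (4 * size b + 1).
Proof.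
elim: b a => [|x b IH] a; first exact: runs_while_stop.
apply: (runs_iter (m := 3)) (IH (x :: a)) _ => //; try by case: x.
by rewrite /=; lia.
Qed.

Lemma shift02 s a b c :
  runs (shift_reg 0 2) (init [:: s; a; b; c]) (init [:: [::]; a; catrev s b; c])
    (4 * size s + 1).
Proof.
elim: s b => [|x s IH] b; first exact: runs_while_stop.
apply: (runs_iter (m := 3)) (IH (x :: b)) _ => //; try by case: x.
by rewrite /=; lia.
Qed.

Definition clear_reg (r : nat) : prog := While r (Pop r).

Lemma runs_clear r st :
  runs (clear_reg r) st (upd st r [::]) (2 * size (st r) + 1).
Proof.
move Es: (st r) => s; elim: s st Es => [|x s IH] st Es.
  have -> : upd st r [::] = st.
    by apply: functional_extensionality => i; rewrite /upd; case: eqP => // ->.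
  exact: runs_while_stop.
apply: runs_weaken.
  apply: (@runs_while_step _ _ _ (upd st r (behead (st r))) _ 1).
  - by rewrite Es.
  - by exists 1 => //; apply: exec_pop.
  have -> : upd st r [::] = upd (upd st r (behead (st r))) r [::].
    by apply: functional_extensionality => i; rewrite /upd; case: eqP.
  by apply: IH; rewrite /upd eqxx Es.
by rewrite /=; lia.
Qed.

Definition drop_prog : prog := Seq (move_tree 1) (clear_reg 1).

Lemma runs_drop t s :
  runs drop_prog (stk (tcode t ++ s)) (stk s) (8 * size (tcode t) + 3).
Proof.
apply: runs_weaken.
  apply: runs_seq; first exact: move_tree1.
  by have := runs_clear 1 (init [:: s; rev (tcode t); [::]; [::]]);
     rewrite upd_init; apply.
by rewrite size_rev; lia.
Qed.

Definition swap_prog : prog :=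
  Seq (move_tree 1) (Seq (move_tree 2) (Seq (shift_reg 1 0) (shift_reg 2 0))).

(** A transfer to a scratch register reverses a code and the transfer back restores it. Register 1
    is emptied first, so its tree ends up below the other one. *)
Lemma runs_swap t u s :
  runs swap_prog (stk (tcode t ++ tcode u ++ s)) (stk (tcode u ++ tcode t ++ s))
    (10 * size (tcode t) + 10 * size (tcode u) + 6).
Proof.
apply: runs_weaken.
  apply: runs_seq; first exact: move_tree1.
  apply: runs_seq; first exact: move_tree2.
  apply: runs_seq; first exact: shift10.
  rewrite catrevE revK -[X in stk (X ++ _)]revK -catrevE.
  exact: shift20.
by rewrite !size_rev; lia.
Qed.

Definition dup_prog : prog :=
  Seq (move_tree 1)
  (Seq (While 1 (Case 1 Skip
                   (Seq (Pop 1) (Seq (Push 0 false) (Push 2 false)))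
                   (Seq (Pop 1) (Seq (Push 0 true) (Push 2 true)))))
  (Seq (shift_reg 2 1) (shift_reg 1 0))).

Lemma runs_dup t s :
  runs dup_prog (stk (tcode t ++ s)) (stk (tcode t ++ tcode t ++ s))
    (20 * size (tcode t) + 6).
Proof.
have copy a s0 b : runs (While 1 (Case 1 Skip
                   (Seq (Pop 1) (Seq (Push 0 false) (Push 2 false)))
                   (Seq (Pop 1) (Seq (Push 0 true) (Push 2 true)))))
     (init [:: s0; a; b; [::]]) (init [:: catrev a s0; [::]; catrev a b; [::]])
     (5 * size a + 1).
  elim: a s0 b => [|x a IH] s0 b; first exact: runs_while_stop.
  apply: (runs_iter (m := 4)) (IH (x :: s0) (x :: b)) _ => //; try by case: x.
  by rewrite /=; lia.
apply: runs_weaken.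
  apply: runs_seq; first exact: move_tree1.
  apply: runs_seq; first exact: copy.
  apply: runs_seq; first exact: shift21.
  rewrite !catrevE revK !cats0 -[X in stk (X ++ _)]revK -[in X in stk X]catrevE.
  exact: shift10.
by rewrite ?catrevE ?size_cat ?size_rev /= ?size_rev; lia.
Qed.

(** * Polynomial-time functions on encoded data *)

Class codable (T : Type) : Type := Codable { tenc : T -> tree; dflt : T }.

Definition code (T : Type) {cT : codable T} (x : T) : seq bool := tcode (tenc x).

Definition csize (T : Type) {cT : codable T} (x : T) : nat := size (code x).

#[export] Instance codable_tree : codable tree := Codable id Leaf.

#[export] Instance codable_unit : codable unit := Codable (fun=> Leaf) tt.

#[export] Instance codable_bool : codable bool :=
  Codable (fun b : bool => if b then Node Leaf Leaf else Leaf) false.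

(** Unary, so that code sizes are linear in values and a number can bound a loop. The numbers
    handled by the reduction stay small enough for this. *)
Fixpoint nat_tree (n : nat) : tree :=
  if n is m.+1 then Node Leaf (nat_tree m) else Leaf.

#[export] Instance codable_nat : codable nat := Codable nat_tree 0.

#[export] Instance codable_pair A B {cA : codable A} {cB : codable B} :
  codable (A * B) := Codable (fun p => Node (tenc p.1) (tenc p.2)) (dflt, dflt).

#[export] Instance codable_seq A {cA : codable A} : codable (seq A) :=
  Codable (foldr (fun x t => Node (tenc x) t) Leaf) [::].

Lemma csize_gt0 A {cA : codable A} (a : A) : 0 < csize a.
Proof. by rewrite /csize /code; case: (tenc a). Qed.

Lemma csize_pair A B {cA : codable A} {cB : codable B} (a : A) (b : B) :
  csize (a, b) = (csize a + csize b).+1.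
Proof. by rewrite /csize /code /= size_cat. Qed.

Lemma csize_cons A {cA : codable A} (a : A) l :
  csize (a :: l) = (csize a + csize l).+1.
Proof. by rewrite /csize /code /= size_cat. Qed.

Lemma csize_nat (n : nat) : csize n = n.*2.+1.
Proof. by elim: n => //= n; rewrite /csize /code /= => ->. Qed.

(** The base is at least 2, so constants, factors and sums are all absorbed by the exponent, the
    only datum to keep track of. *)
Definition pbnd A {cA : codable A} (T : A -> nat) : Prop :=
  exists c, forall a, T a <= (csize a).+2 ^ c.

(** The rest [s] of the stack is arbitrary and preserved; this lets a program work on a copy of its
    input with other data waiting below. *)
Definition computes A B {cA : codable A} {cB : codable B} (p : prog) (f : A -> B)
    (T : A -> nat) : Prop :=
  forall a s, runs p (stk (code a ++ s)) (stk (code (f a) ++ s)) (T a).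

Definition PT A B {cA : codable A} {cB : codable B} (f : A -> B) : Prop :=
  exists p T, computes p f T /\ pbnd T.

Section PolyBounds.
Context {A : Type} {cA : codable A}.
Implicit Types T : A -> nat.

Lemma pbnd_le T T' : pbnd T -> (forall a, T' a <= T a) -> pbnd T'.
Proof. by move=> [c H] H'; exists c => a; apply: leq_trans (H' a) (H a). Qed.

Lemma pbnd_const n : pbnd (fun _ : A => n).
Proof.
exists n => a; apply: (@leq_trans (2 ^ n)); first exact/ltnW/ltn_expl.
by case: n => // n; rewrite leq_exp2r.
Qed.

Lemma pbnd_mul T T' : pbnd T -> pbnd T' -> pbnd (fun a => T a * T' a).
Proof.
move=> [c H] [c' H']; exists (c + c') => a.
by rewrite expnD leq_mul.
Qed.

Lemma pbnd_add T T' : pbnd T -> pbnd T' -> pbnd (fun a => T a + T' a).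
Proof.
move=> [c H] [c' H']; exists (c + c').+1 => a.
have := H a; have := H' a.
have := expn_gt0 (csize a).+2 c; have := expn_gt0 (csize a).+2 c'.
rewrite expnS expnD; nia.
Qed.

Lemma pbnd_exp T n : pbnd T -> pbnd (fun a => T a ^ n).
Proof.
move=> H; elim: n => [|n IH]; first exact: pbnd_const.
by apply: pbnd_le (pbnd_mul H IH) _ => a; rewrite expnS.
Qed.

Lemma pbnd_csize : pbnd (fun a : A => csize a).
Proof. by exists 1 => a; rewrite expn1; lia. Qed.

End PolyBounds.

Lemma pbnd_comp A B {cA : codable A} {cB : codable B} (f : A -> B) T :
  pbnd (fun a => csize (f a)) -> pbnd T -> pbnd (fun a => T (f a)).
Proof.
move=> pf [c H].
have := pbnd_exp c (pbnd_add pf (pbnd_const 2)).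
by move/pbnd_le; apply=> a; rewrite addn2.
Qed.

Lemma computes_csize A B {cA : codable A} {cB : codable B} p (f : A -> B) T a :
  computes p f T -> csize (f a) <= csize a + T a.
Proof.
move=> /(_ a [::]) [t /(exec_size 0)]; rewrite /= !cats0 => H tT.
exact: leq_trans H (leq_add (leqnn _) tT).
Qed.

Lemma PT_csize A B {cA : codable A} {cB : codable B} (f : A -> B) :
  PT f -> pbnd (fun a => csize (f a)).
Proof.
move=> [p [T [H bT]]]; apply: pbnd_le (pbnd_add pbnd_csize bT) _ => a.
exact: computes_csize H.
Qed.

Lemma computes_comp A B C {cA : codable A} {cB : codable B} {cC : codable C}
    p q (f : A -> B) (g : B -> C) T U :
  computes p f T -> computes q g U ->
  computes (Seq p q) (fun a => g (f a)) (fun a => T a + U (f a)).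
Proof. by move=> Hf Hg a s; apply: runs_seq (Hf a s) (Hg (f a) s). Qed.

Definition pair_prog (p q : prog) : prog :=
  Seq dup_prog (Seq p (Seq swap_prog (Seq q (Seq swap_prog (Push 0 true))))).

Lemma computes_pair A B C {cA : codable A} {cB : codable B} {cC : codable C}
    p q (f : A -> B) (g : A -> C) T U :
  computes p f T -> computes q g U ->
  computes (pair_prog p q) (fun a => (f a, g a))
    (fun a => 30 * csize a + T a + U a + 20 * csize (f a) + 10 * csize (g a) + 19).
Proof.
move=> Hf Hg a s.
apply: runs_weaken.
  apply: runs_seq; first exact: runs_dup.
  apply: runs_seq; first exact: Hf.
  apply: runs_seq; first exact: runs_swap.
  apply: runs_seq; first exact: Hg.
  apply: runs_seq; first exact: runs_swap.
  rewrite /stk /code /= -catA.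
  by apply: (runs_lf (n := 1)).
by rewrite /csize /code; lia.
Qed.

Section PTBasic.
Context {A B C : Type} {cA : codable A} {cB : codable B} {cC : codable C}.

Lemma PT_ext (f g : A -> B) : (forall a, f a = g a) -> PT f -> PT g.
Proof. by move=> /functional_extensionality ->. Qed.

Lemma PT_id : PT (fun a : A => a).
Proof.
exists Skip, (fun=> 1); split; last exact: pbnd_const.
by move=> a s; apply: runs_lf.
Qed.

Lemma PT_comp (f : A -> B) (g : B -> C) : PT f -> PT g -> PT (fun a => g (f a)).
Proof.
move=> Hf [q [U [Hq bU]]]; have bf := PT_csize Hf.
move: Hf => [p [T [Hp bT]]].
exists (Seq p q), (fun a => T a + U (f a)); split; first exact: computes_comp.
exact: pbnd_add bT (pbnd_comp bf bU).
Qed.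

Lemma PT_pair (f : A -> B) (g : A -> C) :
  PT f -> PT g -> PT (fun a => (f a, g a)).
Proof.
move=> Hf Hg; have bf := PT_csize Hf; have bg := PT_csize Hg.
move: Hf Hg => [p [T [Hp bT]]] [q [U [Hq bU]]].
eexists; eexists; split; first exact: computes_pair Hp Hq.
by do ?[apply: pbnd_add | apply: pbnd_mul | exact: pbnd_const | exact: pbnd_csize].
Qed.

(* Programs only see codes, so a function inherits any realizer of a function
   that acts in the same way on codes. *)
Lemma PT_tree (h : tree -> tree) (f : A -> B) :
  PT h -> (forall a, tenc (f a) = h (tenc a)) -> PT f.
Proof.
move=> [p [T [Hp [c bT]]]] E; exists p, (fun a => T (tenc a)); split.
  by move=> a s; rewrite /code E; apply: (Hp (tenc a)).
by exists c => a; apply: bT.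
Qed.

Lemma PT_const (b : B) : PT (fun _ : A => b).
Proof.
pose push (s : seq bool) := foldr (fun x p => Seq p (Push 0 x)) Skip s.
have runs_push w s : runs (push w) (stk s) (stk (w ++ s)) (size w).+1.
  elim: w => [|x w IH]; first by apply: runs_lf.
  apply: runs_weaken.
    by apply: runs_seq IH _; apply: (runs_lf (n := 1)).
  by rewrite addn1.
exists (Seq drop_prog (push (code b))).
exists (fun a => 8 * csize a + 3 + (csize b).+1); split.
  by move=> a s; apply: runs_seq (runs_push _ _); apply: runs_drop.
by do ?[apply: pbnd_add | apply: pbnd_mul | exact: pbnd_const | exact: pbnd_csize].
Qed.

Definition if_prog (p q r : prog) : prog :=
  Seq dup_prog (Seq p (Case 0 Skip (Seq (Pop 0) r)
                       (Seq (Seq (Pop 0) (Seq (Pop 0) (Pop 0))) q))).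

Lemma PT_if (b : A -> bool) (f g : A -> B) :
  PT b -> PT f -> PT g -> PT (fun a => if b a then f a else g a).
Proof.
move=> [p [T [Hp bT]]] [q [U [Hq bU]]] [r [V [Hr bV]]].
exists (if_prog p q r), (fun a => 20 * csize a + T a + U a + V a + 10); split.
  move=> a s; apply: runs_weaken.
    apply: runs_seq; first exact: runs_dup.
    apply: runs_seq; first exact: Hp.
    apply: (@runs_case _ _ _ _ _ _ (U a + V a + 3)).
    rewrite /stk /code /=; case: (b a) => /=.
      apply: (@runs_weaken _ _ _ (3 + U a)); last by lia.
      by apply: runs_seq (Hq a s); apply: runs_lf.
    apply: (@runs_weaken _ _ _ (1 + V a)); last by lia.
    by apply: runs_seq (Hr a s); apply: runs_lf.
  by rewrite /csize /code; lia.
by do ?[apply: pbnd_add | apply: pbnd_mul | exact: pbnd_const | exact: pbnd_csize].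
Qed.

End PTBasic.

Definition tfst (t : tree) : tree := if t is Node l _ then l else Leaf.
Definition tsnd (t : tree) : tree := if t is Node _ r then r else Leaf.
Definition tnode (t : tree) : bool := if t is Node _ _ then true else false.

Lemma PT_tfst : PT tfst.
Proof.
exists (Case 0 Skip Skip (Seq (Pop 0) (Seq swap_prog drop_prog))).
exists (fun t => 18 * csize t + 20); split; last first.
  by do ?[apply: pbnd_add | apply: pbnd_mul | exact: pbnd_const | exact: pbnd_csize].
case=> [|l r] s.
  by apply: (@runs_weaken _ _ _ 2); [apply: runs_case; apply: runs_lf | lia].
apply: runs_weaken.
  apply: runs_case => /=.
  apply: runs_seq; first by apply: (runs_lf (n := 1) _ (erefl _)).
  rewrite /code /= -catA; apply: runs_seq; first exact: runs_swap.
  exact: runs_drop.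
by rewrite /csize /code /= size_cat; lia.
Qed.

Lemma PT_tsnd : PT tsnd.
Proof.
exists (Case 0 Skip Skip (Seq (Pop 0) drop_prog)).
exists (fun t => 18 * csize t + 20); split; last first.
  by do ?[apply: pbnd_add | apply: pbnd_mul | exact: pbnd_const | exact: pbnd_csize].
case=> [|l r] s.
  by apply: (@runs_weaken _ _ _ 2); [apply: runs_case; apply: runs_lf | lia].
apply: runs_weaken.
  apply: runs_case => /=.
  apply: runs_seq; first by apply: (runs_lf (n := 1) _ (erefl _)).
  rewrite /code /= -catA; exact: runs_drop.
by rewrite /csize /code /= size_cat; lia.
Qed.

Lemma PT_tnode : PT tnode.
Proof.
exists (Case 0 Skip Skip (Seq drop_prog (Seq (Push 0 false) (Seq (Push 0 false) (Push 0 true))))).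
exists (fun t => 18 * csize t + 20); split; last first.
  by do ?[apply: pbnd_add | apply: pbnd_mul | exact: pbnd_const | exact: pbnd_csize].
case=> [|l r] s.
  by apply: (@runs_weaken _ _ _ 2); [apply: runs_case; apply: runs_lf | lia].
apply: runs_weaken.
  apply: runs_case => /=.
  apply: runs_seq; first exact: (runs_drop (Node l r)).
  by apply: (runs_lf (n := 3)).
by rewrite /csize /code /= size_cat; lia.
Qed.

Section PTData.
Context {A B C : Type} {cA : codable A} {cB : codable B} {cC : codable C}.

Lemma PT_fst (f : A -> B * C) : PT f -> PT (fun a => (f a).1).
Proof. by move=> Hf; apply: PT_comp Hf (PT_tree PT_tfst _). Qed.

Lemma PT_snd (f : A -> B * C) : PT f -> PT (fun a => (f a).2).
Proof. by move=> Hf; apply: PT_comp Hf (PT_tree PT_tsnd _). Qed.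

Lemma PT_cons (f : A -> B) (g : A -> seq B) :
  PT f -> PT g -> PT (fun a => f a :: g a).
Proof.
move=> Hf Hg; apply: (PT_comp (PT_pair Hf Hg) (g := fun p => p.1 :: p.2)).
exact: (PT_tree PT_id).
Qed.

Lemma PT_behead (f : A -> seq B) : PT f -> PT (fun a => behead (f a)).
Proof. by move=> Hf; apply: PT_comp Hf (PT_tree PT_tsnd _); case. Qed.

Lemma PT_nilp (f : A -> seq B) : PT f -> PT (fun a => nilp (f a)).
Proof.
move=> Hf; apply: (PT_comp Hf (g := fun l => nilp l)).
have PTn : PT (fun l : seq B => ~~ nilp l).
  move: PT_tnode => [p [T [Hp [c bT]]]].
  exists p, (fun l => T (tenc l)); split; last by exists c => l; apply: bT.
  by case=> [|x l] s; [exact: (Hp Leaf s) | exact: (Hp (Node (tenc x) (tenc l)) s)].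
apply: (PT_ext (f := fun l => if ~~ nilp l then false else true)).
  by case.
by apply: PT_if => //; apply: PT_const.
Qed.

Lemma PT_head_dflt (f : A -> seq B) : PT f -> PT (fun a => head dflt (f a)).
Proof.
move=> Hf; apply: (PT_comp Hf (g := fun l => head dflt l)).
pose h (t : tree) := if tnode t then tfst t else @tenc B cB (@dflt B cB).
apply: (@PT_tree _ _ _ _ h); last by case.
by apply: PT_if; [exact: PT_tnode | exact: PT_tfst | exact: PT_const].
Qed.

End PTData.

(** * Bounded iteration *)

Definition loop_prog (p : prog) : prog :=
  Seq (Push 3 true)
   (While 3 (Seq (Pop 3) (Seq (Pop 0)
      (Case 0 Skip (Push 0 true) (Seq (Push 0 true) (Seq p (Push 3 true))))))).

(** The list in the state is fuel. Under the tag of the pair lies the first bit of the code of that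
    list: [loop_prog] pops the tag, tests the bit, restores the tag and, if the list is nonempty,
    runs the body and sets register 3 again. The bound [B] is required only along the actual
    trajectory, since [T] depends on a state that may grow. *)
Lemma runs_loop X R {cX : codable X} {cR : codable R} (step : seq X * R -> seq X * R)
    p T B s st :
  computes p step T ->
  (forall s, s.1 <> [::] -> size (step s).1 = (size s.1).-1) ->
  (forall i, i < size s.1 -> T (iter i step s) <= B) ->
  runs (loop_prog p) (stk (code s ++ st))
    (stk (code (iter (size s.1) step s) ++ st)) ((size s.1).+1 * (B + 8) + 2).
Proof.
move=> Hp Hs.
have loop n : forall s, size s.1 = n ->
    (forall i, i < n -> T (iter i step s) <= B) ->
    runs (While 3 (Seq (Pop 3) (Seq (Pop 0)
      (Case 0 Skip (Push 0 true) (Seq (Push 0 true) (Seq p (Push 3 true)))))))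
    (init [:: code s ++ st; [::]; [::]; [:: true]])
    (stk (code (iter n step s) ++ st)) (n.+1 * (B + 8)).
  elim: n => [|n IH] [[|x l] r] //= En HB.
    apply: (@runs_weaken _ _ _ (4 + 1).+1); last by lia.
    apply: (@runs_while_step _ _ _ (stk (code ([::] : seq X, r) ++ st))) => //.
      apply: (@runs_weaken _ _ _ (1 + (1 + 2))) => //.
      apply: runs_seq; first by apply: (runs_lf (n := 1) _ (erefl _)).
      apply: runs_seq; first by apply: (runs_lf (n := 1) _ (erefl _)).
      by apply: runs_case; apply: runs_lf.
    exact: runs_while_stop.
  have Eit i : iter i.+1 step (x :: l, r) = iter i step (step (x :: l, r)).
    by rewrite iterSr.
  apply: (@runs_weaken _ _ _ ((B + 6 + n.+1 * (B + 8)).+1)); last by lia.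
  apply: (@runs_while_step _ _ _
    (init [:: code (step (x :: l, r)) ++ st; [::]; [::]; [:: true]])) => //.
    apply: (@runs_weaken _ _ _ (1 + (1 + (1 + (B + 1)).+1))); last by lia.
    apply: runs_seq; first by apply: (runs_lf (n := 1) _ (erefl _)).
    apply: runs_seq; first by apply: (runs_lf (n := 1) _ (erefl _)).
    apply: runs_case => /=.
    apply: runs_seq; first by apply: (runs_lf (n := 1) _ (erefl _)).
    apply: (@runs_seq _ _ _ (stk (code (step (x :: l, r)) ++ st))); last by apply: (runs_lf (n := 1)).
    by apply: runs_weaken (Hp (x :: l, r) st) (HB 0 isT).
  rewrite -iterS Eit; apply: IH; first by rewrite Hs //=; case: En.
  by move=> i Hi; rewrite -Eit; apply: HB.
move=> HB; apply: runs_weaken.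
  apply: runs_seq; first by apply: (runs_lf (n := 1) _ (erefl _)).
  exact: loop.
lia.
Qed.

Section Fold.
Context {A X Acc : Type} {cA : codable A} {cX : codable X} {cAcc : codable Acc}.

(** The environment [a] travels inside the state because programs have no closures. *)
Definition fold_step (body : A -> Acc -> X -> Acc) (s : seq X * (Acc * A)) :
    seq X * (Acc * A) :=
  if nilp s.1 then s
  else (behead s.1, (body s.2.2 s.2.1 (head dflt s.1), s.2.2)).

Lemma iter_fold_step body l acc a n :
  iter n (fold_step body) (l, (acc, a)) =
  (drop n l, (foldl (body a) acc (take n l), a)).
Proof.
elim: n l acc => [|n IH] l acc; first by rewrite take0 drop0.
by rewrite iterSr /fold_step; case: l => [|x l] /=; rewrite IH //= take_nil drop_nil.
Qed.

Lemma csize_drop n (l : seq X) : csize (drop n l) <= csize l.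
Proof.
elim: l n => [|x l IH] [|n] //=.
by apply: leq_trans (IH n) _; rewrite csize_cons; lia.
Qed.

Lemma size_csize (l : seq X) : size l <= csize l.
Proof. by elim: l => //= x l IH; rewrite csize_cons; lia. Qed.

(** Iterating a polynomial-time body can blow up the accumulator. The bound [M] on all intermediate
    accumulators excludes this, as the majorant does in Cobham's bounded recursion. *)
Lemma PT_foldl (body : A -> Acc -> X -> Acc) (a0 : A -> Acc) (l : A -> seq X) M :
  PT (fun p : A * (Acc * X) => body p.1 p.2.1 p.2.2) -> PT a0 -> PT l -> pbnd M ->
  (forall a n, csize (foldl (body a) (a0 a) (take n (l a))) <= M a) ->
  PT (fun a => foldl (body a) (a0 a) (l a)).
Proof.
move=> Hb Ha Hl bM HM.
have [p [T [Hp [c bT]]]] : PT (fold_step body).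
  apply: PT_if; [by apply: PT_nilp; apply: PT_fst; apply: PT_id | exact: PT_id |].
  apply: PT_pair; first by apply: PT_behead; apply: PT_fst; apply: PT_id.
  have P22 : PT (fun s : seq X * (Acc * A) => s.2.2).
    by apply: PT_snd; apply: PT_snd; apply: PT_id.
  apply: (PT_pair _ P22).
  apply: (PT_comp (g := fun p : A * (Acc * X) => body p.1 p.2.1 p.2.2)
     (f := fun s : seq X * (Acc * A) => (s.2.2, (s.2.1, head dflt s.1)))) => //.
  apply: (PT_pair P22); apply: PT_pair.
    by apply: PT_fst; apply: PT_snd; apply: PT_id.
  by apply: PT_head_dflt; apply: PT_fst; apply: PT_id.
set U := (fun a : A => (csize (l a)).+1 * ((csize (l a) + M a + csize a + 4) ^ c + 8) + 2).
have Hloop : PT (fun a => iter (size (l a)) (fold_step body) (l a, (a0 a, a))).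
  have [pi [Ti [Hpi bTi]]] : PT (fun a => (l a, (a0 a, a))).
    by do 2!apply: PT_pair => //; apply: PT_id.
  exists (Seq pi (loop_prog p)), (fun a => Ti a + U a); split; last first.
    apply: pbnd_add => //; have bl := PT_csize Hl.
    apply: pbnd_add; last exact: pbnd_const.
    apply: (pbnd_le (T := fun a =>
      (csize (l a) + 1) * ((csize (l a) + M a + csize a + 4) ^ c + 8))).
      apply: pbnd_mul; first by apply: pbnd_add bl (pbnd_const _).
      apply: pbnd_add (pbnd_const _); apply: pbnd_exp.
      by do ?[apply: pbnd_add | exact: pbnd_const | exact: pbnd_csize].
    by move=> a; rewrite addn1.
  move=> a s; apply: runs_seq; first exact: Hpi.
  apply: runs_weaken.
    apply: (@runs_loop X (Acc * A) _ _ _ _ _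
       ((csize (l a) + M a + csize a + 4) ^ c) (l a, (a0 a, a)) _ Hp).
      by case=> -[].
    move=> i /= Hi; apply: leq_trans (bT _) _.
    rewrite iter_fold_step.
    case: (c) => // c'; rewrite leq_exp2r // !csize_pair.
    have := csize_drop i (l a); have := HM a i; lia.
  by rewrite leq_add2r leq_mul2r; apply/orP; right; rewrite ltnS size_csize.
apply: (PT_ext _ (PT_fst (PT_snd Hloop))) => a.
by rewrite iter_fold_step /= take_size.
Qed.

End Fold.

Ltac pb := repeat first
  [ assumption | simple apply pbnd_const | simple apply pbnd_csize
  | simple apply pbnd_add | simple apply pbnd_mul | simple apply pbnd_exp
  | refine (PT_csize _) ].

Section Lists.
Context {A X Acc : Type} {cA : codable A} {cX : codable X} {cAcc : codable Acc}.

(** If the growth per step depends on the environment and the element but not on the accumulator,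
    the total growth is a sum of [size (l a)] polynomially bounded terms, which supplies the
    majorant. *)
Lemma PT_foldl_inc (body : A -> Acc -> X -> Acc) (a0 : A -> Acc) (l : A -> seq X) H :
  PT (fun p : A * (Acc * X) => body p.1 p.2.1 p.2.2) -> PT a0 -> PT l -> pbnd H ->
  (forall a acc x, csize (body a acc x) <= csize acc + H (a, x)) ->
  PT (fun a => foldl (body a) (a0 a) (l a)).
Proof.
move=> Hb Ha Hl [c bH] Hinc.
apply: (@PT_foldl _ _ _ _ _ _ _ _ _
  (fun a => csize (a0 a) + csize (l a) * (csize a + csize (l a) + 3) ^ c)) => //.
  by pb; apply: PT_csize.
move=> a n.
have : csize (foldl (body a) (a0 a) (take n (l a))) <=
    csize (a0 a) + size (take n (l a)) * (csize a + csize (l a) + 3) ^ c.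
  have: forall m, m <= n -> csize (foldl (body a) (a0 a) (take m (l a))) <=
    csize (a0 a) + m * (csize a + csize (l a) + 3) ^ c.
    elim=> [|m IH] mn; first by rewrite take0 addn0.
    case: (ltnP m (size (l a))) => Hm; last first.
      rewrite take_oversize 1?leqW //; have := IH (ltnW mn).
      by rewrite take_oversize //; lia.
    rewrite (take_nth dflt Hm) foldl_rcons.
    apply: leq_trans (Hinc _ _ _) _.
    have Hx : csize (nth dflt (l a) m) <= csize (l a).
      elim: (l a) m Hm {IH mn} => // x s IHs [|m] /=.
        by rewrite csize_cons; lia.
      by move/IHs; rewrite csize_cons; lia.
    have : H (a, nth dflt (l a) m) <= (csize a + csize (l a) + 3) ^ c.
      apply: leq_trans (bH _) _; case: (c) => // c'.
      by rewrite leq_exp2r // csize_pair; lia.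
    by have := IH (ltnW mn); lia.
  case: (leqP n (size (l a))) => Hn Hm.
    by rewrite size_take_min (minn_idPl Hn); apply: Hm.
  move: (Hm _ (ltnW Hn)); rewrite size_take_min (minn_idPr (ltnW Hn)).
  by rewrite take_size (take_oversize (ltnW Hn)).
move/leq_trans; apply; rewrite leq_add2l leq_mul2r; apply/orP; right.
by apply: leq_trans (size_csize _); rewrite size_take_min geq_minr.
Qed.
End Lists.

(** * Operations on lists and booleans *)

Lemma PT_catrev A X {cA : codable A} {cX : codable X} (f g : A -> seq X) :
  PT f -> PT g -> PT (fun a => catrev (f a) (g a)).
Proof.
move=> Hf Hg; apply: (@PT_ext _ _ _ _ (fun a => foldl (fun s x => x :: s) (g a) (f a))).
  by move=> a; elim: (f a) (g a) => //= x s IH t; rewrite IH.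
apply: (@PT_foldl_inc _ _ _ _ _ _ (fun=> fun s x => x :: s) g f
         (fun p => csize p + 1)) => //.
  by apply: PT_cons; [do 2!apply: PT_snd | apply: PT_fst; apply: PT_snd]; apply: PT_id.
  by pb.
by move=> a s x; rewrite csize_cons csize_pair; lia.
Qed.

Lemma PT_rev A X {cA : codable A} {cX : codable X} (f : A -> seq X) :
  PT f -> PT (fun a => rev (f a)).
Proof. by move=> Hf; apply: PT_catrev => //; apply: PT_const. Qed.

Lemma PT_cat A X {cA : codable A} {cX : codable X} (f g : A -> seq X) :
  PT f -> PT g -> PT (fun a => f a ++ g a).
Proof.
move=> Hf Hg; apply: (PT_ext _ (PT_catrev (PT_rev Hf) Hg)) => a.
by rewrite catrevE revK.
Qed.

Lemma PT_map A X Y {cA : codable A} {cX : codable X} {cY : codable Y}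
    (F : A -> X -> Y) (l : A -> seq X) :
  PT (fun p : A * X => F p.1 p.2) -> PT l -> PT (fun a => [seq F a x | x <- l a]).
Proof.
move=> HF Hl.
apply: (@PT_ext _ _ _ _ (fun a => rev (foldl (fun s x => F a x :: s) [::] (l a)))).
  move=> a; rewrite -[RHS]revK; congr rev.
  have: forall t, foldl (fun s x => F a x :: s) t (l a) = catrev [seq F a x | x <- l a] t.
    by elim: (l a) => //= x s IH t; rewrite IH.
  by move=> ->.
apply: PT_rev.
apply: (@PT_foldl_inc _ _ _ _ _ _ (fun a s x => F a x :: s) _ _
          (fun p => csize (F p.1 p.2) + 1)) => //.
- apply: PT_cons; last by apply: PT_fst; apply: PT_snd; apply: PT_id.
  apply: (PT_comp (f := fun p : A * (seq Y * X) => (p.1, p.2.2)) _ HF).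
  by apply: PT_pair; [apply: PT_fst | do 2!apply: PT_snd]; apply: PT_id.
- exact: PT_const.
- by pb.
by move=> a s x; rewrite csize_cons /=; lia.
Qed.

Lemma csize_catrev X {cX : codable X} (u v : seq X) : csize (catrev u v) = csize u + csize v - 1.
Proof.
have c0 : csize ([::] : seq X) = 1 by [].
elim: u v => [|x u IH] v; first by rewrite c0 addKn.
by rewrite /= IH !csize_cons; lia.
Qed.

Lemma PT_flatten A X {cA : codable A} {cX : codable X} (f : A -> seq (seq X)) :
  PT f -> PT (fun a => flatten (f a)).
Proof.
move=> Hf.
apply: (@PT_ext _ _ _ _ (fun a => rev (foldl (fun s x => catrev x s) [::] (f a)))).
  move=> a; rewrite -[RHS]revK; congr rev.
  have: forall t, foldl (fun s x => catrev x s) t (f a) = catrev (flatten (f a)) t.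
    by elim: (f a) => //= x s IH t; rewrite IH !catrevE rev_cat catA.
  by move=> ->.
apply: PT_rev.
apply: (@PT_foldl_inc _ _ _ _ _ _ (fun=> fun s x => catrev x s) _ _ (fun p => csize p)) => //.
- by apply: PT_catrev; [do 2!apply: PT_snd | apply: PT_fst; apply: PT_snd]; apply: PT_id.
- exact: PT_const.
- by pb.
by move=> a s x; rewrite csize_catrev csize_pair; lia.
Qed.

Lemma PT_filter A X {cA : codable A} {cX : codable X} (P : A -> X -> bool) (l : A -> seq X) :
  PT (fun p : A * X => P p.1 p.2) -> PT l -> PT (fun a => [seq x <- l a | P a x]).
Proof.
move=> HP Hl.
apply: (@PT_ext _ _ _ _ (fun a => flatten [seq (if P a x then [:: x] else [::]) | x <- l a])).
  by move=> a; elim: (l a) => //= x s ->; case: ifP.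
apply: PT_flatten; apply: PT_map => //; apply: PT_if => //; last exact: PT_const.
by apply: PT_cons; [apply: PT_snd; apply: PT_id | apply: PT_const].
Qed.

Lemma PT_all A X {cA : codable A} {cX : codable X} (P : A -> X -> bool) (l : A -> seq X) :
  PT (fun p : A * X => P p.1 p.2) -> PT l -> PT (fun a => all (P a) (l a)).
Proof.
move=> HP Hl; apply: (@PT_ext _ _ _ _ (fun a => nilp [seq x <- l a | ~~ P a x])).
  by move=> a; elim: (l a) => //= x s <-; case: (P a x).
apply: PT_nilp; apply: PT_filter => //.
by apply: PT_if => //; apply: PT_const.
Qed.

Lemma PT_has A X {cA : codable A} {cX : codable X} (P : A -> X -> bool) (l : A -> seq X) :
  PT (fun p : A * X => P p.1 p.2) -> PT l -> PT (fun a => has (P a) (l a)).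
Proof.
move=> HP Hl; apply: (@PT_ext _ _ _ _ (fun a =>
    if all (fun x => if P a x then false else true) (l a) then false else true)).
  by move=> a; elim: (l a) => //= x s; case: (P a x) => //= ->.
apply: PT_if; [|exact: PT_const|exact: PT_const].
by apply: PT_all => //; apply: PT_if => //; apply: PT_const.
Qed.

Lemma PT_head A X {cA : codable A} {cX : codable X} (d : A -> X) (f : A -> seq X) :
  PT d -> PT f -> PT (fun a => head (d a) (f a)).
Proof.
move=> Hd Hf.
apply: (@PT_ext _ _ _ _ (fun a => if nilp (f a) then d a else head dflt (f a))).
  by move=> a; case: (f a).
by apply: PT_if => //; [apply: PT_nilp | apply: PT_head_dflt].
Qed.

Lemma PT_negb A {cA : codable A} (b : A -> bool) : PT b -> PT (fun a => ~~ b a).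
Proof. by move=> Hb; apply: PT_if => //; apply: PT_const. Qed.

Lemma PT_andb A {cA : codable A} (b b' : A -> bool) :
  PT b -> PT b' -> PT (fun a => b a && b' a).
Proof. by move=> Hb Hb'; apply: PT_if => //; apply: PT_const. Qed.

Lemma PT_orb A {cA : codable A} (b b' : A -> bool) :
  PT b -> PT b' -> PT (fun a => b a || b' a).
Proof. by move=> Hb Hb'; apply: PT_if => //; apply: PT_const. Qed.

Lemma PT_eqb A {cA : codable A} (b b' : A -> bool) :
  PT b -> PT b' -> PT (fun a => b a == b' a).
Proof.
move=> Hb Hb'; apply: (@PT_ext _ _ _ _ (fun a => if b a then b' a else ~~ b' a)).
  by move=> a; case: (b a) (b' a) => -[].
by apply: PT_if => //; apply: PT_negb.
Qed.

(** * Unary arithmetic *)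

Lemma PT_S A {cA : codable A} (f : A -> nat) : PT f -> PT (fun a => (f a).+1).
Proof.
move=> Hf; apply: (PT_comp (g := fun p : unit * nat => p.2.+1)
  (PT_pair (PT_const tt) Hf)).
exact: (PT_tree PT_id).
Qed.

Lemma PT_pred A {cA : codable A} (f : A -> nat) :
  PT f -> PT (fun a => (f a).-1).
Proof. by move=> Hf; apply: PT_comp Hf (PT_tree PT_tsnd _); case. Qed.

(** A number and a list of that many units have the same code, so a number can serve as fuel. *)
Lemma PT_nseq_tt A {cA : codable A} (f : A -> nat) :
  PT f -> PT (fun a => nseq (f a) tt).
Proof.
move=> Hf; apply: (PT_comp Hf (g := fun n => nseq n tt)); apply: (PT_tree PT_id).
by elim=> //= n ->.
Qed.

Lemma PT_iter A {cA : codable A} X {cX : codable X} (body : A -> X -> X)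
    (x0 : A -> X) (f M : A -> nat) :
  PT (fun p : A * X => body p.1 p.2) -> PT x0 -> PT f -> pbnd M ->
  (forall a n, n <= f a -> csize (iter n (body a) (x0 a)) <= M a) ->
  PT (fun a => iter (f a) (body a) (x0 a)).
Proof.
move=> Hb Hx Hf bM HM.
have E a n : foldl (fun x (_ : unit) => body a x) (x0 a) (nseq n tt) = iter n (body a) (x0 a).
  by elim: n (x0 a) => //= n IH x; rewrite IH -iterS iterSr.
apply: (PT_ext (fun a => E a (f a))).
apply: (@PT_foldl _ _ _ _ _ _ (fun a x (_ : unit) => body a x) _ _ M) => //.
- apply: (PT_comp (f := fun p : A * (X * unit) => (p.1, p.2.1)) _ Hb).
  by apply: PT_pair; [| apply: PT_fst; apply: PT_snd]; [apply: PT_fst |]; apply: PT_id.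
- exact: PT_nseq_tt.
move=> a n; case: (leqP n (f a)) => H; first by rewrite take_nseq // E; apply: HM.
by rewrite take_oversize ?size_nseq ?(ltnW H) // E; apply: HM.
Qed.

Lemma PT_addn A {cA : codable A} (f g : A -> nat) :
  PT f -> PT g -> PT (fun a => f a + g a).
Proof.
move=> Hf Hg; apply: (@PT_ext _ _ _ _ (fun a => iter (f a) S (g a))).
  by move=> a; elim: (f a) => //= n ->.
apply: (@PT_iter _ _ _ _ (fun=> S) _ _ (fun a => csize (f a) + csize (g a))) => //.
- by apply: PT_S; apply: PT_snd; apply: PT_id.
- by pb; apply: PT_csize.
move=> a n; rewrite !csize_nat.
have -> : iter n S (g a) = n + g a by elim: n => //= n ->.
by lia.
Qed.

Lemma PT_subn A {cA : codable A} (f g : A -> nat) :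
  PT f -> PT g -> PT (fun a => f a - g a).
Proof.
move=> Hf Hg; apply: (@PT_ext _ _ _ _ (fun a => iter (g a) predn (f a))).
  by move=> a; elim: (g a) => /= [|n ->]; rewrite ?subn0 // subnS.
apply: (@PT_iter _ _ _ _ (fun=> predn) _ _ (fun a => csize (f a))) => //.
- by apply: PT_pred; apply: PT_snd; apply: PT_id.
- by pb; apply: PT_csize.
move=> a n _; rewrite !csize_nat.
have -> : iter n predn (f a) = f a - n by elim: n => /= [|n ->]; rewrite ?subn0 // subnS.
by lia.
Qed.

Lemma PT_eq0 A {cA : codable A} (f : A -> nat) : PT f -> PT (fun a => f a == 0).
Proof.
move=> Hf; apply: (PT_ext _ (PT_nilp (PT_nseq_tt Hf))) => a.
by case: (f a).
Qed.

Lemma PT_leq A {cA : codable A} (f g : A -> nat) :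
  PT f -> PT g -> PT (fun a => f a <= g a).
Proof. by move=> Hf Hg; apply: PT_eq0; apply: PT_subn. Qed.

Lemma PT_eqn A {cA : codable A} (f g : A -> nat) :
  PT f -> PT g -> PT (fun a => f a == g a).
Proof.
move=> Hf Hg; apply: (PT_ext (f := fun a => (f a <= g a) && (g a <= f a))).
  by move=> a; rewrite eqn_leq.
by apply: PT_andb; apply: PT_leq.
Qed.

Lemma PT_muln A {cA : codable A} (f g : A -> nat) :
  PT f -> PT g -> PT (fun a => f a * g a).
Proof.
move=> Hf Hg; apply: (@PT_ext _ _ _ _ (fun a => iter (f a) (addn (g a)) 0)).
  by move=> a; elim: (f a) => //= n ->; rewrite mulSn.
apply: (@PT_iter _ _ _ _ (fun a => addn (g a)) _ _ (fun a => csize (f a) * csize (g a) + 1)) => //.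
- apply: PT_addn; last by apply: PT_snd; apply: PT_id.
  by apply: (PT_comp _ Hg); apply: PT_fst; apply: PT_id.
- exact: PT_const.
- by pb; apply: PT_csize.
move=> a n nf; rewrite !csize_nat.
have -> : iter n (addn (g a)) 0 = n * g a by elim: {nf} n => //= n ->; rewrite mulSn.
by nia.
Qed.

Lemma PT_expn_const A {cA : codable A} (f : A -> nat) (n : nat) :
  PT f -> PT (fun a => f a ^ n).
Proof.
move=> Hf; elim: n => [|n IH]; first exact: PT_const.
by apply: (PT_ext _ (PT_muln Hf IH)) => a; rewrite expnS.
Qed.

Lemma PT_size A {cA : codable A} X {cX : codable X} (l : A -> seq X) :
  PT l -> PT (fun a => size (l a)).
Proof.
move=> Hl; apply: (@PT_ext _ _ _ _ (fun a => foldl (fun n _ => n.+1) 0 (l a))).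
  have E n (s : seq X) : foldl (fun n _ => n.+1) n s = n + size s.
    by elim: s n => [|x s IH] n /=; rewrite ?addn0 // IH addnS.
  by move=> a; rewrite E.
apply: (@PT_foldl_inc _ _ _ _ _ _ (fun=> fun n _ => n.+1) _ _ (fun=> 2)) => //.
- by apply: PT_S; apply: PT_fst; apply: PT_snd; apply: PT_id.
- exact: PT_const.
- by pb.
by move=> a n x; rewrite !csize_nat; lia.
Qed.

Lemma PT_iota A {cA : codable A} (f g : A -> nat) :
  PT f -> PT g -> PT (fun a => iota (f a) (g a)).
Proof.
move=> Hf Hg.
have E m n : iter n (fun s => (m + size s) :: s) [::] = rev (iota m n).
  by elim: n => //= n ->; rewrite size_rev size_iota -rev_rcons -cats1 -(iotaD m n 1) addn1.
apply: (@PT_ext _ _ _ _ (fun a => rev (iter (g a) (fun s => (f a + size s) :: s) [::]))).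
  by move=> a; rewrite E revK.
apply: PT_rev.
apply: (@PT_iter _ _ _ _ (fun a s => (f a + size s) :: s) _ _
  (fun a => csize (g a) * (csize (f a) + csize (g a) + 3) + 1)) => //.
- apply: PT_cons; last by apply: PT_snd; apply: PT_id.
  apply: PT_addn; first by apply: (PT_comp _ Hf); apply: PT_fst; apply: PT_id.
  by apply: PT_size; apply: PT_snd; apply: PT_id.
- exact: PT_const.
- by pb; apply: PT_csize.
move=> a n ng.
apply: (@leq_trans (n * (csize (f a) + csize (g a) + 3) + 1)); last first.
  by rewrite leq_add2r leq_mul2r; apply/orP; right; rewrite csize_nat; lia.
elim: n ng => [|n IH] ng //=.
rewrite csize_cons csize_nat [in X in (f a + X)]E size_rev size_iota; have := IH (ltnW ng).
by rewrite !csize_nat; lia.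
Qed.

Lemma PT_nseq A {cA : codable A} X {cX : codable X} (f : A -> nat) (x : A -> X) :
  PT f -> PT x -> PT (fun a => nseq (f a) (x a)).
Proof.
move=> Hf Hx; apply: (@PT_ext _ _ _ _ (fun a => [seq x a | _ <- nseq (f a) tt])).
  by move=> a; rewrite map_nseq.
apply: PT_map; last exact: PT_nseq_tt.
by apply: (PT_comp _ Hx); apply: PT_fst; apply: PT_id.
Qed.

Lemma PT_drop A {cA : codable A} X {cX : codable X} (f : A -> nat) (l : A -> seq X) :
  PT f -> PT l -> PT (fun a => drop (f a) (l a)).
Proof.
have E n (s : seq X) : iter n behead s = drop n s.
  by elim: n s => [|n IH] s; rewrite ?drop0 // iterSr IH; case: s => //=; rewrite drop_nil.
move=> Hf Hl; apply: (@PT_ext _ _ _ _ (fun a => iter (f a) behead (l a))) => //.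
apply: (@PT_iter _ _ _ _ (fun=> behead) _ _ (fun a => csize (l a))) => //.
- by apply: PT_behead; apply: PT_snd; apply: PT_id.
- exact: PT_csize.
by move=> a n _; rewrite E csize_drop.
Qed.

Lemma PT_take A {cA : codable A} X {cX : codable X} (f : A -> nat) (l : A -> seq X) :
  PT f -> PT l -> PT (fun a => take (f a) (l a)).
Proof.
move=> Hf Hl; apply: (@PT_ext _ _ _ _ (fun a => rev (drop (size (l a) - f a) (rev (l a))))).
  move=> a; rewrite drop_rev revK; case: (leqP (f a) (size (l a))) => H.
    by rewrite subKn.
  by rewrite (eqP (ltnW H)) subn0 take_size take_oversize // ltnW.
by apply: PT_rev; apply: PT_drop; [apply: PT_subn => //; apply: PT_size | apply: PT_rev].
Qed.

Lemma PT_nth A {cA : codable A} X {cX : codable X} (d : A -> X) (l : A -> seq X) (f : A -> nat) :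
  PT d -> PT l -> PT f -> PT (fun a => nth (d a) (l a) (f a)).
Proof.
move=> Hd Hl Hf; apply: (PT_ext _ (PT_head Hd (PT_drop Hf Hl))) => a.
by rewrite -nth0 nth_drop addn0.
Qed.

Lemma PT_eqseq A {cA : codable A} (X : eqType) {cX : codable X} (s t : A -> seq X) :
  PT (fun p : X * X => p.1 == p.2) -> PT s -> PT t -> PT (fun a => s a == t a).
Proof.
move=> HX Hs Ht; apply: (@PT_ext _ _ _ _ (fun a => (size (s a) == size (t a)) &&
    all (fun i => nth dflt (s a) i == nth dflt (t a) i) (iota 0 (size (s a))))).
  move=> a; apply/andP/eqP => [[/eqP E /allP H]|->]; last first.
    by rewrite eqxx; split=> //; apply/allP => i _.
  apply: (@eq_from_nth _ dflt) => // i Hi; apply/eqP/H.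
  by rewrite mem_iota.
apply: PT_andb; first by apply: PT_eqn; apply: PT_size.
apply: PT_all; last by apply: PT_iota; [apply: PT_const | apply: PT_size].
apply: (PT_comp (f := fun p : A * nat => (nth dflt (s p.1) p.2, nth dflt (t p.1) p.2)) _ HX).
apply: PT_pair; apply: PT_nth; try exact: PT_const; try by apply: PT_snd; apply: PT_id.
  by apply: (PT_comp _ Hs); apply: PT_fst; apply: PT_id.
by apply: (PT_comp _ Ht); apply: PT_fst; apply: PT_id.
Qed.

Lemma PT_mem_nat A {cA : codable A} (f : A -> nat) (l : A -> seq nat) :
  PT f -> PT l -> PT (fun a => f a \in l a).
Proof.
move=> Hf Hl; apply: (PT_ext (f := fun a => has (fun x => x == f a) (l a))).
  by move=> a; apply: has_pred1.
apply: PT_has => //; apply: PT_eqn; first by apply: PT_snd; apply: PT_id.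
by apply: (PT_comp _ Hf); apply: PT_fst; apply: PT_id.
Qed.

(** A hook, redefined below as further functions are shown to be polynomial; [pt] decomposes a goal
    along the head symbols of the function body. *)
Ltac pt_user := fail.

Ltac pt_step := first [ assumption
  | match goal with H : PT ?f |- PT (fun a => ?f (@?g a)) =>
      refine (PT_comp (f := g) _ H) end
  | pt_user | lazymatch goal with
  | |- PT (fun a => a) => exact PT_id
  | |- PT (fun _ => ?c) => exact (PT_const c)
  | |- PT (fun a => (@?x a, @?y a)) => refine (PT_pair _ _)
  | |- PT (fun a => fst (@?x a)) => refine (PT_fst _)
  | |- PT (fun a => snd (@?x a)) => refine (PT_snd _)
  | |- PT (fun a => andb (@?x a) (@?y a)) => refine (PT_andb _ _)
  | |- PT (fun a => orb (@?x a) (@?y a)) => refine (PT_orb _ _)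
  | |- PT (fun a => negb (@?x a)) => refine (PT_negb _)
  | |- PT (fun a => leq (@?x a) (@?y a)) => refine (PT_leq _ _)
  | |- PT (fun a => in_mem (@?x a) (@?y a)) => refine (PT_mem_nat _ _)
  | |- PT (fun a => S (@?x a)) => refine (PT_S _)
  | |- PT (fun a => predn (@?x a)) => refine (PT_pred _)
  | |- PT (fun a => addn (@?x a) (@?y a)) => refine (PT_addn _ _)
  | |- PT (fun a => subn (@?x a) (@?y a)) => refine (PT_subn _ _)
  | |- PT (fun a => muln (@?x a) (@?y a)) => refine (PT_muln _ _)
  | |- PT (fun a => expn (@?x a) _) => refine (PT_expn_const _ _)
  | |- PT (fun a => cons (@?x a) (@?y a)) => refine (PT_cons _ _)
  | |- PT (fun a => behead (@?x a)) => refine (PT_behead _)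
  | |- PT (fun a => nilp (@?x a)) => refine (PT_nilp _)
  | |- PT (fun a => head (@?x a) (@?y a)) => refine (PT_head _ _)
  | |- PT (fun a => nth (@?x a) (@?y a) (@?z a)) => refine (PT_nth _ _ _)
  | |- PT (fun a => size (@?x a)) => refine (PT_size _)
  | |- PT (fun a => cat (@?x a) (@?y a)) => refine (PT_cat _ _)
  | |- PT (fun a => rev (@?x a)) => refine (PT_rev _)
  | |- PT (fun a => iota (@?x a) (@?y a)) => refine (PT_iota _ _)
  | |- PT (fun a => nseq (@?x a) (@?y a)) => refine (PT_nseq _ _)
  | |- PT (fun a => drop (@?x a) (@?y a)) => refine (PT_drop _ _)
  | |- PT (fun a => take (@?x a) (@?y a)) => refine (PT_take _ _)
  | |- PT (fun a => flatten (@?x a)) => refine (PT_flatten _)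
  | |- PT (fun a => filter (@?x a) (@?y a)) => refine (PT_filter _ _)
  | |- PT (fun a => map (@?x a) (@?y a)) => refine (PT_map _ _)
  | |- PT (fun a => all (@?x a) (@?y a)) => refine (PT_all _ _)
  | |- PT (fun a => has (@?x a) (@?y a)) => refine (PT_has _ _)
  | |- PT (fun a => eq_op (@?x a) (@?y a)) =>
      first [refine (PT_eqn _ _) | refine (PT_eqb _ _) | refine (PT_eqseq _ _ _)]
  | |- PT (fun a => if _ then _ else _) => refine (PT_if _ _ _)
  | |- PT (fun a => _) => fail
  | |- PT ?f => refine (_ : PT (fun a => f a))
  end ].

Ltac pt := repeat pt_step.

(** * The reduction as a function *)

(** The two tag bits are those of [enc_gate]: the first is set for [And] and [Or], the second for
    [Not] and [Or]. Case analysis on gates becomes tests of booleans. *)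
Definition gate_rep (g : gate) : (bool * bool) * seq nat :=
  match g with
  | Input => ((false, false), [::])
  | Not j => ((false, true), [:: j])
  | And js => ((true, false), js)
  | Or js => ((true, true), js)
  end.

Definition is_andor (g : gate) : bool := (gate_rep g).1.1.
Definition is_notor (g : gate) : bool := (gate_rep g).1.2.

Definition mk_gate (b1 b2 : bool) (js : seq nat) : gate :=
  if b1 then (if b2 then Or js else And js)
  else if b2 then Not (head 0 js) else Input.

#[export] Instance codable_gate : codable gate :=
  Codable (fun g => tenc (gate_rep g)) Input.

(* A parser state is [((mode, tag bits), (number, (arguments, gates)))], the two
   lists being reversed. *)
Definition pstate : Type := (nat * (bool * bool)) * (nat * (seq nat * seq gate)).

(** Modes: 0 between gates, 1 and 2 before the first and second tag bit, 3 inside the number of a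
    [Not], 4 between the arguments of an [And] or [Or], 5 inside such an argument, 6 after the end
    of the circuit. *)
Definition pstep (s : pstate) (b : bool) : pstate :=
  if s.1.1 == 0 then
    ((if b then 1 else 6, s.1.2), s.2)
  else if s.1.1 == 1 then
    ((2, (b, s.1.2.2)), s.2)
  else if s.1.1 == 2 then
    if s.1.2.1 then ((4, (s.1.2.1, b)), s.2)
    else if b then ((3, (s.1.2.1, b)), s.2)
    else ((0, (s.1.2.1, b)), (s.2.1, (s.2.2.1, Input :: s.2.2.2)))
  else if s.1.1 == 3 then
    if b then (s.1, (s.2.1.+1, s.2.2))
    else ((0, s.1.2), (0, (s.2.2.1, Not s.2.1 :: s.2.2.2)))
  else if s.1.1 == 4 then
    if b then ((5, s.1.2), s.2)
    else ((0, s.1.2),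
          (s.2.1, ([::], mk_gate s.1.2.1 s.1.2.2 (rev s.2.2.1) :: s.2.2.2)))
  else if s.1.1 == 5 then
    if b then (s.1, (s.2.1.+1, s.2.2))
    else ((4, s.1.2), (0, (s.2.1 :: s.2.2.1, s.2.2.2)))
  else s.

Definition parse_circuit (x : seq bool) : circuit :=
  rev (foldl pstep ((0, (false, false)), (0, ([::], [::]))) x).2.2.2.

Fixpoint evalf (d : nat) (C : circuit) (B : seq nat) (v : nat) : bool :=
  if d is e.+1 then
    if is_andor (node C v) then
      if is_notor (node C v) then has (evalf e C B) (gate_args (node C v))
      else all (evalf e C B) (gate_args (node C v))
    else if is_notor (node C v) then ~~ evalf e C B (head 0 (gate_args (node C v)))
    else v \in B
  else v \in B.

Definition is_inputb (C : circuit) (v : nat) : bool :=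
  ~~ is_andor (node C v) && ~~ is_notor (node C v).

(* Input nodes below [v]; only meaningful if [v] has no large node below it. *)
Fixpoint varsf (d : nat) (C : circuit) (v : nat) : seq nat :=
  if d is e.+1 then
    if is_inputb C v then [:: v]
    else flatten [seq varsf e C j | j <- take 2 (gate_args (node C v))]
  else [:: v].

Fixpoint smallf (d : nat) (C : circuit) (v : nat) : bool :=
  if d is e.+1 then
    (size (gate_args (node C v)) <= 2) && all (smallf e C) (gate_args (node C v))
  else true.

Fixpoint weft1f (d : nat) (C : circuit) (v : nat) : bool :=
  if d is e.+1 then
    if size (gate_args (node C v)) <= 2 then all (weft1f e C) (gate_args (node C v))
    else all (smallf e C) (gate_args (node C v))
  else true.

Fixpoint depthf (d : nat) (C : circuit) (v : nat) : bool :=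
  if d is e.+1 then is_inputb C v || all (depthf e C) (gate_args (node C v))
  else is_inputb C v.

(* A literal [(u, b)] asserts that node [u] has value [b]; the result is a
   disjunction of conjunctions of literals equivalent to the literal [(v, b)]. *)
Fixpoint dnff (d : nat) (C : circuit) (v : nat) (b : bool) : seq (seq (nat * bool)) :=
  if d is e.+1 then
    if is_andor (node C v) then
      if is_notor (node C v) == b then
        if size (gate_args (node C v)) <= 2 then
          flatten [seq dnff e C j b | j <- gate_args (node C v)]
        else [seq [:: (j, b)] | j <- gate_args (node C v)]
      else
        if size (gate_args (node C v)) <= 2 then
          flatten [seq [seq c ++ c' | c' <- dnff e C (nth 0 (gate_args (node C v)) 1) b]
                  | c <- dnff e C (nth 0 (gate_args (node C v)) 0) b]
        else [:: [seq (j, b) | j <- gate_args (node C v)]]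
    else if is_notor (node C v) then
      dnff e C (head 0 (gate_args (node C v))) (~~ b)
    else [:: [:: (v, b)]]
  else [:: [:: (v, b)]].

Definition phi (d : nat) (C : circuit) (B : seq nat) (c : seq (nat * bool)) : bool :=
  all (fun l => evalf d C B l.1 == l.2) c.

Definition failing_vars d (C : circuit) (B : seq nat) (c : seq (nat * bool)) :=
  varsf d C (head (0, false) [seq l <- c | ~~ (evalf d C B l.1 == l.2)]).1.

Definition vals (b : seq (nat * nat)) : seq nat := [seq p.2 | p <- b].

(** A branch guesses the new input and also its index in the enumeration of [A], whence at most
    [k * 2 ^ d] children of an unfinished branch. *)
Definition grow d C k (c : seq (nat * bool)) (b : seq (nat * nat)) :=
  if phi d C (vals b) c then [:: b]
  else flatten [seq [seq (i, x) :: b | x <- failing_vars d C (vals b) c] | i <- iota 1 k].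

(** For a branch and itself this says that the branch is a partial injection from indices to values;
    for all pairs of branches in a clique, that their union is one. *)
Definition consistent (b b' : seq (nat * nat)) : bool :=
  all (fun p => all (fun p' => (p.1 == p'.1) == (p.2 == p'.2)) b') b.

(** Along a branch that follows [A], each round adds a new value, and only the [k] elements of [A]
    and the padding value [size C] are available; hence [k.+1] rounds. Branches that finish earlier
    are passed on unchanged by [grow]. *)
Definition leaves d C k c (N : seq (nat * nat)) : seq (seq (nat * nat)) :=
  [seq b <- iter k.+1 (fun s => flatten [seq grow d C k c b | b <- s]) [:: N]
     | phi d C (vals b) c && consistent b b].

Definition inputs (C : circuit) : seq nat :=
  [seq i <- iota 0 (size C) | is_inputb C i].

(* Index 0 selects no input; it is paired with [size C], which is not a node. *)
Definition choices (C : circuit) (k : nat) : seq (nat * nat) :=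
  (0, size C) :: flatten [seq [seq (j, x) | x <- inputs C] | j <- iota 1 k].

Fixpoint tuples (T : Type) (q : nat) (l : seq T) : seq (seq T) :=
  if q is r.+1 then flatten [seq [seq x :: t | t <- tuples r l] | x <- l]
  else [:: [::]].

(** The number of a conjunction, a class, that is, the tuple of indices naming [N], and a leaf of
    the search tree rooted at [N]. *)
Definition vertex : Type := nat * (seq nat * seq (nat * nat)).

Definition out_dnf d (C : circuit) := dnff d C (size C).-1 true.

Definition verts d (C : circuit) (k : nat) : seq vertex :=
  flatten [seq flatten [seq [seq (w, ([seq p.1 | p <- N], b))
                            | b <- leaves d C k (nth [::] (out_dnf d C) w) N]
                       | N <- tuples (2 ^ d) (choices C k)]
          | w <- iota 0 (size (out_dnf d C))].

Definition adj (u v : vertex) : bool :=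
  [&& u.1 == v.1, ~~ (u.2.1 == v.2.1) & consistent u.2.2 v.2.2].

Definition vertex0 : vertex := (0, ([::], [::])).

Definition graph_edges (V : seq vertex) : seq (nat * nat) :=
  flatten [seq [seq (i, j) | j <- iota 0 (size V)
                           & (i == j) || adj (nth vertex0 V i) (nth vertex0 V j)]
          | i <- iota 0 (size V)].

Definition clique_sched (n : nat) (E : seq (nat * nat)) (K : nat) : sched_instance :=
  SchedInstance (nseq n (K * K).+1 ++ nseq (size E) 1)
    (flatten [seq [:: ((nth (0, 0) E i).1, n + i); ((nth (0, 0) E i).2, n + i)]
             | i <- iota 0 (size E)])
    (K * (K * K).+1 + K * K).

Definition uniqb (s : seq nat) : bool :=
  all (fun x => size [seq y <- s | y == x] <= 1) s.

Definition wf_circuitb (C : circuit) : bool :=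
  [&& 0 < size C,
      all (fun i => all (fun j => j < i) (gate_args (node C i))) (iota 0 (size C)),
      all (fun i => ~~ is_andor (node C i) ||
             (uniqb (gate_args (node C i)) && (1 < size (gate_args (node C i)))))
        (iota 0 (size C)) &
      all (fun i => has (fun l => i \in gate_args (node C l)) (iota 0 (size C)))
        (iota 0 (size C).-1)].

(** The parser accepts every bit string; comparing the re-encoded circuit with [x] detects the
    strings that are not codes. *)
Definition valid d (x : seq bool) : bool :=
  [&& enc_circuit (parse_circuit x) == x, wf_circuitb (parse_circuit x),
      depthf d (parse_circuit x) (size (parse_circuit x)).-1 &
      weft1f d (parse_circuit x) (size (parse_circuit x)).-1].

Definition nclasses (d k : nat) : nat := k.+1 ^ (2 ^ d).

(** A string that fails the test is sent to an instance without jobs and with target 1, a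
    no-instance. *)
Definition reduction d (x : seq bool) (k : nat) : seq bool * nat :=
  if valid d x then
    (enc_sched (clique_sched (size (verts d (parse_circuit x) k))
                  (graph_edges (verts d (parse_circuit x) k)) (nclasses d k)),
     nclasses d k + nclasses d k * nclasses d k)
  else (enc_sched (SchedInstance [::] [::] 0), 1).

(** * The reduction runs in polynomial time *)

Definition padding (k : nat) : nat := 2 ^ (k.+1 * k.+1).

(* A parameter whose encoding is long enough to make the search tree polynomial. *)
Record param : Type := Param { pval : nat }.

#[export] Instance codable_param : codable param :=
  Codable (fun K => tenc (pval K, padding (pval K))) (Param 0).

Lemma PT_pval A {cA : codable A} (f : A -> param) : PT f -> PT (fun a => pval (f a)).
Proof. by move=> Hf; apply: PT_comp Hf (PT_tree PT_tfst _). Qed.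

Lemma PT_is_andor A {cA : codable A} (f : A -> gate) : PT f -> PT (fun a => is_andor (f a)).
Proof.
move=> Hf; apply: (PT_comp Hf (g := is_andor)).
by apply: (@PT_tree _ _ _ _ (fun t => tfst (tfst t))) => //; apply: PT_comp; apply: PT_tfst.
Qed.

Lemma PT_is_notor A {cA : codable A} (f : A -> gate) : PT f -> PT (fun a => is_notor (f a)).
Proof.
move=> Hf; apply: (PT_comp Hf (g := is_notor)).
apply: (@PT_tree _ _ _ _ (fun t => tsnd (tfst t))) => //.
exact: PT_comp PT_tfst PT_tsnd.
Qed.

Lemma PT_gate_args A {cA : codable A} (f : A -> gate) : PT f -> PT (fun a => gate_args (f a)).
Proof.
move=> Hf; apply: (PT_comp Hf (g := gate_args)).
by apply: (@PT_tree _ _ _ _ tsnd _ PT_tsnd); case.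
Qed.

Lemma PT_node A {cA : codable A} (f : A -> circuit) (g : A -> nat) :
  PT f -> PT g -> PT (fun a => node (f a) (g a)).
Proof. by move=> Hf Hg; apply: (PT_nth (PT_const _) Hf Hg). Qed.

Lemma PT_mk_gate A {cA : codable A} (f g : A -> bool) (h : A -> seq nat) :
  PT f -> PT g -> PT h -> PT (fun a => mk_gate (f a) (g a) (h a)).
Proof.
move=> Hf Hg Hh.
(* A gate and its [gate_rep] have the same code, so a program for the latter is one for the
   former. *)
have mk (k : A -> gate) : PT (fun a => gate_rep (k a)) -> PT k.
  move=> Hk.
  by case: Hk => p [T [Hp bT]]; exists p, T.
rewrite /mk_gate; refine (PT_if Hf (PT_if Hg _ _) (PT_if Hg _ _)); apply: mk => /=; pt.
Qed.

Lemma PT_Not A {cA : codable A} (f : A -> nat) : PT f -> PT (fun a => Not (f a)).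
Proof.
by move=> Hf; apply: (PT_mk_gate (PT_const false) (PT_const true) (PT_cons Hf (PT_const [::]))).
Qed.

Ltac pt_gates := lazymatch goal with
  | |- PT (fun a => Not (@?f a)) => refine (PT_Not _)
  | |- PT (fun a => pval (@?f a)) => refine (PT_pval _)
  | |- PT (fun a => is_andor (@?f a)) => refine (PT_is_andor _)
  | |- PT (fun a => is_notor (@?f a)) => refine (PT_is_notor _)
  | |- PT (fun a => gate_args (@?f a)) => refine (PT_gate_args _)
  | |- PT (fun a => node (@?f a) (@?g a)) => refine (PT_node _ _)
  | |- PT (fun a => mk_gate (@?f a) (@?g a) (@?h a)) => refine (PT_mk_gate _ _ _)
  end.

Ltac pt_user ::= pt_gates.

Lemma csize_gate (g : gate) : csize g = csize (gate_rep g).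
Proof. by []. Qed.

Lemma csize_rev X {cX : codable X} (s : seq X) : csize (rev s) = csize s.
Proof. by rewrite /rev csize_catrev; have := csize_gt0 s; rewrite [csize [::]]/csize /=; lia. Qed.

(** A constant increase per bit is what [PT_foldl_inc] asks for. The head of the argument list is
    bounded as well because [mk_gate] uses it in its negation case. *)
Lemma csize_pstep s b : csize (pstep s b) <= csize s + 40.
Proof.
have c0 : csize ([::] : seq nat) = 1 by [].
have cb (x : bool) : 0 < csize x <= 3 by case: x.
case: s => -[m [b1 b2]] [n [js gs]]; rewrite /pstep /=.
have hb1 := cb b1; have hb2 := cb b2; have hb := cb b.
have js0 : 0 < csize js := csize_gt0 _.
have hd : csize (head 0 (rev js)) <= csize js.
  by rewrite -(csize_rev js); case: (rev js) => [|j l] //=; rewrite csize_cons; lia.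
rewrite !csize_nat in hd; rewrite /mk_gate.
have ct : csize true = 3 by [].
have cf : csize false = 1 by [].
by do !case: ifP => _; rewrite !(csize_pair, csize_cons, csize_gate, csize_rev, csize_nat, c0, ct, cf) /=
  ?(csize_pair, csize_cons, csize_gate, csize_rev, csize_nat, c0, ct, cf); lia.
Qed.

Lemma PT_parse_circuit A {cA : codable A} (f : A -> seq bool) : PT f -> PT (fun a => parse_circuit (f a)).
Proof.
move=> Hf; apply: (PT_comp Hf (g := parse_circuit)).
rewrite /parse_circuit; do 4!pt_step.
apply: (@PT_foldl_inc _ _ _ _ _ _ (fun=> pstep) (fun=> ((0, (false, false)), (0, ([::], [::]))))
          (fun x => x) (fun=> 40)); [|pt|pt|pb|].
- rewrite /pstep; pt.
by move=> a s x; apply: csize_pstep.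
Qed.

(** The recursion unfolds into [d] nested compositions, so the polynomial depends on the constant
    [d]. The environment type varies in the induction since the recursive call occurs inside list
    operations, whose environment is a pair. *)
Lemma PT_evalf d A {cA : codable A} (fC : A -> circuit) (fB : A -> seq nat) (fv : A -> nat) :
  PT fC -> PT fB -> PT fv -> PT (fun a => evalf d (fC a) (fB a) (fv a)).
Proof.
elim: d A cA fC fB fv => [|d IH] A cA fC fB fv HC HB Hv /=; first by pt.
by pt; apply: IH; pt.
Qed.

Lemma PT_is_inputb A {cA : codable A} (fC : A -> circuit) (fv : A -> nat) :
  PT fC -> PT fv -> PT (fun a => is_inputb (fC a) (fv a)).
Proof. by move=> HC Hv; rewrite /is_inputb; pt. Qed.

Ltac pt_nodes := lazymatch goal with
  | |- PT (fun a => is_inputb (@?f a) (@?g a)) => refine (PT_is_inputb _ _)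
  | |- PT (fun a => evalf _ (@?f a) (@?g a) (@?h a)) => refine (PT_evalf _ _ _ _)
  | |- PT (fun a => parse_circuit (@?f a)) => refine (PT_parse_circuit _)
  end.

Ltac pt_user ::= first [pt_gates | pt_nodes].

Lemma PT_varsf d A {cA : codable A} (fC : A -> circuit) (fv : A -> nat) :
  PT fC -> PT fv -> PT (fun a => varsf d (fC a) (fv a)).
Proof.
elim: d A cA fC fv => [|d IH] A cA fC fv HC Hv /=; first by pt.
by pt; apply: IH; pt.
Qed.

Lemma PT_smallf d A {cA : codable A} (fC : A -> circuit) (fv : A -> nat) :
  PT fC -> PT fv -> PT (fun a => smallf d (fC a) (fv a)).
Proof.
elim: d A cA fC fv => [|d IH] A cA fC fv HC Hv /=; first by pt.
by pt; apply: IH; pt.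
Qed.

Lemma PT_weft1f d A {cA : codable A} (fC : A -> circuit) (fv : A -> nat) :
  PT fC -> PT fv -> PT (fun a => weft1f d (fC a) (fv a)).
Proof.
elim: d A cA fC fv => [|d IH] A cA fC fv HC Hv /=; first by pt.
by pt; [apply: IH | apply: PT_smallf]; pt.
Qed.

Lemma PT_depthf d A {cA : codable A} (fC : A -> circuit) (fv : A -> nat) :
  PT fC -> PT fv -> PT (fun a => depthf d (fC a) (fv a)).
Proof.
elim: d A cA fC fv => [|d IH] A cA fC fv HC Hv /=; first by pt.
by pt; apply: IH; pt.
Qed.

Lemma PT_dnff d A {cA : codable A} (fC : A -> circuit) (fv : A -> nat) (fb : A -> bool) :
  PT fC -> PT fv -> PT fb -> PT (fun a => dnff d (fC a) (fv a) (fb a)).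
Proof.
elim: d A cA fC fv fb => [|d IH] A cA fC fv fb HC Hv Hb /=; first by pt.
by pt; apply: IH; pt.
Qed.

Lemma PT_phi d A {cA : codable A} (fC : A -> circuit) (fB : A -> seq nat) fc :
  PT fC -> PT fB -> PT fc -> PT (fun a => phi d (fC a) (fB a) (fc a)).
Proof. by move=> *; rewrite /phi; pt. Qed.

Lemma PT_vals A {cA : codable A} (f : A -> seq (nat * nat)) :
  PT f -> PT (fun a => vals (f a)).
Proof. by move=> *; rewrite /vals; pt. Qed.

Lemma PT_consistent A {cA : codable A} (f g : A -> seq (nat * nat)) :
  PT f -> PT g -> PT (fun a => consistent (f a) (g a)).
Proof. by move=> *; rewrite /consistent; pt. Qed.

Lemma PT_failing_vars d A {cA : codable A} (fC : A -> circuit) (fB : A -> seq nat) fc :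
  PT fC -> PT fB -> PT fc -> PT (fun a => failing_vars d (fC a) (fB a) (fc a)).
Proof. by move=> *; rewrite /failing_vars; apply: PT_varsf; pt. Qed.

Ltac pt_conj := lazymatch goal with
  | |- PT (fun a => phi _ (@?f a) (@?g a) (@?h a)) => refine (PT_phi _ _ _ _)
  | |- PT (fun a => vals (@?f a)) => refine (PT_vals _)
  | |- PT (fun a => consistent (@?f a) (@?g a)) => refine (PT_consistent _ _)
  | |- PT (fun a => failing_vars _ (@?f a) (@?g a) (@?h a)) =>
      refine (PT_failing_vars _ _ _ _)
  | |- PT (fun a => dnff _ (@?f a) (@?g a) (@?h a)) => refine (PT_dnff _ _ _ _)
  end.

Ltac pt_user ::= first [pt_gates | pt_nodes | pt_conj].

Lemma PT_grow d A {cA : codable A} (fC : A -> circuit) (fk : A -> nat) fc fb :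
  PT fC -> PT fk -> PT fc -> PT fb ->
  PT (fun a => grow d (fC a) (fk a) (fc a) (fb a)).
Proof. by move=> *; rewrite /grow; pt. Qed.

Lemma PT_tuples q X {cX : codable X} A {cA : codable A} (f : A -> seq X) :
  PT f -> PT (fun a => tuples q (f a)).
Proof.
elim: q A cA f => [|q IH] A cA f Hf /=; first by pt.
by pt; apply: IH; pt.
Qed.

Lemma PT_choices A {cA : codable A} (fC : A -> circuit) fk :
  PT fC -> PT fk -> PT (fun a => choices (fC a) (fk a)).
Proof. by move=> *; rewrite /choices /inputs; pt. Qed.

Lemma csize_all_le X {cX : codable X} (s : seq X) m :
  all (fun x => csize x <= m) s -> csize s <= size s * m.+1 + 1.
Proof.
elim: s => //= x s IH /andP[xm /IH {}IH].
by rewrite csize_cons mulSn; lia.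
Qed.

Lemma all_csize X {cX : codable X} (s : seq X) : all (fun x => csize x <= csize s) s.
Proof.
elim: s => //= x s IH; rewrite csize_cons; apply/andP; split; first by lia.
by apply: sub_all IH => y; lia.
Qed.

(** Levels of a search tree: a node has at most [R + 1] children, each longer than it by at most
    [L]. The number of nodes multiplies from level to level, so additive growth does not suffice and
    the final count has to be polynomial by hypothesis. *)
Lemma PT_branch A X {cA : codable A} {cX : codable X} (g : A -> X -> seq X)
    (s0 : A -> seq X) (f R L : A -> nat) :
  PT (fun p : A * X => g p.1 p.2) -> PT s0 -> PT f -> pbnd L ->
  pbnd (fun a => (R a).+1 ^ f a) ->
  (forall a x, size (g a x) <= (R a).+1) ->
  (forall a x, all (fun y => csize y <= csize x + L a) (g a x)) ->
  PT (fun a => iter (f a) (fun s => flatten [seq g a x | x <- s]) (s0 a)).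
Proof.
move=> Hg Hs Hf bL bR HR HL.
apply: (@PT_iter _ _ _ _ (fun a s => flatten [seq g a x | x <- s]) _ _ (fun a =>
  csize (s0 a) * ((R a).+1 ^ f a) * (csize (s0 a) + csize (f a) * L a + 1) + 1)) => //.
- by pt; apply: (PT_comp (f := fun p : A * seq X * X => (p.1.1, p.2)) _ Hg); pt.
- by pb; apply: PT_csize.
move=> a n nf; set st := iter _ _ _.
have Hsz : size st <= csize (s0 a) * (R a).+1 ^ n.
  rewrite /st; elim: (n) => [|m IH] /=; first by rewrite muln1 size_csize.
  rewrite size_flatten /shape -map_comp.
  apply: (@leq_trans (size (iter m (fun s => flatten [seq g a x | x <- s]) (s0 a)) * (R a).+1)).
    elim: (iter m _ _) => //= x s IHs; rewrite mulSn leq_add ?HR //.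
  by rewrite expnS mulnCA mulnC leq_mul2l IH orbT.
have Hel : all (fun x => csize x <= csize (s0 a) + n * L a) st.
  rewrite /st; elim: (n) => [|m IH] /=; first by rewrite mul0n addn0 all_csize.
  elim: (iter m _ _) IH => //= x s IHs /andP[Hx /IHs H]; rewrite all_cat H andbT.
  by apply: sub_all (HL a x) => y /=; lia.
apply: leq_trans (csize_all_le Hel) _; rewrite leq_add2r.
have RR : (R a).+1 ^ n <= (R a).+1 ^ f a by rewrite leq_pexp2l.
apply: leq_mul; first by apply: leq_trans Hsz _; rewrite leq_mul2l RR orbT.
by rewrite addn1 ltnS leq_add2l leq_mul2r csize_nat; apply/orP; right; lia.
Qed.

(** Thanks to [take 2] this holds for every list of gates; running times have to be bounded on
    ill-formed circuits too. *)
Lemma size_varsf d C v : size (varsf d C v) <= 2 ^ d.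
Proof.
elim: d v => //= d IH v; case: ifP => _ /=; first by rewrite expn_gt0.
rewrite size_flatten /shape -map_comp expnS.
case: (gate_args _) => [|i [|j s]] //=; rewrite ?take0 /= ?addn0.
  by apply: leq_trans (IH i) _; rewrite mul2n -addnn leq_addr.
by rewrite mul2n -addnn leq_add.
Qed.

(** The left side is at most [k.+1 ^ k.+1 * (2 ^ k.+1) ^ d], and both [k.+1 ^ k.+1] and [2 ^ k.+1]
    are at most [2 ^ (k.+1 * k.+1)]. This is where the square in the padding comes from. *)
Lemma padding_bound d A {cA : codable A} (f : A -> param) :
  PT f -> pbnd (fun a => (pval (f a) * 2 ^ d).+1 ^ (pval (f a)).+1).
Proof.
move=> Hf; have bf := PT_csize Hf.
apply: (pbnd_le (pbnd_mul bf (pbnd_exp d bf))) => a; set k := pval (f a).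
have pk : padding k <= csize (f a).
  have -> : csize (f a) = csize (k, padding k) by [].
  by rewrite csize_pair !csize_nat; lia.
apply: (@leq_trans ((k.+1 * 2 ^ d) ^ k.+1)).
  by rewrite leq_exp2r // mulSn; have := expn_gt0 2 d; lia.
rewrite expnMn; apply: leq_mul.
  apply: leq_trans pk; rewrite /padding expnM leq_exp2r //.
  exact/ltnW/ltn_expl.
case: d => [|d]; first by rewrite exp1n.
rewrite -expnM mulnC expnM leq_exp2r //; apply: leq_trans pk.
by rewrite leq_exp2l // leq_pmulr.
Qed.

Lemma PT_leaves d A {cA : codable A} (fC : A -> circuit) (fk : A -> param) fc fN :
  PT fC -> PT fk -> PT fc -> PT fN ->
  PT (fun a => leaves d (fC a) (pval (fk a)) (fc a) (fN a)).
Proof.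
move=> HC Hk Hc HN; rewrite /leaves; refine (PT_filter _ _); first by pt.
(* An input added to a branch is an element of some [varsf] list, whose code is polynomially long;
   this bounds the growth of a branch. *)
have [e He] : pbnd (fun p : circuit * nat => csize (varsf d p.1 p.2)).
  by apply: PT_csize; apply: PT_varsf; pt.
apply: (@PT_branch _ _ _ _ (fun a b => grow d (fC a) (pval (fk a)) (fc a) b) _ _
  (fun a => pval (fk a) * 2 ^ d)
  (fun a => csize (fk a) + (csize (fC a) + csize (fc a) + 5) ^ e + 3)); try by pt.
- by refine (PT_grow _ _ _ _ _); pt.
- by pb; apply: PT_csize.
- exact: padding_bound.
- move=> a b; rewrite /grow; case: ifP => _ //.
  rewrite size_flatten /shape -map_comp leqW //.
  rewrite -{2}(size_iota 1 (pval (fk a))); elim: (iota _ _) => //= i s IH.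
  by rewrite size_map mulSn leq_add // /failing_vars size_varsf.
move=> a b; rewrite /grow; case: ifP => _ /=; first by rewrite leq_addr.
apply/allP => y /flatten_mapP [i]; rewrite mem_iota => Hi /mapP [x Hx ->].
rewrite csize_cons csize_pair.
have Ci : @csize nat _ i <= csize (fk a).
  have -> : csize (fk a) = csize (pval (fk a), padding (pval (fk a))) by [].
  by rewrite csize_pair !csize_nat; lia.
rewrite /failing_vars in Hx; set v := (head _ _).1 in Hx *.
have Cv : csize v <= csize (fc a) + 1.
  rewrite /v; case E: [seq l <- fc a | _] => [|l s] /=; first by rewrite leq_addl.
  have : l \in fc a by have := mem_head l s; rewrite -E mem_filter => /andP[].
  move=> /(allP (all_csize (fc a))); case: (l) => u c; rewrite csize_pair /=; lia.
have Cx : @csize nat _ x <= (csize (fC a) + csize (fc a) + 5) ^ e.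
  apply: leq_trans (allP (all_csize _) _ Hx) _.
  apply: leq_trans (He (fC a, v)) _; case: (e) => // e'.
  by rewrite leq_exp2r // csize_pair; lia.
by move: (_ ^ e) Cx => P Cx; lia.
Qed.

Lemma PT_verts d A {cA : codable A} (fC : A -> circuit) (fk : A -> param) :
  PT fC -> PT fk -> PT (fun a => verts d (fC a) (pval (fk a))).
Proof.
move=> HC Hk; rewrite /verts /out_dnf; pt.
  by refine (PT_leaves _ _ _ _ _); pt.
by apply: PT_tuples; refine (PT_choices _ _); pt.
Qed.

Lemma PT_adj A {cA : codable A} (f g : A -> vertex) :
  PT f -> PT g -> PT (fun a => adj (f a) (g a)).
Proof. by move=> Hf Hg; rewrite /adj; pt. Qed.

Lemma PT_graph_edges A {cA : codable A} (f : A -> seq vertex) :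
  PT f -> PT (fun a => graph_edges (f a)).
Proof. by move=> Hf; rewrite /graph_edges; pt; refine (PT_adj _ _); pt. Qed.

Lemma PT_rcons A X {cA : codable A} {cX : codable X} (f : A -> seq X) (x : A -> X) :
  PT f -> PT x -> PT (fun a => rcons (f a) (x a)).
Proof. by move=> *; apply: (PT_ext (fun a => cats1 _ _)); pt. Qed.

Lemma PT_enc_unary A {cA : codable A} (f : A -> nat) :
  PT f -> PT (fun a => enc_unary (f a)).
Proof. by move=> *; rewrite /enc_unary /unary; refine (PT_rcons _ _); pt. Qed.

Lemma PT_enc_seq A X {cA : codable A} {cX : codable X} (e : X -> seq bool) (f : A -> seq X) :
  PT e -> PT f -> PT (fun a => enc_seq e (f a)).
Proof. by move=> *; rewrite /enc_seq; refine (PT_rcons _ _); pt. Qed.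

(** * Binary digits by repeated increment *)

Definition incr_step (st : bool * seq bool) (b : bool) : bool * seq bool :=
  (st.1 && b, ~~ (st.1 == b) :: st.2).

Definition incr (s : seq bool) : seq bool :=
  rev (foldl incr_step (true, [::]) s).2 ++
  (if (foldl incr_step (true, [::]) s).1 then [:: true] else [::]).

(** The fold propagates a carry from the least significant bit; this is the same ripple as a
    recursion, the form that matches the successor on binary numbers. *)
Lemma incrE s : incr s = if s is b :: t then (if b then false :: incr t else true :: t)
                         else [:: true].
Proof.
rewrite /incr; have H c t u : foldl incr_step (c, u) t =
   ((foldl incr_step (c, [::]) t).1, (foldl incr_step (c, [::]) t).2 ++ u).
  elim: t c u => [|b t IH] c u //=; rewrite /incr_step /= IH [in RHS]IH /=.
  by rewrite -catA.
have H0 t : foldl incr_step (false, [::]) t = (false, rev t).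
  elim: t => [|b t IH] //=; rewrite /incr_step /= H IH /= rev_cons -cats1.
  by case: b.
by case: s => [|[] t] //=; rewrite /incr_step /= H ?H0 /= rev_cat ?revK ?cats0.
Qed.

Lemma bits_S n : bits n.+1 = incr (bits n).
Proof.
have pos_incr p : pos_bits (PosDef.Pos.succ p) = incr (pos_bits p).
  by elim: p => [p IH|p IH|] /=; rewrite incrE //= IH.
rewrite /bits -{1}(bin_of_natK n).
case: (bin_of_nat n) => [|p] //.
have -> : (nat_of_bin (BinNums.Npos p)).+1 = nat_of_bin (BinNums.Npos (PosDef.Pos.succ p)).
  by rewrite /= nat_of_succ_pos.
by rewrite nat_of_binK pos_incr.
Qed.

Lemma size_incr s : size (incr s) <= (size s).+1.
Proof. by elim: s => [|[] s IH]; rewrite incrE /=. Qed.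

Lemma csize_bits (s : seq bool) : csize s <= 4 * size s + 1.
Proof.
elim: s => //= b s IH; rewrite csize_cons.
have : csize b <= 3 by case: b.
lia.
Qed.

(** The argument is coded in unary, so as many increments as its value are affordable. *)
Lemma PT_bits A {cA : codable A} (f : A -> nat) : PT f -> PT (fun a => bits (f a)).
Proof.
move=> Hf; apply: (PT_ext (f := fun a => iter (f a) incr [::])).
  by move=> a; elim: (f a) => //= n ->; rewrite bits_S.
apply: (@PT_iter _ _ _ _ (fun=> incr) _ _ (fun a => 4 * csize (f a) + 1)); try by pt.
- have Hfold : PT (fun p : A * seq bool => foldl incr_step (true, [::]) p.2).
    apply: (@PT_foldl_inc _ _ _ _ _ _ (fun=> incr_step) (fun=> (true, [::]))
      (fun p => p.2) (fun=> 10)); try by pt.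
    - by rewrite /incr_step; pt.
    - by pb.
    move=> a [c u] b; rewrite /incr_step /= !csize_pair csize_cons.
    have cb (x : bool) : 0 < csize x <= 3 by case: x.
    have := cb (c && b); have := cb (~~ (c == b)); have := cb c; lia.
  by rewrite /incr; pt.
- by pb; apply: PT_csize.
move=> a n nf; apply: leq_trans (csize_bits _) _.
have : size (iter n incr [::]) <= n.
  by elim: {nf} n => //= n IH; apply: leq_trans (size_incr _) _.
by rewrite csize_nat; lia.
Qed.

Lemma PT_enc_nat A {cA : codable A} (f : A -> nat) : PT f -> PT (fun a => enc_nat (f a)).
Proof.
move=> Hf; rewrite /enc_nat; refine (PT_enc_seq _ _); first by pt.
exact: PT_bits.
Qed.

Lemma PT_enc_circuit A {cA : codable A} (f : A -> circuit) :
  PT f -> PT (fun a => enc_circuit (f a)).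
Proof.
move=> Hf; rewrite /enc_circuit; refine (PT_enc_seq _ Hf).
have Eu : PT enc_unary by apply: PT_enc_unary; pt.
apply: (PT_ext (f := fun g => is_andor g :: is_notor g ::
   (if is_andor g then enc_seq enc_unary (gate_args g)
    else if is_notor g then enc_unary (head 0 (gate_args g)) else [::]))).
  by case.
by pt; refine (PT_enc_seq _ _); pt.
Qed.

Lemma PT_enc_clique_sched A {cA : codable A} (fn : A -> nat) fE (fK : A -> nat) :
  PT fn -> PT fE -> PT fK ->
  PT (fun a => enc_sched (clique_sched (fn a) (fE a) (fK a))).
Proof.
move=> Hn HE HK; rewrite /enc_sched /=.
have En : PT enc_nat by apply: PT_enc_nat; pt.
have Ea : PT enc_arc by rewrite /enc_arc; pt; refine (PT_enc_unary _); pt.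
pt; [refine (PT_enc_seq _ _) | refine (PT_enc_seq _ _)]; pt.
Qed.

Lemma uniqbE s : uniqb s = uniq s.
Proof.
apply/allP/idP => [H|us x xs]; last by rewrite size_filter count_uniq_mem // xs.
apply/count_mem_uniq => x; case: (boolP (x \in s)) => xs; last exact/count_memPn.
apply/eqP; rewrite eqn_leq -has_count has_pred1 xs andbT.
by have := H x xs; rewrite size_filter.
Qed.

Lemma PT_wf_circuitb A {cA : codable A} (f : A -> circuit) :
  PT f -> PT (fun a => wf_circuitb (f a)).
Proof. by move=> Hf; rewrite /wf_circuitb /uniqb; pt. Qed.

Lemma PT_valid d A {cA : codable A} (f : A -> seq bool) :
  PT f -> PT (fun a => valid d (f a)).
Proof.
move=> Hf; rewrite /valid; pt.
- by refine (PT_enc_circuit _); pt.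
- by refine (PT_wf_circuitb _); pt.
- by refine (PT_depthf _ _ _); pt.
- by refine (PT_weft1f _ _ _); pt.
Qed.

Lemma PT_reduction d : PT (fun i : seq bool * param => reduction d i.1 (pval i.2)).
Proof.
rewrite /reduction /nclasses; pt; first by refine (PT_valid _ _); pt.
refine (PT_enc_clique_sched _ _ _); pt.
- by refine (PT_verts _ _ _); pt.
- by refine (PT_graph_edges _); refine (PT_verts _ _ _); pt.
Qed.

(** * Parsing and evaluating circuits *)

Lemma pstep_unary m t n js gs j r : m = 3 \/ m = 5 ->
  foldl pstep ((m, t), (n, (js, gs))) (enc_unary j ++ r) =
  foldl pstep (pstep ((m, t), (n + j, (js, gs))) false) r.
Proof.
move=> Hm; elim: j n => [|j IH] n /=; first by rewrite addn0.
have -> : pstep (m, t, (n, (js, gs))) true = (m, t, (n.+1, (js, gs))).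
  by case: Hm => ->.
by rewrite IH addSnnS.
Qed.

Lemma pstep_args t js gs l r :
  foldl pstep ((4, t), (0, (js, gs))) (enc_seq enc_unary l ++ r) =
  foldl pstep ((0, t), (0, ([::], mk_gate t.1 t.2 (rev js ++ l) :: gs))) r.
Proof.
elim: l js => [|j l IH] js; first by rewrite cats0.
have -> : enc_seq enc_unary (j :: l) ++ r =
          true :: (enc_unary j ++ (enc_seq enc_unary l ++ r)).
  by rewrite /enc_seq /= rcons_cat -catA.
rewrite [LHS]/= pstep_unary; last by right.
by rewrite [pstep _ _]/= IH rev_cons cat_rcons add0n.
Qed.

Lemma pstep_gate t gs g r : exists t',
  foldl pstep ((1, t), (0, ([::], gs))) (enc_gate g ++ r) =
  foldl pstep ((0, t'), (0, ([::], g :: gs))) r.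
Proof.
case: t => t1 t2; case: g => [|j|js|js] /=.
- by exists (false, false).
- by exists (false, true); rewrite pstep_unary; last by left.
- by exists (true, false); rewrite pstep_args.
- by exists (true, true); rewrite pstep_args.
Qed.

Lemma parse_circuitK : cancel enc_circuit parse_circuit.
Proof.
move=> C; rewrite /parse_circuit.
have H : forall t gs,
    (foldl pstep ((0, t), (0, ([::], gs))) (enc_circuit C)).2.2.2 = catrev C gs.
  elim: C => [|g C IH] t gs //.
  have -> : enc_circuit (g :: C) = true :: (enc_gate g ++ enc_circuit C).
    by rewrite /enc_circuit /enc_seq /= rcons_cat.
  rewrite [foldl _ _ _]/=.
  by have [t' ->] := pstep_gate t gs g (enc_circuit C); rewrite IH.
by rewrite H catrevE cats0 revK.
Qed.

Section Scan.
Context {T : Type} (step : nat -> seq T -> gate -> T).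

Lemma scan_rcons C g :
  scan step (rcons C g) = rcons (scan step C) (step (size (scan step C)) (scan step C) g).
Proof. by rewrite /scan foldl_rcons. Qed.

Lemma size_scan C : size (scan step C) = size C.
Proof. by elim/last_ind: C => // C g IH; rewrite scan_rcons !size_rcons IH. Qed.

Lemma nth_scan x0 C i : i < size C ->
  nth x0 (scan step C) i = step i (take i (scan step C)) (node C i).
Proof.
elim/last_ind: C => // C g IH; rewrite size_rcons ltnS leq_eqVlt.
rewrite scan_rcons nth_rcons /node nth_rcons -cats1 !size_scan.
case/orP=> [/eqP ->|ltC].
  by rewrite ltnn eqxx take_size_cat ?size_scan.
rewrite ltC IH //; congr step.
by rewrite take_cat size_scan ltC.
Qed.

End Scan.

Lemma bigmax_leq_all (s : seq nat) (F : nat -> nat) m :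
  (\max_(j <- s) F j <= m) = all (fun j => F j <= m) s.
Proof. by elim: s => [|j s IH]; rewrite ?big_nil // big_cons geq_max IH. Qed.

Lemma has_flatten (T : Type) (P : pred T) ss : has P (flatten ss) = has (has P) ss.
Proof. by elim: ss => //= s ss IH; rewrite has_cat IH. Qed.

Lemma wf_circuitP C : reflect (wf_circuit C) (wf_circuitb C).
Proof.
apply: (iffP and4P).
  move=> [h1 /allP h2 /allP h3 /allP h4]; split=> //.
  - by move=> i Hi; apply: h2; rewrite mem_iota.
  - move=> i Hi; have := h3 i; rewrite mem_iota Hi => /(_ isT).
    by rewrite uniqbE /is_andor; case: (node C i).
  - move=> i Hi; have := h4 i; rewrite mem_iota /= => /(_ _) H.
    have /hasP[l] : has (fun l => i \in gate_args (node C l)) (iota 0 (size C)).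
      by apply: H; move: Hi; case: (size C).
    by rewrite mem_iota => Hl il; exists l.
move=> [h1 h2 h3 h4]; split=> //.
- by apply/allP => i; rewrite mem_iota => Hi; apply: h2.
- apply/allP => i; rewrite mem_iota => Hi; have := h3 i Hi.
  by rewrite uniqbE /is_andor; case: (node C i).
apply/allP => i; rewrite mem_iota /= => Hi.
have [l Hl il] : exists2 l, l < size C & i \in gate_args (node C l).
  by apply: h4; move: h1 Hi; case: (size C).
by apply/hasP; exists l; rewrite ?mem_iota.
Qed.

(** * Values, depth and weft of the nodes of a well-formed circuit *)

Section Circuit.
Context (C : circuit) (Cwf : wf_circuit C).

Definition nval (a : nat -> bool) (v : nat) : bool := nth false (scan (gate_value a) C) v.
Definition ndepth (v : nat) : nat := nth 0 (scan gate_depth C) v.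
Definition nweft (v : nat) : nat := nth 0 (scan gate_weft C) v.

Lemma gate_args_lt v j : v < size C -> j \in gate_args (node C v) -> j < v.
Proof. by case: Cwf => _ H _ _ /H /allP; apply. Qed.

Lemma gate_args_size v j : v < size C -> j \in gate_args (node C v) -> j < size C.
Proof. by move=> vC /(gate_args_lt vC) /ltn_trans; apply. Qed.

Lemma nvalE a v : v < size C -> nval a v =
  match node C v with
  | Input => a v
  | Not j => ~~ nval a j
  | And js => all (nval a) js
  | Or js => has (nval a) js
  end.
Proof.
move=> vC; rewrite /nval nth_scan //; have := @gate_args_lt v^~ vC.
case: (node C v) => [|j|js|js] //= H.
- by rewrite nth_take // H // mem_head.
- by apply: eq_in_all => j /H jv; rewrite nth_take.
- by apply: eq_in_has => j /H jv; rewrite nth_take.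
Qed.

Lemma ndepthE v : v < size C ->
  ndepth v = if is_inputb C v then 0
             else (\max_(j <- gate_args (node C v)) ndepth j).+1.
Proof.
move=> vC; rewrite /ndepth nth_scan //; have := @gate_args_lt v^~ vC.
have E s : {in s, forall j, j < v} ->
   \max_(j <- s) nth 0 (take v (scan gate_depth C)) j =
   \max_(j <- s) nth 0 (scan gate_depth C) j.
  by move=> H; apply: eq_big_seq => j /H jv; rewrite nth_take.
by rewrite /is_inputb /is_andor /is_notor; case: (node C v) => [|j|js|js] //= H; rewrite E.
Qed.

Lemma nweftE v : v < size C ->
  nweft v = (2 < size (gate_args (node C v))) + \max_(j <- gate_args (node C v)) nweft j.
Proof.
move=> vC; rewrite /nweft nth_scan // /gate_weft; congr (_ + _).
by apply: eq_big_seq => j /(gate_args_lt vC) jv; rewrite nth_take.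
Qed.

Lemma is_inputE v : is_input C v = is_inputb C v.
Proof. by rewrite /is_input /is_inputb /is_andor /is_notor; case: (node C v). Qed.

Lemma depthfE d v : v < size C -> depthf d C v = (ndepth v <= d).
Proof.
elim: d v => [|d IH] v vC /=; rewrite ndepthE //; case: ifP => //= _.
rewrite ltnS bigmax_leq_all; apply: eq_in_all => j /(gate_args_size vC) jC.
exact: IH.
Qed.

Lemma ndepth_args d v j : v < size C -> ndepth v <= d.+1 ->
  j \in gate_args (node C v) -> ndepth j <= d.
Proof.
move=> vC; rewrite ndepthE //; case: ifP => [|_].
  by rewrite /is_inputb /is_andor /is_notor; case: (node C v).
by rewrite ltnS bigmax_leq_all => /allP H /H.
Qed.

Lemma smallfE d v : v < size C -> ndepth v <= d -> smallf d C v = (nweft v == 0).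
Proof.
elim: d v => [|d IH] v vC dv /=; rewrite nweftE //.
  move: dv; rewrite ndepthE //; case: ifP => // + _.
  by rewrite /is_inputb /is_andor /is_notor; case: (node C v) => //=; rewrite big_nil.
rewrite addn_eq0 eqb0 -leqNgt -leqn0 bigmax_leq_all; congr (_ && _).
apply: eq_in_all => j Hj; rewrite leqn0; apply: IH.
  exact: gate_args_size Hj.
exact: ndepth_args Hj.
Qed.

Lemma weft1fE d v : v < size C -> ndepth v <= d -> weft1f d C v = (nweft v <= 1).
Proof.
elim: d v => [|d IH] v vC dv /=; rewrite nweftE //.
  move: dv; rewrite ndepthE //; case: ifP => // + _.
  by rewrite /is_inputb /is_andor /is_notor; case: (node C v) => //=; rewrite big_nil.
case: leqP => _ /=.
  rewrite add0n bigmax_leq_all; apply: eq_in_all => j Hj; apply: IH.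
    exact: gate_args_size Hj.
  exact: ndepth_args Hj.
rewrite add1n ltnS bigmax_leq_all; apply: eq_in_all => j Hj.
rewrite leqn0; apply: smallfE; first exact: gate_args_size Hj.
exact: ndepth_args Hj.
Qed.

Lemma evalfE d B v : v < size C -> ndepth v <= d ->
  evalf d C B v = nval (mem B) v.
Proof.
elim: d v => [|d IH] v vC dv /=; rewrite nvalE //.
  move: dv; rewrite ndepthE //; case: ifP => // + _.
  by rewrite /is_inputb /is_andor /is_notor; case: (node C v).
have {}IH j : j \in gate_args (node C v) -> evalf d C B j = nval (mem B) j.
  by move=> Hj; apply: IH; [exact: gate_args_size Hj | exact: ndepth_args Hj].
rewrite /is_andor /is_notor; case: (node C v) IH => [|j|js|js] //= IH.
- by rewrite IH // mem_head.
- exact: eq_in_all.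
- exact: eq_in_has.
Qed.

Lemma nval_inputs a a' v : v < size C ->
  (forall x, x < size C -> is_inputb C x -> a x = a' x) -> nval a v = nval a' v.
Proof.
move=> vC H; elim/ltn_ind: v vC => v IH vC; rewrite !nvalE //.
have {}IH j : j \in gate_args (node C v) -> nval a j = nval a' j.
  by move=> Hj; apply: IH; [exact: gate_args_lt Hj | exact: gate_args_size Hj].
have := H v vC; rewrite /is_inputb /is_andor /is_notor.
case: (node C v) IH => [|j|js|js] //= IH Hv.
- exact: Hv.
- by rewrite IH // mem_head.
- exact: eq_in_all.
- exact: eq_in_has.
Qed.

(** Weft 0 leaves at most two arguments to each gate below [v], so the [take 2] in [varsf] cuts off
    nothing and every input that [v] depends on is collected. *)
Lemma nval_varsf d a a' v : v < size C -> ndepth v <= d -> nweft v = 0 ->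
  {in varsf d C v, a =1 a'} -> nval a v = nval a' v.
Proof.
elim: d v => [|d IH] v vC dv wv H.
  rewrite !nvalE //; move: dv; rewrite ndepthE //; case: ifP => // + _.
  have := H v (mem_head _ _).
  by rewrite /is_inputb /is_andor /is_notor; case: (node C v).
move: wv; rewrite nweftE // => /eqP.
rewrite addn_eq0 eqb0 -leqNgt -leqn0 bigmax_leq_all => /andP[sz /allP wv].
have {}IH j : ~~ is_inputb C v -> j \in gate_args (node C v) -> nval a j = nval a' j.
  move=> nv Hj; apply: IH; [exact: gate_args_size Hj | exact: ndepth_args Hj | |].
    by apply/eqP; rewrite -leqn0 wv.
  move=> x Hx; apply: H; rewrite /= (negPf nv).
  by apply/flatten_mapP; exists j; rewrite ?take_oversize.
have := H v; rewrite !nvalE //=.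
move: IH; rewrite /is_inputb /is_andor /is_notor.
case: (node C v) => [|j|js|js] //= IH Hv.
- by apply: Hv; rewrite mem_head.
- by rewrite IH // mem_head.
- by apply: eq_in_all => j; apply: IH.
- by apply: eq_in_has => j; apply: IH.
Qed.

Lemma varsf_inputs d v x : v < size C -> ndepth v <= d -> x \in varsf d C v ->
  (x < size C) && is_inputb C x.
Proof.
elim: d v => [|d IH] v vC dv /=.
  rewrite inE => /eqP ->; rewrite vC; move: dv; rewrite ndepthE //.
  by case: ifP.
case: ifP => iv; first by rewrite inE => /eqP ->; rewrite vC.
case/flatten_mapP => j /mem_take Hj; apply: IH; first exact: gate_args_size Hj.
exact: ndepth_args Hj.
Qed.

Definition good_lit d (l : nat * bool) : bool :=
  [&& l.1 < size C, ndepth l.1 <= d & nweft l.1 == 0].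

(** A literal is emitted at an input or at an argument of a large gate. With weft at most 1, nothing
    at or below such an argument is large. *)
Lemma dnff_good d v b : v < size C -> ndepth v <= d -> nweft v <= 1 ->
  all (all (good_lit d)) (dnff d C v b).
Proof.
elim: d v b => [|d IH] v b vC dv wv.
  by rewrite /= /good_lit /= vC dv !andbT -(smallfE (d := 0)).
have gl_le : forall l, good_lit d l -> good_lit d.+1 l.
  by move=> l /and3P[h1 h2 h3]; rewrite /good_lit h1 h3 andbT (leq_trans h2).
have wk (D : seq (seq (nat * bool))) : all (all (good_lit d)) D -> all (all (good_lit d.+1)) D.
  by apply: sub_all => c; apply: sub_all.
have Hsz j : j \in gate_args (node C v) -> j < size C by exact: gate_args_size.
have Hdep j : j \in gate_args (node C v) -> ndepth j <= d by exact: ndepth_args.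
have small_case : size (gate_args (node C v)) <= 2 ->
    forall j b', j \in gate_args (node C v) -> all (all (good_lit d)) (dnff d C j b').
  move=> sz j b' Hj; apply: IH; [exact: Hsz | exact: Hdep |].
  move: wv; rewrite nweftE // ltnNge sz add0n bigmax_leq_all => /allP; exact.
have large_case : ~~ (size (gate_args (node C v)) <= 2) ->
    forall j b', j \in gate_args (node C v) -> good_lit d (j, b').
  move=> sz j b' Hj; rewrite /good_lit /= Hsz // Hdep //=.
  move: wv; rewrite nweftE // ltnNge sz add1n ltnS bigmax_leq_all => /allP.
  by move/(_ _ Hj); rewrite leqn0.
have input_case : is_inputb C v -> all (all (good_lit d.+1)) [:: [:: (v, b)]].
  move=> iv; rewrite /= /good_lit /= vC dv /= nweftE //.
  by move: iv; rewrite /is_inputb /is_andor /is_notor; case: (node C v) => //=; rewrite big_nil.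
set js := gate_args (node C v) in Hsz Hdep small_case large_case.
have c1 : size js <= 2 -> all (all (good_lit d.+1)) (flatten [seq dnff d C j b | j <- js]).
  move=> sz; apply: wk; apply/allP => c /flatten_mapP[j Hj]; apply/allP.
  exact: small_case.
have c2 : ~~ (size js <= 2) -> all (all (good_lit d.+1)) [seq [:: (j, b)] | j <- js].
  move=> sz; apply: wk; apply/allP => c /mapP[j Hj ->] /=.
  by rewrite large_case.
have c3 : 1 < size js -> size js <= 2 -> all (all (good_lit d.+1))
    (flatten [seq [seq c ++ c' | c' <- dnff d C (nth 0 js 1) b] | c <- dnff d C (nth 0 js 0) b]).
  move=> sz1 sz; apply: wk; apply/allP => c /flatten_mapP[c1' H1 /mapP[c2' H2 ->]].
  have h0 := allP (small_case sz _ b (mem_nth 0 (ltnW sz1))) _ H1.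
  have h1 := allP (small_case sz _ b (mem_nth 0 sz1)) _ H2.
  by rewrite all_cat h0 h1.
have c4 : ~~ (size js <= 2) -> all (all (good_lit d.+1)) [:: [seq (j, b) | j <- js]].
  move=> sz; apply: wk; rewrite /= andbT; apply/allP => l /mapP[j Hj ->].
  exact: large_case.
case: (Cwf) => _ _ /(_ v vC) sz2 _.
move: c1 c2 c3 c4 small_case input_case => /=; rewrite /js.
rewrite /is_inputb /is_andor /is_notor.
case E: (node C v) sz2 => [|j|ks|ks] //= sz2 c1 c2 c3 c4 sc ic.
- exact: ic.
- by apply: wk; apply: sc => //; rewrite mem_head.
- by case/andP: sz2 => _ sz2; do 2!case: ifP => [|/negbT] ?; auto.
- by case/andP: sz2 => _ sz2; do 2!case: ifP => [|/negbT] ?; auto.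
Qed.

(** The polarity [b] carries negations downwards: by De Morgan, a gate required to have value [b]
    acts as a disjunction exactly when [is_notor] equals [b]. Only binary gates are multiplied out;
    the arguments of a large gate become literals. *)
Lemma dnffE d a v b : v < size C -> ndepth v <= d ->
  (nval a v == b) = has (all (fun l => nval a l.1 == l.2)) (dnff d C v b).
Proof.
elim: d v b => [|d IH] v b vC dv; first by rewrite /= orbF andbT.
have {}IH j b' : j \in gate_args (node C v) ->
    (nval a j == b') = has (all (fun l => nval a l.1 == l.2)) (dnff d C j b').
  by move=> Hj; apply: IH; [exact: gate_args_size Hj | exact: ndepth_args Hj].
set js := gate_args (node C v) in IH.
have c1 : has (all (fun l => nval a l.1 == l.2)) (flatten [seq dnff d C j b | j <- js]) =
    has (fun j => nval a j == b) js.
  rewrite has_flatten has_map; apply: eq_in_has => j Hj /=; exact/esym/IH.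
have c2 : has (all (fun l => nval a l.1 == l.2)) [seq [:: (j, b)] | j <- js] =
    has (fun j => nval a j == b) js.
  by rewrite has_map; apply: eq_has => j /=; rewrite andbT.
(* Distributivity. Where this is used, well-formedness gives at least two arguments and the size
   test at most two. *)
have c3 : size js = 2 -> has (all (fun l => nval a l.1 == l.2))
    (flatten [seq [seq c ++ c' | c' <- dnff d C (nth 0 js 1) b] | c <- dnff d C (nth 0 js 0) b])
    = all (fun j => nval a j == b) js.
  move=> sz; have -> : all (fun j => nval a j == b) js =
     (nval a (nth 0 js 0) == b) && (nval a (nth 0 js 1) == b).
    by move: sz; case: (js) => [|j0 [|j1 []]] //= _; rewrite andbT.
  rewrite !IH ?mem_nth ?sz // has_flatten has_map.
  elim: (dnff d C (nth 0 js 0) b) => //= c D ->; rewrite has_map.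
  rewrite andb_orl; congr (_ || _).
  elim: (dnff d C (nth 0 js 1) b) => /= [|c' D' ->]; first by rewrite andbF.
  by rewrite all_cat andb_orr.
case: (Cwf) => _ _ /(_ v vC) sz2 _.
rewrite nvalE //; move: c1 c2 c3 IH => /=; rewrite /js.
rewrite /is_andor /is_notor.
case E: (node C v) sz2 => [|j|ks|ks] //= sz2 c1 c2 c3 IH.
- by rewrite nvalE // E orbF andbT.
- by rewrite -IH ?mem_head //; case: (nval a j) (b) => -[].
- case/andP: sz2 => _ sz2; case: (b) c1 c2 c3 => /= c1 c2 c3.
    case: ifP => sz.
      rewrite c3; last by apply/eqP; rewrite eqn_leq sz.
      by rewrite eqb_id; apply: eq_all => j; rewrite eqb_id.
    by rewrite eqb_id /= orbF all_map; apply: eq_all => j /=; rewrite eqb_id.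
  rewrite eqbF_neg -has_predC; case: ifP => _; rewrite ?c1 ?c2;
    by apply: eq_has => j /=; rewrite eqbF_neg.
- case/andP: sz2 => _ sz2; case: (b) c1 c2 c3 => /= c1 c2 c3.
    rewrite eqb_id; case: ifP => _; rewrite ?c1 ?c2;
    by apply: eq_has => j /=; rewrite eqb_id.
  rewrite eqbF_neg -all_predC; case: ifP => sz.
    rewrite c3; last by apply/eqP; rewrite eqn_leq sz.
    by apply: eq_all => j /=; rewrite eqbF_neg.
  by rewrite /= orbF all_map; apply: eq_all => j /=; rewrite eqbF_neg.
Qed.

End Circuit.

(** * Satisfying assignments and cliques *)

Definition has_clique (n : nat) (E : seq (nat * nat)) (K : nat) : Prop :=
  exists s, [/\ uniq s, size s = K, all (fun u => u < n) s &
                {in s &, forall u v, (u, v) \in E}].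

Lemma mem_tuples (T : eqType) q (l t : seq T) :
  (t \in tuples q l) = (size t == q) && all (fun x => x \in l) t.
Proof.
elim: q t => [|q IH] t /=; first by rewrite inE; case: t.
apply/flatten_mapP/idP => [[x xl /mapP[u]]|].
  by rewrite IH => /andP[/eqP <- ul] -> /=; rewrite eqxx ul andbT.
case: t => // x t /andP[sz /andP[/= xl tl]]; exists x => //.
by apply/mapP; exists t => //; rewrite IH; move: sz; rewrite /= eqSS => ->.
Qed.

Lemma size_tuples (T : Type) q (l : seq T) : size (tuples q l) = size l ^ q.
Proof.
elim: q => [|q IH] //=; rewrite size_flatten /shape -map_comp expnS.
have: forall s, sumn [seq (size \o (fun x => [seq x :: t | t <- tuples q l])) i | i <- s] =
  size s * size l ^ q; last exact.
by elim=> //= x s ->; rewrite size_map IH mulSn.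
Qed.

Lemma uniq_tuples (T : eqType) q (l : seq T) : uniq l -> uniq (tuples q l).
Proof.
move=> ul; elim: q => [|q IH] //=.
have: forall s, uniq s -> uniq (flatten [seq [seq x :: t | t <- tuples q l] | x <- s]);
  last exact.
elim=> //= x s IHs /andP[xs us]; rewrite cat_uniq IHs // andbT map_inj_uniq ?IH //=; last by move=> ? ? [].
apply/hasPn => t /flatten_mapP[y ys /mapP[u _ ->]]; apply/mapP => -[w _ [yx _]].
by rewrite -yx ys in xs.
Qed.

Lemma mem_graph_edges V u v :
  ((u, v) \in graph_edges V) =
  [&& u < size V, v < size V & (u == v) || adj (nth vertex0 V u) (nth vertex0 V v)].
Proof.
apply/flatten_mapP/and3P => [[i]|[uV vV uv]].
  rewrite mem_iota => /= iV /mapP[j]; rewrite mem_filter mem_iota => /andP[ij /= jV].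
  by case=> -> ->.
exists u; rewrite ?mem_iota //; apply/mapP; exists v => //.
by rewrite mem_filter mem_iota uv.
Qed.

Lemma uniq_graph_edges V : uniq (graph_edges V).
Proof.
rewrite /graph_edges; have: forall s, uniq s -> uniq (flatten
   [seq [seq (i, j) | j <- iota 0 (size V)
           & (i == j) || adj (nth vertex0 V i) (nth vertex0 V j)] | i <- s]);
  last by apply; apply: iota_uniq.
elim=> //= i s IH /andP[si us]; rewrite cat_uniq IH // andbT.
rewrite map_inj_uniq ?filter_uniq ?iota_uniq //=; last by move=> ? ? [].
apply/hasPn => p /flatten_mapP[j js /mapP[x _ ->]]; apply/mapP => -[y _ [ji _]].
by rewrite -ji js in si.
Qed.

Lemma mem_vertsP d C k w J b :
  reflect (exists N, [/\ w < size (out_dnf d C), N \in tuples (2 ^ d) (choices C k),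
                         J = [seq p.1 | p <- N] &
                         b \in leaves d C k (nth [::] (out_dnf d C) w) N])
    ((w, (J, b)) \in verts d C k).
Proof.
apply: (iffP flatten_mapP) => [[w']|[N [wD NT -> bL]]].
  rewrite mem_iota => /= wD /flatten_mapP[N NT /mapP[b' bL [-> -> ->]]].
  by exists N.
exists w; rewrite ?mem_iota //; apply/flatten_mapP; exists N => //.
by apply/mapP; exists b.
Qed.

Lemma consistentP b b' :
  reflect (forall p p', p \in b -> p' \in b' -> (p.1 == p'.1) = (p.2 == p'.2))
    (consistent b b').
Proof.
apply: (iffP allP) => [H p p' /H /allP {}H /H /eqP //|H p pb].
by apply/allP => p' pb'; apply/eqP/H.
Qed.

Section Clique.
Context (d : nat) (C : circuit) (k : nat).
Context (Cwf : wf_circuit C) (Cdepth : depth C <= d) (Cweft : weft C <= 1).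

Let n := size C.
Let q := 2 ^ d.
Let V := verts d C k.

Lemma size_gt0 : 0 < n. Proof. by case: Cwf. Qed.

Lemma out_lt : n.-1 < n. Proof. by have := size_gt0; case: (n). Qed.

Lemma circuit_valueE a : circuit_value C a = nval C a n.-1.
Proof. by rewrite /circuit_value /nval /n -(size_scan (gate_value a)) nth_last. Qed.

Lemma depth_out : ndepth C n.-1 <= d.
Proof.
by move: Cdepth; rewrite /depth /ndepth /n -(size_scan gate_depth) nth_last.
Qed.

Lemma weft_out : nweft C n.-1 <= 1.
Proof.
by move: Cweft; rewrite /weft /nweft /n -(size_scan gate_weft) nth_last.
Qed.

Lemma good_conj w : w < size (out_dnf d C) ->
  all (good_lit C d) (nth [::] (out_dnf d C) w).
Proof.
move=> wD; apply: (allP (dnff_good Cwf true out_lt depth_out weft_out)).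
exact: mem_nth.
Qed.

Lemma phiE B c : all (good_lit C d) c ->
  phi d C B c = all (fun l => nval C (mem B) l.1 == l.2) c.
Proof.
move=> /allP gc; apply: eq_in_all => l /gc /and3P[lC ld _].
by rewrite evalfE.
Qed.

Lemma weightE a : weight C a = size [seq x <- inputs C | a x].
Proof.
rewrite /weight /inputs -filter_predI size_filter.
by apply: eq_count => x /=; rewrite is_inputE andbC.
Qed.

Lemma mem_inputs x : (x \in inputs C) = (x < n) && is_inputb C x.
Proof. by rewrite mem_filter mem_iota andbC. Qed.

Lemma mem_choices p : (p \in choices C k) =
  (p == (0, n)) || ((0 < p.1 <= k) && (p.2 \in inputs C)).
Proof.
rewrite inE; congr (_ || _); apply/flatten_mapP/andP => [[j]|[pk pi]].
  by rewrite mem_iota => jk /mapP[x xi ->] /=; move: jk; rewrite add1n ltnS.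
exists p.1; first by rewrite mem_iota add1n ltnS.
by apply/mapP; exists p.2 => //; case: (p).
Qed.

Lemma iter_grow_sub m c N b :
  b \in iter m (fun s => flatten [seq grow d C k c b0 | b0 <- s]) [:: N] ->
  {subset N <= b} /\ (all (fun p => p.1 <= k) N -> all (fun p => p.1 <= k) b).
Proof.
elim: m b => [|m IH] b /=; first by rewrite inE => /eqP ->; split.
case/flatten_mapP => b0 /IH [sub le]; rewrite /grow; case: ifP => _.
  by rewrite inE => /eqP ->; split.
case/flatten_mapP => i; rewrite mem_iota add1n ltnS => /andP[_ ik] /mapP[x _ ->].
split; first by move=> p /sub pb; rewrite inE pb orbT.
by move/le => /= ->; rewrite ik.
Qed.

(** * From a satisfying set of inputs to a clique *)

Section Complete.
Context (A : seq nat) (w : nat).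
Context (Auniq : uniq A) (Asize : size A = k) (Asub : {subset A <= inputs C}).
Let c := nth [::] (out_dnf d C) w.
Context (wD : w < size (out_dnf d C)) (Asat : phi d C A c).

(** Index 0 goes to the padding value [n]; the indices from 1 to [k] enumerate [A]. The branches
    that follow [A] are those inside the graph of this injection. *)
Let alpha i := nth n (n :: A) i.

Definition in_graph (p : nat * nat) : bool := (p.1 <= k) && (p.2 == alpha p.1).

Lemma n_notin_A : n \notin A.
Proof. by apply/negP => /Asub; rewrite mem_inputs ltnn. Qed.

Lemma alpha_inj i j : i <= k -> j <= k -> (alpha i == alpha j) = (i == j).
Proof. by move=> ik jk; apply: nth_uniq; rewrite /= ?Asize ?n_notin_A. Qed.

Lemma in_graph_vals b x : all in_graph b -> x \in vals b -> x \in n :: A.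
Proof.
move=> /allP H /mapP[p /H /andP[pk /eqP px] ->]; rewrite px.
by apply: mem_nth; rewrite /= Asize.
Qed.

(** The extra value [n] is not a node, hence invisible to the circuit. *)
Lemma phi_vals b : vals b =i n :: A -> phi d C (vals b) c.
Proof.
move=> bA; have := Asat; rewrite !phiE ?good_conj //.
move=> /allP H; apply/allP => l lc; rewrite -(eqP (H l lc)); apply/eqP.
have /and3P[lC _ _] := allP (good_conj wD) l lc.
apply: nval_inputs => // x xC _; rewrite /= bA inE.
by case: eqP => // xn; rewrite xn ltnn in xC.
Qed.

(* The failing literal holds on [A] but not on the values of [b], so some input
   of it lies in [A] only; the branch adding that input stays inside [A]. *)
Lemma grow_in_graph b : all in_graph b -> ~~ phi d C (vals b) c ->
  exists2 b', b' \in grow d C k c b &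
    all in_graph b' /\ exists2 x, x \notin vals b & vals b' = x :: vals b.
Proof.
move=> bg nphi; rewrite /grow (negPf nphi) /failing_vars.
set F := [seq l <- c | _]; have : has predT F.
  by rewrite has_predT size_filter -has_count has_predC.
case E: F => [|l F'] // _ /=; set u := l.1.
have : l \in F by rewrite E mem_head.
rewrite mem_filter => /andP[nl lc].
have /and3P[lC ld /eqP lw] := allP (good_conj wD) l lc.
have [x xu] : exists2 x, x \in varsf d C u & (x \in vals b) != (x \in A).
  apply/hasP; apply/contraT; rewrite -all_predC => /allP H; case/negP: nl.
  rewrite -(eqP (allP Asat l lc)) !evalfE //; apply/eqP.
  by apply: (@nval_varsf _ Cwf d) => // y yu; have := H y yu; rewrite /= negbK => /eqP.
have /andP[xC xi] := varsf_inputs Cwf lC ld xu.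
have xb_A : x \in vals b -> x \in A.
  move=> /(in_graph_vals bg); rewrite inE => /orP[/eqP xn|//].
  by rewrite xn ltnn in xC.
move=> xneq; have xb : x \notin vals b.
  by apply: contraNN xneq => xb; rewrite xb xb_A.
have xA : x \in A by move: xneq; rewrite (negPf xb); case: (x \in A).
have iA := xA; rewrite -index_mem Asize in iA.
exists (((index x A).+1, x) :: b).
  apply/flatten_mapP; exists (index x A).+1; first by rewrite mem_iota add1n !ltnS.
  by apply/mapP; exists x.
split; last by exists x.
by rewrite /= bg andbT /in_graph /= iA /alpha /= nth_index.
Qed.

(** After [m] rounds, some branch inside the graph of [alpha] satisfies the conjunction or has at
    least [m] distinct values. For [m = k + 1] the values exhaust [n :: A], on which the conjunction
    holds by assumption. *)
Lemma leaf_exists N : all in_graph N ->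
  exists2 b, b \in leaves d C k c N & all in_graph b.
Proof.
move=> Ng.
have H m : exists2 b, b \in iter m (fun s => flatten [seq grow d C k c b0 | b0 <- s]) [:: N] &
    all in_graph b /\ (phi d C (vals b) c \/ m <= size (undup (vals b))).
  elim: m => [|m [b bm [bg bphi]]] /=.
    by exists N; rewrite ?inE //; split=> //; right.
  case: (boolP (phi d C (vals b) c)) => pb.
    exists b; last by split=> //; left.
    by apply/flatten_mapP; exists b => //; rewrite /grow pb inE.
  have [b' b'g [b'gr [x xb b'x]]] := grow_in_graph bg pb.
  exists b'; first by apply/flatten_mapP; exists b.
  split=> //; right; rewrite b'x /= (negPf xb) /= ltnS.
  by case: bphi => //; rewrite (negPf pb).
have [b bk [bg bphi]] := H k.+1; exists b => //.
rewrite mem_filter bk andbT; apply/andP; split.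
  case: bphi => // sz; apply: phi_vals => x; rewrite -mem_undup.
  have sub : {subset undup (vals b) <= n :: A}.
    by move=> y; rewrite mem_undup; apply: in_graph_vals.
  have sz' : size (n :: A) <= size (undup (vals b)) by rewrite /= Asize.
  by have [_ ->] := uniq_min_size (undup_uniq _) sub sz'.
apply/consistentP => p p' /(allP bg) /andP[pk /eqP ->] /(allP bg) /andP[pk' /eqP ->].
by rewrite alpha_inj.
Qed.

(** For each tuple [J] of indices take for [N] the restriction of [alpha] to [J] and a leaf below it
    inside the graph of [alpha]. The chosen vertices are compatible because all their branches lie
    in the graph of one injection. *)
Lemma clique_of_assignment : has_clique (size V) (graph_edges V) (nclasses d k).
Proof.
pose sel J (u : vertex) := [&& u.1 == w, u.2.1 == J & all in_graph u.2.2].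
have selV J : J \in tuples q (iota 0 k.+1) -> has (sel J) V.
  rewrite mem_tuples => /andP[/eqP szJ /allP JK].
  have {}JK j : j \in J -> j <= k by move=> /JK; rewrite mem_iota ltnS.
  pose N := [seq (j, alpha j) | j <- J].
  have Ng : all in_graph N.
    by apply/allP => p /mapP[j /JK jk ->]; rewrite /in_graph /= eqxx andbT.
  have [b bL bg] := leaf_exists Ng.
  apply/hasP; exists (w, (J, b)); last by rewrite /sel /= !eqxx.
  apply/mem_vertsP; exists N; split=> //.
    rewrite mem_tuples size_map szJ eqxx /=; apply/allP => p /mapP[j /JK jk ->].
    rewrite mem_choices /=.
    case: j jk => [|j] jk /=; first by rewrite eqxx.
    by rewrite jk Asub //; apply: mem_nth; rewrite Asize.
  by rewrite /N -map_comp map_id_in.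
pose idx J := find (sel J) V.
have idxP J : J \in tuples q (iota 0 k.+1) ->
    idx J < size V /\ sel J (nth vertex0 V (idx J)).
  by move=> /selV H; rewrite -has_find; split=> //; apply: nth_find.
exists [seq idx J | J <- tuples q (iota 0 k.+1)]; split.
- rewrite map_inj_in_uniq ?uniq_tuples ?iota_uniq // => J J' /idxP[_ s1] /idxP[_ s2] E.
  by move: s1 s2; rewrite E => /and3P[_ /eqP e1 _] /and3P[_ /eqP e2 _]; rewrite -e1 e2.
- by rewrite size_map size_tuples size_iota.
- by apply/allP => u /mapP[J /idxP[H _] ->].
move=> u v /mapP[J /idxP[HJ sJ] ->] /mapP[J' /idxP[HJ' sJ'] ->].
rewrite mem_graph_edges HJ HJ' /=; case: (boolP (J == J')) => [/eqP ->|JJ'].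
  by rewrite eqxx.
apply/orP; right; rewrite /adj.
case/and3P: sJ => /eqP -> /eqP -> bg; case/and3P: sJ' => /eqP -> /eqP -> bg'.
rewrite eqxx JJ' /=; apply/consistentP => p p'.
move=> /(allP bg) /andP[pk /eqP ->] /(allP bg') /andP[pk' /eqP ->].
by rewrite alpha_inj.
Qed.

End Complete.

(** * From a clique to a satisfying set of inputs *)

Section Sound.
Context (s : seq nat) (suniq : uniq s) (ssize : size s = nclasses d k).
Context (sV : all (fun u => u < size V) s).
Context (sE : {in s &, forall u v, (u, v) \in graph_edges V}).

Let vx u := nth vertex0 V u.
Let G := flatten [seq (vx u).2.2 | u <- s].

Lemma clique_vertex u : u \in s -> exists N,
  [/\ (vx u).1 < size (out_dnf d C), N \in tuples q (choices C k),
      (vx u).2.1 = [seq p.1 | p <- N] &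
      (vx u).2.2 \in leaves d C k (nth [::] (out_dnf d C) (vx u).1) N].
Proof.
move=> us; have := mem_nth vertex0 (allP sV u us).
rewrite -/(vx u); case: (vx u) => w [J b] /mem_vertsP[N [? ? ? ?]].
by exists N.
Qed.

Lemma clique_adj u v : u \in s -> v \in s -> u != v -> adj (vx u) (vx v).
Proof.
by move=> us vs /negPf uv; have := sE us vs; rewrite mem_graph_edges uv => /and3P[].
Qed.

(** Vertices of the clique have distinct classes and are as many as the classes, so by counting no
    class is missed. *)
Lemma clique_class J : J \in tuples q (iota 0 k.+1) ->
  exists2 u, u \in s & (vx u).2.1 = J.
Proof.
move=> JT; have mu : uniq [seq (vx u).2.1 | u <- s].
  rewrite map_inj_in_uniq // => u v us vs E; apply/eqP/negPn/negP => uv.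
  by case/and3P: (clique_adj us vs uv) => _; rewrite E eqxx.
have sub : {subset [seq (vx u).2.1 | u <- s] <= tuples q (iota 0 k.+1)}.
  move=> J' /mapP[u us ->]; have [N [_ + -> _]] := clique_vertex us.
  rewrite !mem_tuples size_map => /andP[-> /allP NC] /=.
  apply/allP => j /mapP[p /NC + ->]; rewrite mem_choices.
  case/orP=> [/eqP -> //|/andP[/andP[_ pk] _]].
  by have : p.1 \in iota 0 k.+1 by rewrite mem_iota.
have sz : size (tuples q (iota 0 k.+1)) <= size [seq (vx u).2.1 | u <- s].
  by rewrite size_map ssize size_tuples size_iota.
have [_ E] := uniq_min_size mu sub sz.
by move: JT; rewrite -E => /mapP[u us ->]; exists u.
Qed.

Lemma clique_consistent p p' : p \in G -> p' \in G -> (p.1 == p'.1) = (p.2 == p'.2).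
Proof.
move=> /flatten_mapP[u us pu] /flatten_mapP[v vs pv].
suff /consistentP : consistent (vx u).2.2 (vx v).2.2 by apply.
case: (eqVneq u v) => [<-|uv]; last by case/and3P: (clique_adj us vs uv).
by have [N [_ _ _]] := clique_vertex us; rewrite mem_filter => /andP[/andP[]].
Qed.

Lemma clique_le p : p \in G -> p.1 <= k.
Proof.
move=> /flatten_mapP[u us]; have [N [_ NT _ bL]] := clique_vertex us.
move: bL; rewrite mem_filter => /andP[_ /iter_grow_sub[_ le]].
apply: (allP (a := fun p => p.1 <= k)); apply: le.
apply/allP => p' p'N; move: NT; rewrite mem_tuples => /andP[_ /allP/(_ _ p'N)].
by rewrite mem_choices => /orP[/eqP -> //|/andP[/andP[]]].
Qed.

(** The class of the constant tuple [nseq q i] has a vertex whose [N] starts with a pair of index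
    [i]; the tuple is nonempty as [q > 0]. *)
Lemma clique_index i : i <= k -> exists x,
  [/\ (i, x) \in G, i = 0 -> x = n & 0 < i -> x \in inputs C].
Proof.
move=> ik; have JT : nseq q i \in tuples q (iota 0 k.+1).
  rewrite mem_tuples size_nseq eqxx; apply/allP => j /nseqP[-> _].
  by rewrite mem_iota.
have [u us Ju] := clique_class JT; have [N [_ NT JN bL]] := clique_vertex us.
have q0 : 0 < q by rewrite expn_gt0.
case: N JN NT bL => [|p N] JN NT bL.
  by move: JN; rewrite Ju; case: (q) q0.
have pi : p.1 = i by move: JN; rewrite Ju; case: (q) q0 => // q' _ [].
have pC : p \in choices C k.
  by move: NT; rewrite mem_tuples => /andP[_ /allP/(_ p)]; apply; rewrite mem_head.
exists p.2; split.
- rewrite -pi -surjective_pairing; apply/flatten_mapP; exists u => //.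
  move: bL; rewrite mem_filter => /andP[_ /iter_grow_sub[sub _]].
  by apply: sub; rewrite mem_head.
- move=> i0; move: pC; rewrite mem_choices pi i0 /= orbF => /eqP.
  by rewrite [p]surjective_pairing => -[].
- move=> i0; move: pC; rewrite mem_choices pi i0 /= => /orP[/eqP E|/andP[]//].
  by rewrite E /= in pi; rewrite -pi in i0.
Qed.

(** The numbering read off from the clique. By [clique_consistent] it does not depend on the pair
    picked from [G], and it is injective, so that [A] has exactly [k] elements. *)
Let alpha i := (head (0, 0) [seq p <- G | p.1 == i]).2.
Let A := [seq alpha i | i <- iota 1 k].

Lemma alpha_mem i : i <= k -> (i, alpha i) \in G.
Proof.
move=> /clique_index[x [xG _ _]]; rewrite /alpha.
case E: [seq p <- G | p.1 == i] => [|p F].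
  have : (i, x) \in [seq p <- G | p.1 == i] by rewrite mem_filter eqxx.
  by rewrite E.
have : p \in [seq p <- G | p.1 == i] by rewrite E mem_head.
by rewrite mem_filter => /andP[/eqP <- pG] /=; rewrite -surjective_pairing.
Qed.

Lemma alphaE p : p \in G -> p.2 = alpha p.1.
Proof.
move=> pG; have := clique_consistent pG (alpha_mem (clique_le pG)).
by rewrite eqxx => /esym/eqP.
Qed.

Lemma alpha0 : alpha 0 = n.
Proof. by have [x [xG /(_ erefl) <- _]] := clique_index (leq0n k); rewrite -(alphaE xG). Qed.

Lemma alpha_inputs i : 0 < i <= k -> alpha i \in inputs C.
Proof.
by case/andP=> i0 ik; have [x [xG _ /(_ i0)]] := clique_index ik; rewrite -(alphaE xG).
Qed.

Lemma alpha_eq i j : i <= k -> j <= k -> alpha i = alpha j -> i = j.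
Proof.
move=> ik jk E; apply/eqP.
by rewrite (clique_consistent (alpha_mem ik) (alpha_mem jk)) /= E.
Qed.

Lemma A_uniq : uniq A.
Proof.
rewrite map_inj_in_uniq ?iota_uniq // => i j.
by rewrite !mem_iota add1n !ltnS => /andP[_ ik] /andP[_ jk]; apply: alpha_eq.
Qed.

Lemma A_inputs x : x \in A -> x \in inputs C.
Proof.
by case/mapP=> i; rewrite mem_iota add1n ltnS => ik ->; apply: alpha_inputs.
Qed.

(** An unselected input is named by 0, the index of the padding value. *)
Let rank x := if x \in A then (index x A).+1 else 0.

Lemma rank_le x : rank x <= k.
Proof.
by rewrite /rank; case: ifP => //; rewrite -index_mem size_map size_iota.
Qed.

Lemma alpha_rank x : x \in A -> alpha (rank x) = x.
Proof.
move=> xA; rewrite /rank xA; have := nth_index n xA.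
rewrite /A (nth_map 0); last by move: xA; rewrite -index_mem !size_map size_iota.
rewrite nth_iota ?add1n //; last by move: xA; rewrite -index_mem !size_map size_iota.
Qed.

(* The class indexed by the selected inputs of a literal contains a vertex whose
   value set agrees with [A] on that literal. *)
Lemma clique_phi w : (forall u, u \in s -> (vx u).1 = w) ->
  w < size (out_dnf d C) -> phi d C A (nth [::] (out_dnf d C) w).
Proof.
move=> sw wD; apply/allP => l lc.
have /and3P[lC ld /eqP lw] := allP (good_conj wD) l lc.
pose vs := varsf d C l.1.
(* A literal may have fewer than [q] inputs; the remaining positions read the default [n], which
   lies outside [A] and has rank 0. *)
pose J := [seq rank (nth n vs r) | r <- iota 0 q].
have JT : J \in tuples q (iota 0 k.+1).
  rewrite mem_tuples size_map size_iota eqxx; apply/allP => j /mapP[r _ ->].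
  by rewrite mem_iota ltnS rank_le.
have [u us Ju] := clique_class JT; have [N [_ NT JN]] := clique_vertex us.
rewrite mem_filter => /andP[/andP[bphi _] /iter_grow_sub[sub _]].
have inG p : p \in (vx u).2.2 -> p \in G.
  by move=> pu; apply/flatten_mapP; exists u.
(* A value of the leaf has an index in [G]: index 0 means [n], which is no node, and any other index
   puts the value in [A]. Conversely an input of the literal in [A] has its rank in [J], so it
   already occurs in [N]. *)
have agree : {in vs, mem (vals (vx u).2.2) =1 mem A}.
  move=> x xv; have /andP[xC _] := varsf_inputs Cwf lC ld xv.
  apply/idP/idP => /= [/mapP[p pu xp]|xA].
    have pG := inG p pu; have pk := clique_le pG; have := alphaE pG.
    rewrite -xp => xa; case: (posnP p.1) => p0.
      by move: xC; rewrite xa p0 alpha0 ltnn.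
    by rewrite xa; apply: map_f; rewrite mem_iota add1n ltnS p0.
  have : rank x \in J.
    apply/mapP; exists (index x vs); last by rewrite nth_index.
    rewrite mem_iota /= add0n; apply: leq_trans (size_varsf d C l.1).
    by rewrite index_mem.
  rewrite -Ju JN => /mapP[p pN rp]; apply/mapP; exists p; first exact: sub.
  by rewrite (alphaE (inG _ (sub _ pN))) -rp alpha_rank.
have := allP bphi l; rewrite (sw u us) => /(_ lc) /eqP <-; rewrite !evalfE //; apply/eqP/esym.
by apply: (@nval_varsf _ Cwf d) => // x xv; rewrite agree.
Qed.

Lemma assignment_of_clique : exists a, weight C a = k /\ circuit_value C a.
Proof.
(* Any class would do: its vertex provides the conjunction shared by the whole clique. *)
have [u0 us0 _] : exists2 u, u \in s & (vx u).2.1 = nseq q 0.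
  apply: clique_class; rewrite mem_tuples size_nseq eqxx.
  by apply/allP => j /nseqP[-> _].
have [N [wD _ _ _]] := clique_vertex us0.
have sw u : u \in s -> (vx u).1 = (vx u0).1.
  move=> us; case: (eqVneq u u0) => [-> //|uu].
  by case/and3P: (clique_adj us us0 uu) => /eqP.
exists (mem A); split.
  rewrite weightE; transitivity (size A); last by rewrite size_map size_iota.
  apply: perm_size.
  apply: uniq_perm; rewrite ?filter_uniq ?iota_uniq ?A_uniq // => x.
  by rewrite mem_filter; apply/andP/idP => [[]//|xA]; split=> //; exact: A_inputs.
rewrite circuit_valueE -[nval _ _ _]eqb_id (dnffE Cwf _ _ out_lt depth_out).
apply/hasP; exists (nth [::] (out_dnf d C) (vx u0).1); first exact: mem_nth.
by rewrite -phiE ?good_conj // clique_phi.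
Qed.

End Sound.

Lemma clique_iff :
  (exists a, weight C a = k /\ circuit_value C a) <->
  has_clique (size V) (graph_edges V) (nclasses d k).
Proof.
split=> [[a [wa va]]|[s [su ss sV sE]]]; last exact: assignment_of_clique sE.
pose A := [seq x <- inputs C | a x].
have : nval C a n.-1 == true by rewrite -circuit_valueE va.
rewrite (dnffE Cwf _ _ out_lt depth_out) => /hasP[c cD ac].
have wD : index c (out_dnf d C) < size (out_dnf d C) by rewrite index_mem.
have := good_conj wD; rewrite nth_index // => gc.
apply: (@clique_of_assignment A _ _ _ _ wD).
- by rewrite !filter_uniq // iota_uniq.
- by rewrite -weightE.
- by move=> x; rewrite mem_filter => /andP[].
rewrite nth_index // phiE //; move: ac => /allP ac; apply/allP => l lc.
rewrite -(eqP (ac l lc)); apply/eqP; have /and3P[lC _ _] := allP gc l lc.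
apply: nval_inputs => // x xC xi.
by rewrite -[LHS]/(x \in A) mem_filter mem_inputs xC xi !andbT.
Qed.

End Clique.

Lemma WCS_clique d x k :
  WCS 1 d x k <-> valid d x /\
    has_clique (size (verts d (parse_circuit x) k))
      (graph_edges (verts d (parse_circuit x) k)) (nclasses d k).
Proof.
have out C : wf_circuit C -> (size C).-1 < size C by case; case: (size C).
have de C : depth C = ndepth C (size C).-1.
  by rewrite /depth /ndepth -(size_scan gate_depth) nth_last.
have we C : weft C = nweft C (size C).-1.
  by rewrite /weft /nweft -(size_scan gate_weft) nth_last.
split=> [[C [-> Cwf wC dC sat]]|[/and4P[/eqP xC /wf_circuitP Cwf dC wC] cl]].
  split; last by rewrite parse_circuitK; apply/clique_iff.
  have oC := out C Cwf; apply/and4P; rewrite parse_circuitK; split=> //.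
  - exact/wf_circuitP.
  - by rewrite depthfE // -de.
  - by rewrite weft1fE // -?de -?we.
have oC := out _ Cwf; move: dC wC; rewrite depthfE // => dC.
rewrite weft1fE // -we => wC; rewrite -de in dC.
exists (parse_circuit x); split=> //.
exact/(clique_iff k Cwf dC wC).
Qed.

(** * Cliques and schedules *)

Section Interval.
Local Open Scope ring_scope.

(** Remove a selected job that completes last. The others complete before it starts, so the
    induction applies with the horizon shortened by its processing time. *)
Lemma schedule_total (I : sched_instance) (S : {set job I}) (start : job I -> rat) (c : rat) :
  (forall j : job I, (0 < ptime j)%N) ->
  (forall j, j \in S -> 0 <= start j) ->
  (forall i j, i \in S -> j \in S -> i != j ->
     completion start i <= start j \/ completion start j <= start i) ->
  0 <= c -> (forall j, j \in S -> completion start j <= c) ->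
  (\sum_(j in S) ptime j)%:R <= c.
Proof.
move=> pos; move En: #|S| => N; elim: N S c En => [|N IH] S c En h0 hd c0 hc.
  by rewrite (cards0_eq En) big_set0.
have /card_gt0P[j0 j0S] : (0 < #|S|)%N by rewrite En.
have [j jS jmax] : exists2 j, j \in S & forall i, i \in S -> completion start i <= completion start j.
  by case: (@arg_maxP _ _ _ j0 (mem S) (completion start) j0S) => j jS H; exists j.
have pj : (0 : rat) < (ptime j)%:R by rewrite ltr0n.
rewrite (big_setD1 j) //= natrD addrC -lerBrDr.
have cj : start j <= c - (ptime j)%:R by rewrite lerBrDr; apply: hc.
apply: le_trans cj; apply: IH => [||||i].
- by move: En; rewrite (cardsD1 j S) jS => -[].
- by move=> i; rewrite in_setD1 => /andP[_ /h0].
- by move=> i i'; rewrite !in_setD1 => /andP[_ iS] /andP[_ iS']; apply: hd.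
- exact: h0.
(* Were [j] run before [i], then [i], of positive length, would complete later than [j]. *)
rewrite in_setD1 => /andP[ij iS]; case: (hd i j iS jS ij) => // H.
have pi : start i < completion start i by rewrite /completion ltrDl ltr0n.
by have := lt_le_trans pi (le_trans (jmax i iS) H); rewrite ltxx.
Qed.

End Interval.

Section CliqueSched.
Context (n K : nat) (E : seq (nat * nat)).
Context (Euniq : uniq E) (Ebound : forall e, e \in E -> (e.1 < n) && (e.2 < n)).

Let I := clique_sched n E K.
Let edge i := nth (0, 0) E i.

Lemma size_ptimes : size (ptimes I) = n + size E.
Proof. by rewrite size_cat !size_nseq. Qed.

Lemma job_lt (j : job I) : j < n + size E.
Proof. by case: j => j /=; rewrite size_cat !size_nseq. Qed.

Lemma ptime_job (j : job I) : ptime j = if j < n then (K * K).+1 else 1.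
Proof.
rewrite /ptime /= nth_cat size_nseq; case: ifP => jn; rewrite nth_nseq ?jn //.
by move: jn (job_lt j); case: (j : nat) => [|i] jn ji; rewrite ifT //; lia.
Qed.

Lemma arcP (a b : job I) :
  arc a b = (n <= b) && (((edge (b - n)).1 == a) || ((edge (b - n)).2 == a)).
Proof.
rewrite /arc; apply/flatten_mapP/andP => [[i]|[nb]].
  rewrite mem_iota => /= iE; rewrite !inE !xpair_eqE -/(edge i).
  case/orP=> /andP[/eqP -> /eqP ->]; rewrite leq_addr addKn eqxx ?orbT //.
have bE : b - n < size E by have := job_lt b; lia.
move=> H; exists (b - n); first by rewrite mem_iota.
rewrite !inE !xpair_eqE subnKC // !eqxx !andbT.
by case/orP: H => /eqP H; rewrite -![\val a]/(nat_of_ord a) -H /edge eqxx ?orbT.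
Qed.

Lemma arc_lt (a b : job I) : arc a b -> a < n <= b.
Proof.
rewrite arcP => /andP[nb H]; rewrite nb andbT.
have bE : b - n < size E by have := job_lt b; lia.
have /andP[h1 h2] := Ebound (mem_nth (0, 0) bE).
by case/orP: H => /eqP <-.
Qed.

(** Arcs lead only from vertex jobs to pair jobs, so no path has two arcs. *)
Lemma precE (a b : job I) : prec a b = arc a b.
Proof.
apply/existsP/idP => [[c /andP[ac /connectP[p]]]|ab]; last first.
  by exists b; rewrite ab connect0.
case: p => [|c' p] /=; first by move=> _ ->.
move=> /andP[/arc_lt /andP[cn _] _] _.
by case/andP: (arc_lt ac) => _; rewrite leqNgt cn.
Qed.

Lemma clique_sched_wf : wf_sched I.
Proof.
split.
- by move=> j; rewrite ptime_job; case: ifP.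
- move=> e /flatten_mapP[i]; rewrite mem_iota => /= iE; rewrite size_ptimes.
  have /andP[h1 h2] := Ebound (mem_nth (0, 0) iE).
  by rewrite !inE => /orP[] /eqP -> /=; rewrite ltn_add2l iE andbT; apply: ltn_addr.
move=> a; rewrite precE; apply/negP => /arc_lt /andP[an].
by rewrite leqNgt an.
Qed.

Section Selected.
Context (S : {set job I}).

Definition sel_verts : seq nat := [seq val j | j <- enum [set j in S | j < n]].
Definition sel_edges : seq (nat * nat) :=
  [seq edge (val j - n) | j <- enum [set j in S | ~~ (j < n)]].

Lemma uniq_sel_verts : uniq sel_verts.
Proof. by rewrite map_inj_uniq ?enum_uniq //; apply: val_inj. Qed.

Lemma uniq_sel_edges : uniq sel_edges.
Proof.
rewrite map_inj_in_uniq ?enum_uniq // => j j'.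
rewrite !mem_enum !inE -!leqNgt => /andP[_ jn] /andP[_ jn'] /eqP.
have jE : j - n < size E by have := job_lt j; lia.
have jE' : j' - n < size E by have := job_lt j'; lia.
rewrite /edge nth_uniq // => /eqP H; apply: val_inj.
by rewrite /= -(subnKC jn) -(subnKC jn'); congr (_ + _).
Qed.

Lemma card_selected : #|S| = size sel_verts + size sel_edges.
Proof.
rewrite !size_map -!cardE -(cardsID [set j : job I | j < n] S).
by congr (_ + _); apply: eq_card => j; rewrite !inE // andbC.
Qed.

Lemma cost_selected :
  \sum_(j in S) ptime j = size sel_verts * (K * K).+1 + size sel_edges.
Proof.
rewrite !size_map -!cardE (bigID (fun j : job I => j < n)) /=; congr (_ + _).
  rewrite -sum_nat_const; apply: eq_big => j; first by rewrite inE.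
  by case/andP=> _ jn; rewrite ptime_job jn.
rewrite -[RHS]muln1 -sum_nat_const; apply: eq_big => j; first by rewrite inE.
by case/andP=> _ /negPf jn; rewrite ptime_job jn.
Qed.

End Selected.

Lemma clique_of_schedule (S : {set job I}) start :
  schedule S start -> K + K * K <= #|S| -> makespan_le S start (cmax I) ->
  has_clique n E K.
Proof.
move=> [h0 hd hp] card span; have [pos _ _] := clique_sched_wf.
have := schedule_total pos h0 hd (ler0n _ _) span.
rewrite ler_nat cost_selected /=; rewrite card_selected in card => cost.
have sub : {subset sel_edges S <= [seq (u, v) | u <- sel_verts S, v <- sel_verts S]}.
  move=> e /mapP[j]; rewrite mem_enum !inE -leqNgt => /andP[jS jn] ->.
  have jE : j - n < size E by have := job_lt j; lia.
  have /andP[h1 h2] := Ebound (mem_nth (0, 0) jE).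
  have endpoint x : x < n -> ((edge (j - n)).1 == x) || ((edge (j - n)).2 == x) ->
      x \in sel_verts S.
    move=> xn H; have xI : x < size (ptimes I) by rewrite size_ptimes; lia.
    apply/mapP; exists (Ordinal xI) => //; rewrite mem_enum inE xn andbT.
    by have [] := hp (Ordinal xI) j jS; rewrite ?precE ?arcP ?jn.
  rewrite [edge _]surjective_pairing; apply: allpairs_f; apply: endpoint;
    by rewrite // eqxx ?orbT.
have := uniq_leq_size (uniq_sel_edges S) sub; rewrite size_allpairs => le_e.
have [cK eK] : size (sel_verts S) = K /\ size (sel_edges S) = K * K.
  move: (size (sel_verts S)) (size (sel_edges S)) card cost le_e => c e card cost le_e.
  (* Already [K + 1] vertices take [K * (K * K + 1) + K * K + 1], one unit too much. *)
  have cK : c <= K.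
    rewrite leqNgt; apply/negP => Kc.
    have : K.+1 * (K * K).+1 <= c * (K * K).+1 by rewrite leq_mul2r Kc orbT.
    by rewrite mulSn; lia.
  (* With [c < K] vertices at most [c * c] pairs are available, and [c + c * c < K + K * K]. *)
  have {}cK : c = K.
    apply/eqP; rewrite eqn_leq cK leqNgt; apply/negP => cK'.
    have : c * c <= c * K by rewrite leq_mul2l cK orbT.
    have : c.+1 * K <= K * K by rewrite leq_mul2r cK' orbT.
    by rewrite mulSn; lia.
  by subst c; split=> //; lia.
have sz : size [seq (u, v) | u <- sel_verts S, v <- sel_verts S] <= size (sel_edges S).
  by rewrite size_allpairs eK cK.
(* There are [K * K] selected pairs among the [K * K] ordered pairs of selected vertices, so every
   such pair is an edge. *)
have [_ Eq] := uniq_min_size (uniq_sel_edges S) sub sz.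
exists (sel_verts S); split=> //; first exact: uniq_sel_verts.
  by apply/allP => u /mapP[j]; rewrite mem_enum inE => /andP[_ jn] ->.
move=> u v us vs.
have : (u, v) \in sel_edges S by rewrite Eq; apply: allpairs_f.
case/mapP=> j; rewrite mem_enum inE -leqNgt => /andP[_ jn] ->.
by apply: mem_nth; rewrite -(ltn_add2l n) subnKC //; apply: job_lt.
Qed.

(** The selected jobs run without idle time in the order of their numbers. Vertex jobs have smaller
    numbers than pair jobs, which takes care of precedence, and the makespan is the total processing
    time. *)
Lemma schedule_of_clique : has_clique n E K ->
  exists (S : {set job I}) (start : job I -> rat),
    [/\ schedule S start, K + K * K <= #|S| & makespan_le S start (cmax I)].
Proof.
move=> [s [su ss /allP sn sE]].
pose P (j : nat) := if j < n then j \in s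
                    else ((edge (j - n)).1 \in s) && ((edge (j - n)).2 \in s).
pose S := [set j : job I | P j].
have szV : size (sel_verts S) = K.
  rewrite -ss; apply: perm_size; apply: uniq_perm; rewrite ?uniq_sel_verts // => x.
  apply/mapP/idP => [[j]|xs].
    by rewrite mem_enum !inE /P => /andP[+ jn] ->; rewrite jn.
  have xn := sn x xs; have xI : x < size (ptimes I) by rewrite size_ptimes; lia.
  by exists (Ordinal xI) => //; rewrite mem_enum !inE /P /= xn xs.
have szE : size (sel_edges S) = K * K.
  rewrite -ss -(size_allpairs pair); apply: perm_size; apply: uniq_perm.
  - exact: uniq_sel_edges.
  - by apply: allpairs_uniq => // -[? ?] [? ?] _ _ /= [-> ->].
  move=> e; apply/mapP/allpairsP => [[j]|[[u v] /= [us vs ->]]].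
    rewrite mem_enum !inE /P => /andP[+ jn] ->; rewrite (negPf jn) => /andP[h1 h2].
    by exists (edge (j - n)); split=> //; apply: surjective_pairing.
  have uvE := sE u v us vs.
  have iI : n + index (u, v) E < size (ptimes I).
    by rewrite size_ptimes ltn_add2l index_mem.
  have Ei : edge (n + index (u, v) E - n) = (u, v) by rewrite addKn /edge nth_index.
  exists (Ordinal iI); last by rewrite /= Ei.
  by rewrite mem_enum !inE /P /= ltnNge leq_addr /= Ei /= us vs.
pose before (j : nat) := \sum_(i in S | i < j) ptime i.
have step (i : job I) j : i \in S -> i < j -> before i + ptime i <= before j.
  move=> iS ij; rewrite /before [X in _ <= X](bigD1 i) /=; last by rewrite iS.
  rewrite addnC leq_add2l.
  rewrite [X in X <= _](eq_bigl (fun l => (l \in S) && (l < i) && ((l < j) && (l != i)))); last first.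
    move=> l; case: (l \in S) => //=; case: ltnP => //= li.
    by rewrite (ltn_trans li ij) neq_ltn li.
  rewrite [X in _ <= X](bigID (fun l : job I => l < i)) /=.
  apply: leq_trans (leq_addr _ _); rewrite leq_eqVlt; apply/orP; left; apply/eqP.
  by apply: eq_bigl => l; case: (l \in S); case: (l < i); case: (l < j); case: (l != i).
exists S, (fun j : job I => (before j)%:R%R).
have compl (j : job I) : completion (fun j : job I => (before j)%:R%R) j = (before j + ptime j)%:R%R.
  by rewrite /completion natrD.
split.
- split.
  + by move=> j _; apply: ler0n.
  + move=> i j iS jS ij; rewrite !compl !ler_nat.
    have : val i != val j by [].
    by rewrite neq_ltn => /orP[] H; [left | right]; apply: step.
  + move=> a b bS; rewrite precE => ab; have /andP[an nb] := arc_lt ab.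
    have aS : a \in S.
      move: bS ab; rewrite !inE arcP /P an ltnNge nb /= => /andP[h1 h2].
      by case/orP=> /eqP <-.
    by split=> //; rewrite compl ler_nat; apply: step => //; apply: leq_trans nb.
- by rewrite card_selected szV szE.
move=> j jS; rewrite compl ler_nat.
apply: leq_trans (step j (size (ptimes I)) jS (ltn_ord j)) _.
rewrite /before (eq_bigl (fun i => i \in S)); last by move=> i; rewrite ltn_ord andbT.
by rewrite cost_selected szV szE.
Qed.

Lemma sched_clique :
  k_sched_cmax (enc_sched I) (K + K * K) <-> has_clique n E K.
Proof.
split=> [[I' [/enc_sched_inj <- _ [S [start [h1 h2 h3]]]]]|/schedule_of_clique H].
  exact: clique_of_schedule h3.
by exists I; split=> //; apply: clique_sched_wf.
Qed.

End CliqueSched.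

Lemma reduction_correct d x k :
  WCS 1 d x k <-> k_sched_cmax (reduction d x k).1 (reduction d x k).2.
Proof.
rewrite WCS_clique /reduction; case: ifP => _ /=.
  rewrite sched_clique; first by split=> [[]|].
    exact: uniq_graph_edges.
  by move=> [u v]; rewrite mem_graph_edges => /and3P[-> ->].
split=> [[]//|].
(* The instance has no jobs, so not even one can be selected. *)
case=> I [/enc_sched_inj <- _ [S [start [_ + _]]]].
by rewrite leqNgt ltnS (leq_trans (max_card _)) // card_ord.
Qed.

(** * Registers of a program *)

(* All registers used by a program are smaller than this number. *)
Fixpoint nregs (p : prog) : nat :=
  match p with
  | Skip => 0
  | Push r _ | Pop r => r.+1
  | Seq p q => maxn (nregs p) (nregs q)
  | Case r pe p0 p1 => maxn r.+1 (maxn (nregs pe) (maxn (nregs p0) (nregs p1)))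
  | While r p => maxn r.+1 (nregs p)
  end.

Lemma exec_frame p st t st' r : exec p st t st' -> nregs p <= r -> st' r = st r.
Proof.
elim=> {p st t st'} //=; rewrite /upd.
- by move=> st i b; case: eqP => // ->; lia.
- by move=> st i; case: eqP => // ->; lia.
- by move=> p q st t st' u st'' _ IHp _ IHq; rewrite geq_max => /andP[/IHp <- /IHq ->].
- move=> i pe p0 p1 st t st' _ IH; rewrite !geq_max => /and4P[_ he h0 h1]; apply: IH.
  by case: (st i) => [|[] ?].
- move=> i p st t st' u st'' _ _ IHp _ IHw; rewrite geq_max => /andP[ir pr].
  by rewrite -(IHp pr) IHw // geq_max ir.
Qed.

(** A program obtained from [computable] may use any registers; renumbered, it runs above the four
    registers reserved for stack programs. *)
Fixpoint shift_prog (s : nat) (p : prog) : prog :=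
  match p with
  | Skip => Skip
  | Push r b => Push (s + r) b
  | Pop r => Pop (s + r)
  | Seq p q => Seq (shift_prog s p) (shift_prog s q)
  | Case r pe p0 p1 => Case (s + r) (shift_prog s pe) (shift_prog s p0) (shift_prog s p1)
  | While r p => While (s + r) (shift_prog s p)
  end.

Definition merge (s : nat) (lo hi : store) : store :=
  fun i => if i < s then lo i else hi (i - s).

Lemma merge_shift s lo hi r : merge s lo hi (s + r) = hi r.
Proof. by rewrite /merge ltnNge leq_addr addKn. Qed.

Lemma upd_merge s lo hi r x : upd (merge s lo hi) (s + r) x = merge s lo (upd hi r x).
Proof.
apply: functional_extensionality => i; rewrite /upd /merge.
case: ltnP => si; first by case: eqP => // E; rewrite E ltnNge leq_addr in si.
by rewrite -{1}(subnKC si) eqn_add2l.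
Qed.

Lemma exec_shift s lo p st t st' :
  exec p st t st' -> exec (shift_prog s p) (merge s lo st) t (merge s lo st').
Proof.
elim=> {p st t st'} /=.
- by move=> st; apply: exec_skip.
- move=> st r b; rewrite -upd_merge -(merge_shift s lo st r); exact: exec_push.
- move=> st r; rewrite -upd_merge -(merge_shift s lo st r); exact: exec_pop.
- by move=> p q st t st' u st'' _ IHp _ IHq; apply: exec_seq IHp IHq.
- move=> r pe p0 p1 st t st' _ IH; apply: exec_case; rewrite merge_shift.
  by case: (st r) IH => [|[] ?].
- by move=> r p st H; apply: exec_while_stop; rewrite merge_shift.
- move=> r p st t st' u st'' H _ IHp _ IHw; apply: exec_while_step IHp IHw.
  by rewrite merge_shift.
Qed.

Definition clear_regs (rs : seq nat) : prog :=
  foldr (fun r p => Seq (clear_reg r) p) Skip rs.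

Lemma runs_clear_regs rs st m : (forall r, size (st r) <= m) ->
  runs (clear_regs rs) st (fun i => if i \in rs then [::] else st i)
    (size rs * (2 * m + 1) + 1).
Proof.
elim: rs st => [|r rs IH] st Hm.
  by exists 1 => //; have -> : (fun i => if i \in [::] then [::] else st i) = st;
    [apply: functional_extensionality | apply: exec_skip].
apply: (@runs_weaken _ _ _ (2 * m + 1 + (size rs * (2 * m + 1) + 1))); last first.
  by rewrite /= mulSn addnA.
apply: (@runs_seq _ _ _ (upd st r [::])).
  by apply: runs_weaken (runs_clear r st) _; have := Hm r; lia.
have -> : (fun i => if i \in r :: rs then [::] else st i) =
          (fun i => if i \in rs then [::] else upd st r [::] i).
  apply: functional_extensionality => i; rewrite inE /upd.
  by case: (i == r) => //=; case: ifP.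
by apply: IH => i; rewrite /upd; case: ifP.
Qed.

(** * From raw registers to codes and back *)

(** Pushing 0 and then 1 turns the code of [m] into that of [m.+1]. *)
Definition encode_nat_loop (r : nat) : prog :=
  While r (Seq (Pop r) (Seq (Push 0 false) (Push 0 true))).

Lemma encode_nat1 k m s b c :
  runs (encode_nat_loop 1) (init [:: code m ++ s; unary k; b; c])
    (init [:: code (k + m) ++ s; [::]; b; c]) (4 * k + 1).
Proof.
elim: k m => [|k IH] m; first exact: runs_while_stop.
by rewrite addSnnS; apply: (runs_iter (m := 3)) (IH m.+1) _ => //; lia.
Qed.

Definition encode_bits_loop : prog :=
  While 2 (Case 2 Skip
    (Seq (Pop 2) (Seq (Push 0 false) (Push 0 true)))
    (Seq (Pop 2) (Seq (Seq (Push 0 false) (Seq (Push 0 false) (Push 0 true))) (Push 0 true)))).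

Lemma encode_bits x y s a c :
  runs encode_bits_loop (init [:: code (y : seq bool) ++ s; a; x; c])
    (init [:: code (catrev x y) ++ s; a; [::]; c]) (7 * size x + 1).
Proof.
elim: x y => [|b x IH] y; first exact: runs_while_stop.
apply: (runs_iter (m := 6)) (IH (b :: y)) _ => //; try by case: b.
by rewrite /=; lia.
Qed.

(** The stack is built from the bottom: the number, then the list, then the tag of the pair. Moving
    the bits to register 2 reverses them, and consing them one by one restores their order. *)
Definition encode_prog : prog :=
  Seq (shift_reg 0 2) (Seq (Push 0 false) (Seq (encode_nat_loop 1)
    (Seq (Push 0 false) (Seq encode_bits_loop (Push 0 true))))).

Lemma runs_encode x k :
  runs encode_prog (init [:: x; unary k]) (stk (code (x, k)))
    (11 * size x + 4 * k + 6).
Proof.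
have -> : init [:: x; unary k] = init [:: x; unary k; [::]; [::]].
  by apply: init_ext => -[|[|[|[|i]]]] //=; rewrite nth_nil.
apply: runs_weaken.
  apply: runs_seq; first exact: shift02.
  apply: runs_seq; first by apply: (runs_lf (n := 1) _ (erefl _)).
  apply: runs_seq; first exact: (@encode_nat1 k 0 [::]).
  apply: runs_seq; first by apply: (runs_lf (n := 1) _ (erefl _)).
  apply: runs_seq; first exact: (@encode_bits (catrev x [::]) [::] (code (k + 0) ++ [::])).
  apply: (runs_lf (n := 1)) => //=.
  by rewrite addn0 cats0 (revK x : catrev (catrev x [::]) [::] = x).
by rewrite (size_rev x : size (catrev x [::]) = size x); lia.
Qed.

Definition decode_nat_loop (r : nat) : prog :=
  While 3 (Case 0 Skip (Seq (Pop 0) (Pop 3)) (Seq (Pop 0) (Seq (Pop 0) (Push r true)))).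

Lemma decode_nat1 k m s b :
  runs (decode_nat_loop 1) (init [:: code k ++ s; unary m; b; [:: true]])
    (init [:: s; unary (k + m); b; [::]]) (5 * k + 5).
Proof.
elim: k m => [|k IH] m.
  by apply: (@runs_iter 3 _ _ _ [:: s; unary m; b; [::]] _ 1) => //; apply: runs_while_stop.
rewrite addSnnS; apply: (@runs_iter 4 _ _ _ _ _ _ _ _ _ _ _ (IH m.+1)) => //; lia.
Qed.

Definition decode_bits_loop : prog :=
  While 3 (Case 0 Skip (Seq (Pop 0) (Pop 3))
    (Seq (Pop 0) (Case 0 Skip (Seq (Pop 0) (Push 2 false))
       (Seq (Seq (Pop 0) (Seq (Pop 0) (Pop 0))) (Push 2 true))))).

Lemma decode_bits (x y : seq bool) s a :
  runs decode_bits_loop (init [:: code x ++ s; a; y; [:: true]])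
    (init [:: s; a; catrev x y; [::]]) (8 * size x + 5).
Proof.
elim: x y => [|b x IH] y.
  by apply: (@runs_iter 3 _ _ _ [:: s; a; y; [::]] _ 1) => //; apply: runs_while_stop.
apply: (@runs_iter 7 _ _ _ _ _ _ _ _ _ _ _ (IH (b :: y))) => //; try by case: b.
by rewrite /=; lia.
Qed.

Definition decode_prog : prog :=
  Seq (Pop 0) (Seq (Push 3 true) (Seq decode_bits_loop
    (Seq (Push 3 true) (Seq (decode_nat_loop 1) (shift_reg 2 0))))).

Lemma runs_decode x k :
  runs decode_prog (stk (code (x, k))) (init [:: x; unary k])
    (12 * size x + 5 * k + 14).
Proof.
have -> : init [:: x; unary k] = init [:: x; unary k; [::]; [::]].
  by apply: init_ext => -[|[|[|[|i]]]] //=; rewrite nth_nil.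
apply: runs_weaken.
  apply: runs_seq; first by apply: (runs_lf (n := 1) _ (erefl _)).
  apply: runs_seq; first by apply: (runs_lf (n := 1) _ (erefl _)).
  apply: runs_seq; first exact: (@decode_bits x [::] (code k) [::]).
  apply: runs_seq; first by apply: (runs_lf (n := 1) _ (erefl _)).
  apply: runs_seq.
    rewrite /= -[code k]cats0; exact: (@decode_nat1 k 0 [::]).
  rewrite -{2}[x]revK -[rev (rev x)]cats0 -catrevE addn0 catrevE cats0.
  exact: shift20.
by rewrite size_rev; lia.
Qed.

(** * Computable functions *)

(** Computability on codes, without a time bound. Unlike [computable], it allows pairs and arbitrary
    codable types, which is needed to assemble the time bound of the final reduction. *)
Definition cmp A B {cA : codable A} {cB : codable B} (f : A -> B) : Prop :=
  exists p, forall a s, exists n, runs p (stk (code a ++ s)) (stk (code (f a) ++ s)) n.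

Lemma PT_cmp A B {cA : codable A} {cB : codable B} (f : A -> B) : PT f -> cmp f.
Proof. by move=> [p [T [Hp _]]]; exists p => a s; exists (T a). Qed.

Lemma cmp_comp A B C {cA : codable A} {cB : codable B} {cC : codable C}
    (f : A -> B) (g : B -> C) : cmp f -> cmp g -> cmp (fun a => g (f a)).
Proof.
move=> [p Hp] [q Hq]; exists (Seq p q) => a s.
have [m Hm] := Hp a s; have [l Hl] := Hq (f a) s.
by exists (m + l); apply: runs_seq Hm Hl.
Qed.

Lemma cmp_pair A B C {cA : codable A} {cB : codable B} {cC : codable C}
    (f : A -> B) (g : A -> C) : cmp f -> cmp g -> cmp (fun a => (f a, g a)).
Proof.
move=> [p Hp] [q Hq]; exists (pair_prog p q) => a s.
have [m Hm] := Hp a (code a ++ s); have [l Hl] := Hq a (code (f a) ++ s).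
eexists; apply: runs_seq; first exact: runs_dup.
apply: runs_seq; first exact: Hm.
apply: runs_seq; first exact: runs_swap.
apply: runs_seq; first exact: Hl.
apply: runs_seq; first exact: runs_swap.
by rewrite /stk /code /= -catA; apply: (runs_lf (n := 1)).
Qed.

Lemma cmp_computable (f : nat -> nat) : cmp f -> computable f.
Proof.
move=> [p Hp].
pose P := Seq (Seq (shift_reg 0 2) (Seq (Push 0 false) (Seq (shift_reg 2 1) (encode_nat_loop 1))))
  (Seq p (Seq (Push 3 true) (Seq (decode_nat_loop 1) (shift_reg 1 0)))).
exists P => n; have [m Hm] := Hp n [::].
suff [l [t H _]] : exists l, runs P (init [:: unary n]) (stk (unary (f n))) l.
  by exists t, (stk (unary (f n))).
have rn j : rev (unary j) = unary j by apply: rev_nseq.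
eexists; rewrite -stkE; apply: runs_seq.
  apply: runs_seq; first exact: shift02.
  apply: runs_seq; first by apply: (runs_lf (n := 1) _ (erefl _)).
  apply: runs_seq; first exact: shift21.
  rewrite !catrevE !cats0 !rn; exact: (@encode_nat1 n 0 [::]).
rewrite addn0; apply: runs_seq; first exact: Hm.
apply: runs_seq; first by apply: (runs_lf (n := 1) _ (erefl _)).
apply: runs_seq; first exact: (@decode_nat1 (f n) 0 [::]).
rewrite addn0 -[unary (f n) in X in runs _ _ X](rn (f n)) -[rev _]cats0 -catrevE.
exact: shift10.
Qed.

Lemma encode_nat4 k m s :
  runs (encode_nat_loop 4) (init [:: code m ++ s; [::]; [::]; [::]; unary k])
    (stk (code (k + m) ++ s)) (4 * k + 1).
Proof.
elim: k m => [|k IH] m.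
  have -> : stk (code (0 + m) ++ s) = init [:: code m ++ s; [::]; [::]; [::]; unary 0].
    by apply: init_ext => -[|[|[|[|[|i]]]]] //=; rewrite !nth_nil.
  exact: runs_while_stop.
by rewrite addSnnS; apply: (runs_iter (m := 3)) (IH m.+1) _ => //; lia.
Qed.

Lemma decode_nat4 k m s :
  runs (decode_nat_loop 4) (init [:: code k ++ s; [::]; [::]; [:: true]; unary m])
    (init [:: s; [::]; [::]; [::]; unary (k + m)]) (5 * k + 5).
Proof.
elim: k m => [|k IH] m.
  by apply: (@runs_iter 3 _ _ _ [:: s; [::]; [::]; [::]; unary m] _ 1) => //;
     apply: runs_while_stop.
rewrite addSnnS; apply: (@runs_iter 4 _ _ _ _ _ _ _ _ _ _ _ (IH m.+1)) => //; lia.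
Qed.

(** The argument is decoded into register 4, which is register 0 of the shifted program; whatever
    else that program leaves behind must be erased to return to a pure stack. *)
Lemma computable_cmp (f : nat -> nat) : computable f -> cmp f.
Proof.
move=> [p Hp].
exists (Seq (Seq (Push 3 true) (decode_nat_loop 4)) (Seq (shift_prog 4 p)
  (Seq (clear_regs (iota 5 (nregs p))) (Seq (Push 0 false) (encode_nat_loop 4))))) => n s.
have [t [st [Hexec Hst]]] := Hp n.
have E0 : init [:: s; [::]; [::]; [::]; unary (n + 0)] = merge 4 (stk s) (init [:: unary n]).
  rewrite addn0; apply: functional_extensionality => -[|[|[|[|[|i]]]]] //=.
eexists; apply: runs_seq.
  apply: runs_seq; last exact: (@decode_nat4 n 0 s).
  have -> : stk (code n ++ s) = init [:: code n ++ s; [::]; [::]; [::]; unary 0].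
    by apply: init_ext => -[|[|[|[|[|i]]]]] //=; rewrite !nth_nil.
  by apply: (runs_lf (n := 1)).
rewrite E0; apply: runs_seq.
  by exists t; [apply: exec_shift Hexec | apply: leqnn].
(* Register 4 holds the result, and the shifted program uses only registers below [4 + nregs p], so
   clearing [iota 5 (nregs p)] is enough. *)
have E1 : (fun i => if i \in iota 5 (nregs p) then [::] else merge 4 (stk s) st i) =
    init [:: s; [::]; [::]; [::]; unary (f n)].
  apply: functional_extensionality => i; rewrite mem_iota.
  case: (ltnP i 5) => [|i5] /=; first by case: i => [|[|[|[|[|i]]]]].
  rewrite /init nth_default //; case: ltnP => // ip.
  rewrite /merge ltnNge (leq_trans _ i5) //= (exec_frame Hexec) //; last by lia.
  by rewrite /init nth_default //=; lia.
apply: runs_seq.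
  apply: (@runs_clear_regs _ _ (size s + (n + t))) => r.
  rewrite /merge; case: ifP => r4.
    by case: r r4 => [|[|[|[|r]]]] //= _; rewrite leq_addr.
  apply: leq_trans (exec_size _ Hexec) _; rewrite [leqRHS]addnA leq_add2r.
  rewrite /init; case: (r - 4) => [|i]; first by rewrite /= size_nseq leq_addl.
  by rewrite nth_default.
rewrite E1; apply: runs_seq; first by apply: (runs_lf (n := 1) _ (erefl _)).
by have := @encode_nat4 (f n) 0 s; rewrite addn0; apply.
Qed.

(** * Computing the padding, and the whole reduction *)

Definition exp_step (s : seq unit * nat) : seq unit * nat := (behead s.1, s.2 + s.2).

Lemma iter_exp_stepE n i m : i <= n ->
  iter i exp_step (nseq n tt, m) = (nseq (n - i) tt, 2 ^ i * m).
Proof.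
elim: i => [|i IH] ni; first by rewrite subn0 mul1n.
rewrite iterS IH ?(ltnW ni) // /exp_step /= addnn -mul2n mulnA expnS.
by rewrite -[n - i]prednK ?subn_gt0 //= -subnS.
Qed.

Lemma csize_nseq_tt n : csize (nseq n tt) = csize n.
Proof. by rewrite /csize /code; congr (size (tcode _)); elim: n => //= n ->. Qed.

(** Repeated doubling is polynomial in the result but not in the argument, so it lies outside [PT]
    and its running time is stated separately; all intermediate numbers stay below [2 ^ n]. *)
Lemma runs_exp2 : exists p c, forall n s,
  runs p (stk (code n ++ s)) (stk (code (2 ^ n) ++ s)) ((2 ^ n + 5) ^ c).
Proof.
have [p [T [Hp [c bT]]]] : PT exp_step by rewrite /exp_step; pt.
have [p0 [T0 [Hp0 [c0 bT0]]]] : PT (fun n : nat => (nseq n tt, 1)) by pt.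
have [p2 [T2 [Hp2 [c2 bT2]]]] : PT (fun s : seq unit * nat => s.2) by pt.
pose U y := (2 * y + 3) ^ c0 + ((y + 1) * ((4 * y + 5) ^ c + 8) + 2) + (2 * y + 5) ^ c2.
(* [pbnd] over [nat] only serves to collapse the expression [U] into a single power; the exponent
   doubles since [2 * y + 3 <= (y + 5) ^ 2]. *)
have [e He] : pbnd U by rewrite /U; pb; apply: (pbnd_le pbnd_csize) => n; rewrite csize_nat; lia.
exists (Seq p0 (Seq (loop_prog p) p2)), (2 * e) => n s.
have n2 : n < 2 ^ n := ltn_expl n (ltnSn 1).
apply: (@runs_weaken _ _ _ (U (2 ^ n))); last first.
  apply: leq_trans (He _) _; rewrite csize_nat expnM.
  case: (e) => // e'; rewrite leq_exp2r //; nia.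
have Eend : iter n exp_step (nseq n tt, 1) = ([::], 2 ^ n).
  by rewrite iter_exp_stepE // subnn muln1.
rewrite /U -addnA; apply: runs_seq.
  apply: runs_weaken (Hp0 n s) _; apply: leq_trans (bT0 n) _.
  case: (c0) => // c'; rewrite leq_exp2r // csize_nat; lia.
apply: (@runs_seq _ _ _ (stk (code (([::] : seq unit), 2 ^ n) ++ s))).
  rewrite -Eend; apply: runs_weaken.
    have := @runs_loop _ _ _ _ exp_step p T ((4 * 2 ^ n + 5) ^ c) (nseq n tt, 1) s Hp.
    rewrite /= size_nseq; apply; first by move=> [l m] /=; rewrite size_behead.
    move=> i ni; apply: leq_trans (bT _) _; rewrite iter_exp_stepE ?(ltnW ni) //.
    case: (c) => // c'; rewrite leq_exp2r // csize_pair csize_nseq_tt !csize_nat muln1.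
    have : 2 ^ i <= 2 ^ n by rewrite leq_exp2l // ltnW.
    lia.
  by rewrite leq_add2r leq_mul2r; apply/orP; right; lia.
apply: runs_weaken (Hp2 _ s) _; apply: leq_trans (bT2 _) _.
case: (c2) => // c'; rewrite leq_exp2r // csize_pair csize_nat.
have -> : csize ([::] : seq unit) = 1 by [].
lia.
Qed.

Lemma cmp_exp2 : cmp (fun n : nat => 2 ^ n).
Proof. by have [p [c H]] := runs_exp2; exists p => n s; exists ((2 ^ n + 5) ^ c). Qed.

(** Writing the padding is the only stage not polynomial in the original input; its cost is
    polynomial in [padding], a function of the parameter alone. A [param] has the code of a pair, so
    a program for pairs serves. *)
Lemma computes_param : exists p c,
  computes p (fun i : seq bool * nat => (i.1, Param i.2))
    (fun i => (csize i.1 + i.2 + padding i.2 + 5) ^ c).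
Proof.
have [pe [ce He]] := runs_exp2.
have [p0 [T0 [Hp0 [c0 bT0]]]] : PT (fun i : seq bool * nat => i.2.+1 * i.2.+1) by pt.
have [p1 [T1 [Hp1 [c1 bT1]]]] : PT (fun i : seq bool * nat => i.1) by pt.
have [p2 [T2 [Hp2 [c2 bT2]]]] : PT (fun i : seq bool * nat => i.2) by pt.
have Hpe : computes pe (fun n : nat => 2 ^ n) (fun n => (2 ^ n + 5) ^ ce) by [].
have H := computes_pair Hp1 (computes_pair Hp2 (computes_comp Hp0 Hpe)).
pose U y := 200 * y + 100 + (2 * y + 2) ^ c1 + (2 * y + 2) ^ c2 + (2 * y + 2) ^ c0 + y ^ ce.
have [e He'] : pbnd U by rewrite /U; pb; apply: (pbnd_le pbnd_csize) => n; rewrite csize_nat; lia.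
eexists; exists (2 * e) => i s; apply: runs_weaken (H i s) _ => {H}.
rewrite -/(padding i.2); set W := csize i.1 + i.2 + padding i.2 + 5.
apply: (@leq_trans (U W)); last first.
  apply: leq_trans (He' _) _; rewrite csize_nat expnM.
  case: (e) => // e'; rewrite leq_exp2r //; nia.
have ci : csize i <= 2 * W by case: (i) @W => x k W; rewrite csize_pair csize_nat /W /=; lia.
have bound c T : T i <= (csize i).+2 ^ c -> T i <= (2 * W + 2) ^ c.
  by move=> H; apply: leq_trans H _; case: (c) => // c'; rewrite leq_exp2r //; lia.
have := bound _ _ (bT0 i); have := bound _ _ (bT1 i); have := bound _ _ (bT2 i).
have : (padding i.2 + 5) ^ ce <= W ^ ce.
  by case: (ce) => // c'; rewrite leq_exp2r // /W; lia.
rewrite /U !csize_pair !csize_nat.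
have : csize i.1 + i.2 + padding i.2 + 5 <= W by [].
move: (_ ^ c0) (_ ^ c1) (_ ^ c2) (_ ^ ce) (_ ^ ce) => x0 x1 x2 x3 x4.
move: (T0 i) (T1 i) (T2 i) => t0 t1 t2.
move: (csize i) ci (csize i.1) (padding i.2) => z ci z1 pd.
lia.
Qed.

Lemma runs_reduction d : exists p c, forall x k,
  runs p (init [:: x; unary k])
    (init [:: (reduction d x k).1; unary (reduction d x k).2])
    ((size x + k + padding k + 5) ^ c).
Proof.
have [p1 [c1 H1]] := computes_param.
have [p2 [T2 [H2 [c2 bT2]]]] := PT_reduction d.
pose U y := 400 * y + 200 + (6 * y) ^ c1 + 20 * (20 * y) ^ c2.
have [e He] : pbnd U by rewrite /U; pb; apply: (pbnd_le pbnd_csize) => n; rewrite csize_nat; lia.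
exists (Seq encode_prog (Seq p1 (Seq p2 decode_prog))), (2 * e) => x k.
set W := size x + k + padding k + 5.
apply: (@runs_weaken _ _ _ (U W)); last first.
  apply: leq_trans (He _) _; rewrite csize_nat expnM.
  case: (e) => // e'; rewrite leq_exp2r //; nia.
have cx := csize_bits x.
set i := (x, Param k).
have ci : csize i + 2 <= 20 * W.
  have -> : csize i = csize (x, (k, padding k)) by [].
  by rewrite !csize_pair !csize_nat /W; lia.
have cT : T2 i <= (20 * W) ^ c2.
  apply: leq_trans (bT2 i) _; case: (c2) => // c'; rewrite leq_exp2r //; lia.
have co : csize (reduction d x k) <= csize i + T2 i := computes_csize i H2.
rewrite [reduction d x k]surjective_pairing csize_pair csize_nat in co.
have so := @size_csize bool codable_bool (reduction d x k).1.
apply: runs_weaken.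
  apply: runs_seq; first exact: runs_encode.
  apply: runs_seq; first by rewrite -[code _]cats0; exact: (H1 (x, k)).
  apply: runs_seq; first exact: (H2 i).
  rewrite cats0 [reduction _ _ _]surjective_pairing; exact: runs_decode.
have c1W : (csize x + k + padding k + 5) ^ c1 <= (6 * W) ^ c1.
  by case: (c1) => // c'; rewrite leq_exp2r // /W; lia.
move: co so cT c1W; rewrite /U /i /=.
move: (_ ^ c1) (_ ^ c1) (_ ^ c2) (T2 _) => y1 y2 y3 y4.
move: (size (reduction d x k).1) (csize (reduction d x k).1) ((reduction d x k).2) => a b c.
move: ci; rewrite -/i; move: (csize i) => z ci.
have : size x + k + padding k + 5 <= W by [].
lia.
Qed.

(** Monotonicity is needed because the first reduction controls its new parameter only by an upper
    bound. *)
Lemma reduction_param_le d x k m : k <= m ->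
  (reduction d x k).2 <= nclasses d m + nclasses d m * nclasses d m + 1.
Proof.
move=> km; have nc : nclasses d k <= nclasses d m.
  by rewrite /nclasses leq_exp2r ?expn_gt0 // ltnS.
rewrite /reduction; case: ifP => _ /=; last by rewrite addn1.
by rewrite addn1 leqW // leq_add // leq_mul.
Qed.

(** The given reduction to weft 1 circuits is followed by [reduction]. Its program may leave data in
    any of its registers, so those other than the two holding the output are emptied in between. *)
Theorem theorem12 : W_hard 1 k_sched_cmax.
Proof.
move=> P [d _ [p1 [f1 [g1 [c1 [cf cg Hred]]]]]].
have [p2 [c2 H2]] := runs_reduction d.
pose m := nregs p1.
pose F k := k + f1 k + g1 k + padding (g1 k) + m + 20.
pose g k := nclasses d (g1 k) + nclasses d (g1 k) * nclasses d (g1 k) + 1.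
have cmpg := computable_cmp cg; have cmpf := computable_cmp cf.
have cmppad : cmp (fun k => padding (g1 k)).
  apply: (cmp_comp (f := fun k => (g1 k).+1 * (g1 k).+1) _ cmp_exp2).
  by apply: (cmp_comp (g := fun y : nat => y.+1 * y.+1) cmpg); apply: PT_cmp; pt.
(* With [N = (size x).+1 ^ c1.+1], the quantities to be bounded add up to at most [N * F k].
   Clearing multiplies this by [m <= F k], and the second program raises it to the power [c2]; the
   two further factors in [c2.+2] absorb the sum of the costs. The successor in [c1.+1] ensures
   [size x <= N]. *)
exists (Seq p1 (Seq (clear_regs (iota 2 m)) p2)), (fun k => (4 * F k * F k) ^ c2.+2), g, (c1.+1 * c2.+2).
split.
- apply: cmp_computable.
  apply: (cmp_comp (f := fun k => (k, (f1 k, (g1 k, padding (g1 k)))))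
    (g := fun y => (4 * (y.1 + y.2.1 + y.2.2.1 + y.2.2.2 + m + 20) *
                    (y.1 + y.2.1 + y.2.2.1 + y.2.2.2 + m + 20)) ^ c2.+2)).
    by apply: cmp_pair (PT_cmp PT_id) (cmp_pair cmpf (cmp_pair cmpg cmppad)).
  by apply: PT_cmp; pt.
- apply: cmp_computable; apply: (cmp_comp (g := fun y : nat =>
    nclasses d y + nclasses d y * nclasses d y + 1) cmpg).
  by apply: PT_cmp; rewrite /nclasses; pt.
move=> x k; have [x1 [k1 [t1 [st1 [Hex [Hx Hk] tb kb Heq]]]]] := Hred x k.
have sz1 r : size (st1 r) <= size x + k + t1.
  apply: leq_trans (exec_size r Hex) _; rewrite leq_add2r /init.
  case: r => [|[|r]] /=; rewrite ?nth_nil ?size_nseq ?leq_addr ?leq_addl //.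
(* Registers from [m] on are untouched by [p1] and initially empty, apart from the first two, which
   hold the output. *)
have clean : (fun i => if i \in iota 2 m then [::] else st1 i) = init [:: x1; unary k1].
  apply: functional_extensionality => i; rewrite mem_iota.
  case: i => [|[|i]]; [exact: Hx | exact: Hk |].
  rewrite [RHS]nth_default //; case: ifP => // /negbT mi.
  by rewrite (exec_frame Hex) ?[LHS]nth_default //; move: mi; rewrite -/m; lia.
have sx1 : size x1 <= size x + k + t1 by rewrite -Hx.
have [t Ht tle] : runs (Seq p1 (Seq (clear_regs (iota 2 m)) p2)) (init [:: x; unary k])
    (init [:: (reduction d x1 k1).1; unary (reduction d x1 k1).2])
    (t1 + ((m * (2 * (size x + k + t1) + 1) + 1) + (size x1 + k1 + padding k1 + 5) ^ c2)).
  apply: runs_seq; first by exists t1; [exact: Hex | exact: leqnn].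
  apply: runs_seq (H2 x1 k1); rewrite -clean.
  by have := @runs_clear_regs (iota 2 m) st1 _ sz1; rewrite size_iota.
exists (reduction d x1 k1).1, (reduction d x1 k1).2, t.
eexists; split; [exact: Ht | by [] | | exact: reduction_param_le |]; last first.
  by rewrite Heq reduction_correct.
apply: leq_trans tle _.
set n := (size x).+1; set N := n ^ c1.+1.
have N0 : 0 < N by rewrite expn_gt0.
have xN : size x <= N.
  by rewrite /N expnS; apply: (@leq_trans n) => //; rewrite leq_pmulr // expn_gt0.
have tN : t1 <= f1 k * N.
  apply: leq_trans tb _; rewrite leq_mul2l; apply/orP; right.
  by rewrite leq_pexp2l.
have pk : padding k1 <= padding (g1 k).
  by rewrite /padding leq_exp2l // leq_mul // ltnS.
pose y := N * F k.
have yb : size x + k + t1 + k1 + padding k1 + m + 10 <= y.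
  have kN j : j <= j * N by rewrite leq_pmulr.
  have := kN k; have := kN k1; have := kN (padding k1); have := kN m.
  have : k1 * N <= g1 k * N by rewrite leq_mul2r kb orbT.
  have : padding k1 * N <= padding (g1 k) * N by rewrite leq_mul2r pk orbT.
  by rewrite /y /F !mulnDr ![N * _]mulnC; lia.
have y0 : 0 < y by lia.
have Fy : F k <= y by rewrite /y leq_pmull.
apply: (@leq_trans ((4 * F k * y) ^ c2.+2)); last first.
  rewrite expnM -/N -expnMn; rewrite leq_exp2r // /y; apply: eq_leq.
  by rewrite [N * F k]mulnC mulnA.
have p0 : (size x1 + k1 + padding k1 + 5) ^ c2 <= (2 * y) ^ c2.
  by case: (c2) => // c'; rewrite leq_exp2r //; lia.
have F20 : 20 <= F k by rewrite /F; lia.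
have mF : m <= F k by rewrite /F; lia.
have p1' : (2 * y) ^ c2 <= (4 * F k * y) ^ c2.
  by case: (c2) => // c'; rewrite leq_exp2r //; nia.
rewrite !expnS; have := expn_gt0 (4 * F k * y) c2.
move: p0 p1' yb sx1; move: ((4 * F k * y) ^ c2) ((2 * y) ^ c2) (_ ^ c2) => a b e.
move=> eb ba yb sx1 a0.
have {}a0 : 0 < a by rewrite a0 muln_gt0 y0 andbT muln_gt0 (leq_trans _ F20).
have mS : m * (2 * (size x + k + t1) + 1) <= F k * (2 * y) by apply: leq_mul; lia.
have yF : 20 * y <= F k * y by rewrite leq_mul2r F20 orbT.
rewrite mulnCA in mS; have -> : 4 * F k * y = 4 * (F k * y) by rewrite mulnA.
move: (F k * y) (m * _) yF mS => G M yF mS.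
have h1 : 4 * G <= 4 * G * a by rewrite leq_pmulr.
have h2 : a <= 4 * G * a by rewrite leq_pmull //; lia.
have h3 : 2 * (4 * G * a) <= 4 * G * (4 * G * a) by rewrite leq_mul2r; apply/orP; right; lia.
lia.
Qed.
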